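(* Assume that $V$ is self-adjoint with $|V(x)|\lesssim\langle x\rangle^{-\beta}$ for some $\beta>2$. Fix $\phi\in S_1L^2$ and let $\psi=-\mathcal G_{0,0}v^*\phi$, so that $\phi=Uv\psi$. Then $\phi\in S_2L^2$ if and only if $\psi\in L^2$.
   Context: Functions are $\mathbb C^2$-valued on $\mathbb R^2$ and $L^p$ means $L^p(\mathbb R^2;\mathbb C^2)$. $\alpha\cdot x=\alpha_1x_1+\alpha_2x_2$ with $\alpha_1=\begin{pmatrix}0&1\\1&0\end{pmatrix}$, $\alpha_2=\begin{pmatrix}0&-i\\ i&0\end{pmatrix}$; $V:\mathbb R^2\to\mathbb C^{2\times2}$ is Hermitian matrix valued. $\langle x\rangle=(1+|x|^2)^{1/2}$, and $|V(x)|\lesssim\langle x\rangle^{-\beta}$ means every entry satisfies this bound with some constant. Diagonalize $V=B^*\,\mathrm{diag}(\zeta_1,\zeta_2)B$ pointwise with $B(x)$ unitary, $\zeta_j(x)\in\mathbb R$; put $\eta_j=|\zeta_j|^{1/2}$, $v=\mathrm{diag}(\eta_1,\eta_2)B$, $U=\mathrm{diag}(\mathrm{sign}\,\zeta_1,\mathrm{sign}\,\zeta_2)$ (with $\mathrm{sign}\,0:=1$), so $V=v^*Uv$. $\mathcal G_{0,0}$ is the integral operator with kernel $\frac{i\alpha\cdot(x-y)}{2\pi|x-y|^2}$; $\mathcal G_{1,1}$ is the integral operator with kernel $1$ (times the identity matrix). $T=U+v\mathcal G_{0,0}v^*$ on $L^2$, $S_1$ is the (finite rank) Riesz projection onto $\ker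 T$, and $S_2\le S_1$ is the Riesz projection onto the kernel of $S_1v\mathcal G_{1,1}v^*S_1$ in $S_1L^2$. *)

(* Defs.v *)
From HB Require Import structures.
From mathcomp Require Import all_boot all_order all_algebra.
From mathcomp Require Import sesquilinear spectral.
From mathcomp Require Import all_classical all_reals all_analysis.
From mathcomp Require Import complex.

Set Implicit Arguments.
Unset Strict Implicit.
Unset Printing Implicit Defensive.

Import Order.TTheory GRing.Theory Num.Theory.
Import numFieldNormedType.Exports.

Local Open Scope classical_set_scope.
Local Open Scope ring_scope.
Local Open Scope sesquilinear_scope.
Local Open Scope complex_scope.

Notation plane R := (measurableTypeR R * measurableTypeR R)%type.
(* Everywhere-defined representatives: equality in L^2 is [aeq] below. *)
Notation vfield R := (plane R -> 'cV[R[i]]_2).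
Notation mfield R := (plane R -> 'M[R[i]]_2).

Section Defs.
Variable R : realType.

Definition mu2 : {measure set (plane R) -> \bar R} :=
  ((@lebesgue_measure R) \x (@lebesgue_measure R))%E.

Definition aeq (f g : vfield R) : Prop := \forall x \ae mu2, f x = g x.

Definition cintegral d (X : measurableType d) (mu : {measure set X -> \bar R})
    (D : set X) (F : X -> R[i]) : R[i] :=
  (\int[mu]_(x in D) complex.Re (F x)) +i* (\int[mu]_(x in D) complex.Im (F x)).

Definition measurable_mx (M : mfield R) : Prop := forall i j,
  measurable_fun setT (fun x => complex.Re (M x i j)) /\
  measurable_fun setT (fun x => complex.Im (M x i j)).

Definition L2 : set (vfield R) := [set f | forall i,
  (fun x => complex.Re (f x i 0)) \in Lfun mu2 2%:E /\
  (fun x => complex.Im (f x i 0)) \in Lfun mu2 2%:E].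

(* Linear in the first argument. *)
Definition inner (f g : vfield R) : R[i] :=
  cintegral mu2 setT (fun x => \sum_(i < 2) f x i 0 * (g x i 0)^*).

Definition norm2 (f : vfield R) : R := Num.sqrt (complex.Re (inner f f)).

Definition sqnorm (x : plane R) : R := x.1 ^+ 2 + x.2 ^+ 2.

Definition japanese (x : plane R) : R := Num.sqrt (1 + sqnorm x).

Definition alpha1 : 'M[R[i]]_2 :=
  \matrix_(i, j) (if i == j then 0 else 1).

Definition alpha2 : 'M[R[i]]_2 :=
  \matrix_(i, j) (if i == j then 0 else if i == 0 then - 'i%C else 'i%C).

Definition alpha_dot (x : plane R) : 'M[R[i]]_2 :=
  (x.1)%:C *: alpha1 + (x.2)%:C *: alpha2.

(* [Rintegral] is total with junk value where the integral does not exist; on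
   the functions v^* f with f in L^2 and |V| <= C <x>^-beta, beta > 2, the
   integrals for [G00] converge absolutely for almost every x, and those for
   [G11] always converge absolutely. *)
Definition integral_op (K : plane R -> plane R -> 'M[R[i]]_2) (f : vfield R) :
    vfield R :=
  fun x => \col_i cintegral mu2 setT (fun y => (K x y *m f y) i 0).

Definition G00 : vfield R -> vfield R := integral_op (fun x y =>
  ('i%C / (2 * pi * sqnorm (x - y))%:C) *: alpha_dot (x - y)).

Definition G11 : vfield R -> vfield R := integral_op (fun _ _ => 1%:M).

Definition pwmul (M : mfield R) (f : vfield R) : vfield R :=
  fun x => M x *m f x.

Definition pwadj (M : mfield R) : mfield R := fun x => (M x)^t*.

Definition pwdiag (d : 'I_2 -> plane R -> R) : mfield R :=
  fun x => diag_mx (\row_j (d j x)%:C).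

(* [V = B^* pwdiag(zeta_0, zeta_1) B] pointwise, with measurable data. *)
Definition diagonalization (V : mfield R) (zeta : 'I_2 -> plane R -> R)
    (B : mfield R) : Prop :=
  [/\ forall j, measurable_fun setT (zeta j),
      measurable_mx B,
      forall x, B x \is unitarymx &
      forall x, V x = pwadj B x *m pwdiag zeta x *m B x].

Definition vop (zeta : 'I_2 -> plane R -> R) (B : mfield R) : mfield R :=
  fun x => pwdiag (fun j y => Num.sqrt `|zeta j y|) x *m B x.

(* [Num.sg 0 = 0], whereas here the sign of 0 is 1. *)
Definition Uop (zeta : 'I_2 -> plane R -> R) : mfield R :=
  pwdiag (fun j y => if 0 <= zeta j y then 1 else -1).

Definition Top (zeta : 'I_2 -> plane R -> R) (B : mfield R) (f : vfield R) :
    vfield R :=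
  fun x => pwmul (Uop zeta) f x
           + pwmul (vop zeta B) (G00 (pwmul (pwadj (vop zeta B)) f)) x.

Definition T1op (zeta : 'I_2 -> plane R -> R) (B : mfield R)
    (S1 : vfield R -> vfield R) (f : vfield R) : vfield R :=
  S1 (pwmul (vop zeta B) (G11 (pwmul (pwadj (vop zeta B)) (S1 f)))).

(* [P L^2] *)
Definition range_L2 (P : vfield R -> vfield R) : set (vfield R) :=
  [set f | L2 f /\ exists2 g, L2 g & aeq f (P g)].

(* [Rz] is the bounded inverse of z - A on the subspace H of L^2. *)
Definition is_resolvent (H : set (vfield R)) (A : vfield R -> vfield R)
    (z : R[i]) (Rz : vfield R -> vfield R) : Prop :=
  [/\ forall f, H f -> H (Rz f),
      forall f h, H f -> H h ->
        aeq (fun x => z *: h x - A h x) f <-> aeq h (Rz f) &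
      exists c : R, forall f, H f -> norm2 (Rz f) <= c * norm2 f].

Definition circle (r t : R) : R[i] := (r * cos t) +i* (r * sin t).

(* Integral over the positively oriented circle |z| = r; the factor
   ['i%C * circle r t] is the derivative of [circle r] at t. *)
Definition circle_integral (r : R) (F : R[i] -> R[i]) : R[i] :=
  cintegral (@lebesgue_measure R) `[0, 2 * pi]
    (fun t => F (circle r t) * ('i%C * circle r t)).

(* P is the Riesz projection of A on H associated with the point 0:
   P = (2 pi i)^-1 * (integral of (z - A)^-1 dz over |z| = r) for all small
   r > 0, where 0 is the only point of the disc |z| < rho that may belong to the
   spectrum of A.  The operator-valued integral is taken weakly. *)
Definition riesz_projection0 (H : set (vfield R)) (A P : vfield R -> vfield R) :
    Prop :=
  (forall f, H f -> H (P f)) /\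
  exists (rho : R) (res : R[i] -> vfield R -> vfield R),
    [/\ 0 < rho,
        forall z, 0 < `|z| < rho%:C -> is_resolvent H A z (res z) &
        forall r, 0 < r < rho -> forall f g, H f -> H g ->
          inner (P f) g =
          (2 * pi%:C * 'i%C)^-1 * circle_integral r (fun z => inner (res z f) g)].

(* Q <= P for projections on L^2. *)
Definition proj_le (Q P : vfield R -> vfield R) : Prop := forall f, L2 f ->
  [/\ L2 (Q f), aeq (P (Q f)) (Q f) & aeq (Q (P f)) (Q f)].

End Defs.

(* Main.v *)
Require Import Defs.
From HB Require Import structures.
From mathcomp Require Import all_boot all_order all_algebra.
From mathcomp Require Import sesquilinear spectral.
From mathcomp Require Import all_classical all_reals all_analysis.
From mathcomp Require Import measurable_realfun complex.
From mathcomp Require Import ring lra.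

Set Implicit Arguments.
Unset Strict Implicit.
Unset Printing Implicit Defensive.

Import Order.TTheory GRing.Theory Num.Theory.
Import numFieldNormedType.Exports.

Local Open Scope classical_set_scope.
Local Open Scope ring_scope.
Local Open Scope sesquilinear_scope.
Local Open Scope complex_scope.

(** Write <x> for [japanese x], J for 1 + |.| on the line, and
    c for the integral ([mean]) over the plane of v^* phi.

    The kernel of [G00] is homogeneous of degree -1, so far from the origin
    psi behaves like -K(x) c.  Since |K(x)|^2 is of order |x|^-2, which is not
    integrable at infinity in the plane, psi can be square integrable only if
    c = 0.  To avoid the singularity of K at the origin, the comparison is made
    with the bounded kernel i alpha.x / (2 pi <x>^2) ([tail_kernel]).  The
    estimate |K(x - y) - tail_kernel x| <= <y> / (<x> |x - y|)
    ([cnorm_kernel_difference_le]) and the decay |v| <= C <x>^-(1 + dl)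
    ([vop_decay]) dominate psi + tail_kernel c by the integral operator with
    kernel <x>^-1 |x - y|^-1 <y>^-dl applied to |phi|.  That operator is
    bounded on L^2 ([integral_absp_kernel]): its kernel is at most a constant
    times a product of two kernels J(s)^-1/2 |s - t|^-1/2 J(t)^-dl/2 on the
    line, to which Schur's test with power weights applies.  Hence
    psi + tail_kernel c is always in L^2, and psi is in L^2 exactly when c = 0
    ([L2_psi_iff]).

    On the other side, v G11 v^* f is v times the constant vector [mean], so
    the quadratic form of the operator T1 = S1 v G11 v^* S1 on S1 L^2 is the
    square of the norm of the mean of v^* f, and T1 phi = 0 exactly when c = 0
    ([T1op_ker]).

    It remains to identify the range of a Riesz projection P at 0 of a
    symmetric operator A with the kernel of A; P is only given through weak
    contour integrals of the resolvent R(z).  If A g = 0 then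
    <R(z) f, g> = <f, g> / z and Cauchy's formula gives <P f, g> = <f, g>
    ([inner_riesz_ker]).  Conversely <P f, (A^3 - r^2 A) g> is the contour
    integral over |z| = r of (z^3 - r^2 z) <R(z) f, g>, where
    z^3 - r^2 z = 2 i z^2 Im z, while symmetry of A gives
    |Im z| |<R(z) f, g>| <= |f| |g|; so it is O(r^3).  Comparing the radii r
    and r / 2 yields <P f, A g> = O(r), hence <P f, A g> = 0
    ([inner_riesz_A]).  T is symmetric because K(x - y)^* = K(y - x), by
    Fubini's theorem, whose hypothesis is again the kernel bound above
    ([BirmanSchwinger_symmetric]). *)

Local Notation Re := complex.Re.
Local Notation Im := complex.Im.

(** * Complex-valued integrals *)

Section ComplexCoordinates.
Variable R : realType.
Implicit Types z w : R[i].

Lemma complex_ext z w : Re z = Re w -> Im z = Im w -> z = w.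
Proof. by case: z w => [a b] [c d] /= -> ->. Qed.

Lemma cReD z w : Re (z + w) = Re z + Re w. Proof. by case: z w => [a b] [c d]. Qed.
Lemma cImD z w : Im (z + w) = Im z + Im w. Proof. by case: z w => [a b] [c d]. Qed.
Lemma cReN z : Re (- z) = - Re z. Proof. by case: z. Qed.
Lemma cImN z : Im (- z) = - Im z. Proof. by case: z. Qed.
Lemma cReM z w : Re (z * w) = Re z * Re w - Im z * Im w.
Proof. by case: z w => [a b] [c d]. Qed.
Lemma cImM z w : Im (z * w) = Re z * Im w + Im z * Re w.
Proof. by case: z w => [a b] [c d]. Qed.
Lemma cReJ z : Re (z^*)%R = Re z. Proof. by case: z. Qed.
Lemma cImJ z : Im (z^*)%R = - Im z. Proof. by case: z. Qed.
Lemma cRe0 : Re (0 : R[i]) = 0. Proof. by []. Qed.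
Lemma cIm0 : Im (0 : R[i]) = 0. Proof. by []. Qed.
Lemma cRe1 : Re (1 : R[i]) = 1. Proof. by []. Qed.
Lemma cIm1 : Im (1 : R[i]) = 0. Proof. by []. Qed.

Definition cReImE := (cReD, cImD, cReN, cImN, cReM, cImM, cReJ, cImJ, cRe0, cIm0, cRe1, cIm1).

(** The modulus as an element of R; the norm of R[i] takes its values in R[i]. *)
Definition cnorm z : R := Num.sqrt (Re z ^+ 2 + Im z ^+ 2).

Lemma cnormE z : `|z| = (cnorm z)%:C. Proof. exact: normc_def. Qed.
Lemma cnorm_ge0 z : 0 <= cnorm z. Proof. exact: sqrtr_ge0. Qed.
Lemma cnorm0 : cnorm 0 = 0.
Proof. by apply: complexI; rewrite -cnormE normr0. Qed.
Lemma cnorm_eq0 z : cnorm z = 0 -> z = 0.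
Proof. by move=> h; apply/eqP; rewrite -normr_eq0 cnormE h. Qed.
Lemma cnormD z w : cnorm (z + w) <= cnorm z + cnorm w.
Proof. by rewrite -lecR rmorphD/= -!cnormE ler_normD. Qed.
Lemma cnormM z w : cnorm (z * w) = cnorm z * cnorm w.
Proof. by apply: complexI; rewrite rmorphM/= -!cnormE normrM. Qed.
Lemma cnormN z : cnorm (- z) = cnorm z.
Proof. by rewrite /cnorm !cReImE !sqrrN. Qed.
Lemma cnormJ z : cnorm (z^*)%R = cnorm z.
Proof. by rewrite /cnorm !cReImE sqrrN. Qed.
Lemma cnormV z : cnorm z^-1 = (cnorm z)^-1.
Proof. by apply: complexI; rewrite fmorphV/= -!cnormE normfV. Qed.
Lemma cnormC (r : R) : cnorm r%:C = `|r|.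
Proof. by rewrite /cnorm/= expr0n/= addr0 sqrtr_sqr. Qed.
Lemma sqr_cnorm z : cnorm z ^+ 2 = Re z ^+ 2 + Im z ^+ 2.
Proof. by rewrite sqr_sqrtr// addr_ge0// sqr_ge0. Qed.
Lemma normr_Re z : `|Re z| <= cnorm z.
Proof.
by rewrite -sqrtr_sqr ler_wsqrtr// lerDl sqr_ge0.
Qed.
Lemma normr_Im z : `|Im z| <= cnorm z.
Proof.
by rewrite -sqrtr_sqr ler_wsqrtr// lerDr sqr_ge0.
Qed.
Lemma cnorm_le_ReIm z : cnorm z <= `|Re z| + `|Im z|.
Proof.
rewrite -(@ler_pXn2r _ 2)// ?nnegrE ?addr_ge0// ?cnorm_ge0//.
rewrite sqr_cnorm sqrrD !real_normK ?num_real// lerD2r lerDl.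
by rewrite mulrn_wge0// mulr_ge0.
Qed.

Lemma mulJ z : z * (z^*)%R = (cnorm z ^+ 2)%:C.
Proof. by apply: complex_ext; rewrite sqr_cnorm !cReImE/=; ring. Qed.

End ComplexCoordinates.

Lemma measurable_sqrt (R : realType) :
  measurable_fun [set: measurableTypeR R] (@Num.sqrt R).
Proof. by apply: continuous_measurable_fun; exact: sqrt_continuous. Qed.

(** When the integral of F is infinite or of the form oo - oo, both sides
    vanish, because [fine] sends the infinite values to 0. *)
Lemma Rintegral_opp d (X : measurableType d) (R : realType)
    (mu : {measure set X -> \bar R})
    (D : set X) (F : X -> R) : \int[mu]_(t in D) (- F t) = - \int[mu]_(t in D) F t.
Proof.
rewrite /Rintegral [in LHS]integralE [in RHS]integralE.
rewrite (_ : (fun t => (- F t)%:E)^\+%E = (fun t => (F t)%:E)^\-%E); last first.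
  by apply/funext => t; rewrite funeposE funenegE.
rewrite (_ : (fun t => (- F t)%:E)^\-%E = (fun t => (F t)%:E)^\+%E); last first.
  by apply/funext => t; rewrite funeposE funenegE EFinN oppeK.
have : (0 <= \int[mu]_(t in D) (fun t => (F t)%:E)^\+%E t)%E.
  by apply: integral_ge0 => t _; exact: funepos_ge0.
have : (0 <= \int[mu]_(t in D) (fun t => (F t)%:E)^\-%E t)%E.
  by apply: integral_ge0 => t _; exact: funeneg_ge0.
case: (integral _ _ _) => [a| |] //; case: (integral _ _ _) => [b| |] //= _ _; rewrite ?oppr0//.
by rewrite opprB.
Qed.

Lemma cintegral_conj d (X : measurableType d) (R : realType)
    (mu : {measure set X -> \bar R})
    (D : set X) (F : X -> R[i]) :
  cintegral mu D (fun t => ((F t)^*)%R) = ((cintegral mu D F)^*)%R.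
Proof.
apply: complex_ext; rewrite cReImE /=.
  by congr Rintegral; apply/funext => t; rewrite cReJ.
by rewrite -Rintegral_opp; congr Rintegral; apply/funext => t; rewrite cImJ.
Qed.

Section ComplexIntegral.
Context d (X : measurableType d) (R : realType).
Variable mu : {measure set X -> \bar R}.
Variable D : set X.
Hypothesis mD : measurable D.
Implicit Types F G : X -> R[i].

Definition cmeasurable F :=
  measurable_fun D (fun x => Re (F x)) /\ measurable_fun D (fun x => Im (F x)).

Definition cintegrable F :=
  mu.-integrable D (fun x => (Re (F x))%:E) /\
  mu.-integrable D (fun x => (Im (F x))%:E).

Lemma cintegrable_measurable F : cintegrable F -> cmeasurable F.
Proof.
by move=> [/measurable_int/measurable_EFinP a /measurable_int/measurable_EFinP b].
Qed.

Lemma cmeasurableD F G : cmeasurable F -> cmeasurable G ->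
  cmeasurable (fun x => F x + G x).
Proof.
move=> [a b] [c e]; split.
- by under eq_fun do rewrite cReD; exact: measurable_funD.
- by under eq_fun do rewrite cImD; exact: measurable_funD.
Qed.

Lemma cmeasurableN F : cmeasurable F -> cmeasurable (fun x => - F x).
Proof.
move=> [a b]; split.
- by under eq_fun do rewrite cReN; exact: measurableT_comp.
- by under eq_fun do rewrite cImN; exact: measurableT_comp.
Qed.

Lemma cmeasurableM F G : cmeasurable F -> cmeasurable G ->
  cmeasurable (fun x => F x * G x).
Proof.
move=> [a b] [c e]; split.
- by under eq_fun do rewrite cReM; apply: measurable_funB; exact: measurable_funM.
- by under eq_fun do rewrite cImM; apply: measurable_funD; exact: measurable_funM.
Qed.

Lemma cmeasurableJ F : cmeasurable F -> cmeasurable (fun x => (F x)^*)%R.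
Proof.
move=> [a b]; split.
- by under eq_fun do rewrite cReJ.
- by under eq_fun do rewrite cImJ; exact: measurableT_comp.
Qed.

Lemma cmeasurable_cst c : cmeasurable (fun=> c).
Proof. by split; exact: measurable_cst. Qed.

Lemma cmeasurable_real (f : X -> R) : measurable_fun D f ->
  cmeasurable (fun x => (f x)%:C).
Proof. by move=> mf; split=> //=; exact: measurable_cst. Qed.

Lemma cmeasurable_sum (n : nat) (F : 'I_n -> X -> R[i]) :
  (forall i, cmeasurable (F i)) -> cmeasurable (fun x => \sum_i F i x).
Proof.
elim: n F => [|n IH] F mF.
  by under eq_fun do rewrite big_ord0; exact: cmeasurable_cst.
under eq_fun do rewrite big_ord_recl.
by apply: cmeasurableD => //; exact: (IH (fun i => F (lift ord0 i))).
Qed.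

Lemma measurable_cnorm F : cmeasurable F -> measurable_fun D (fun x => cnorm (F x)).
Proof.
move=> [a b].
apply: (measurableT_comp (@measurable_sqrt R)).
by apply: measurable_funD; exact: measurable_funX.
Qed.

Lemma le_cintegrable F (h : X -> R) : cmeasurable F ->
  mu.-integrable D (EFin \o h) -> (forall x, D x -> cnorm (F x) <= h x) ->
  cintegrable F.
Proof.
move=> [a b] ih Fh; split.
- apply: le_integrable ih => //; first exact/measurable_EFinP.
  move=> x Dx /=; rewrite lee_fin; apply: le_trans (normr_Re _) _.
  by apply: le_trans (Fh x Dx) (ler_norm _).
- apply: le_integrable ih => //; first exact/measurable_EFinP.
  move=> x Dx /=; rewrite lee_fin; apply: le_trans (normr_Im _) _.
  by apply: le_trans (Fh x Dx) (ler_norm _).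
Qed.

Lemma cintegrableD F G : cintegrable F -> cintegrable G ->
  cintegrable (fun x => F x + G x).
Proof.
move=> [a b] [c e]; split.
- by under eq_fun do rewrite cReD EFinD; exact: integrableD.
- by under eq_fun do rewrite cImD EFinD; exact: integrableD.
Qed.

Lemma cintegrableZ (c : R[i]) F : cintegrable F -> cintegrable (fun x => c * F x).
Proof.
move=> [a b]; split.
- under eq_fun do rewrite cReM EFinB.
  by apply: integrableB => //; under eq_fun do rewrite EFinM; exact: integrableZl.
- under eq_fun do rewrite cImM EFinD.
  by apply: integrableD => //; under eq_fun do rewrite EFinM; exact: integrableZl.
Qed.

Lemma cintegrableJ F : cintegrable F -> cintegrable (fun x => (F x)^*)%R.
Proof.
move=> [a b]; split.
- by under eq_fun do rewrite cReJ.
- by under eq_fun do rewrite cImJ EFinN; exact: integrableN.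
Qed.

Lemma cintegrable_sum (n : nat) (F : 'I_n -> X -> R[i]) :
  (forall i, cintegrable (F i)) -> cintegrable (fun x => \sum_i F i x).
Proof.
elim: n F => [|n IH] F mF.
  by under eq_fun do rewrite big_ord0; split; exact: integrable0.
under eq_fun do rewrite big_ord_recl.
by apply: cintegrableD => //; exact: (IH (fun i => F (lift ord0 i))).
Qed.

Lemma cintegralD F G : cintegrable F -> cintegrable G ->
  cintegral mu D (fun x => F x + G x) = cintegral mu D F + cintegral mu D G.
Proof.
move=> [a b] [c e]; rewrite /cintegral; apply: complex_ext => /=.
- by under eq_Rintegral do rewrite cReD; rewrite RintegralD.
- by under eq_Rintegral do rewrite cImD; rewrite RintegralD.
Qed.

Lemma integrableZl_EFin (k : R) (f : X -> R) :
  mu.-integrable D (EFin \o f) -> mu.-integrable D (EFin \o (fun x => k * f x)).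
Proof. by move=> /(integrableZl mD k). Qed.

Lemma cintegralZ (c : R[i]) F : cintegrable F ->
  cintegral mu D (fun x => c * F x) = c * cintegral mu D F.
Proof.
move=> [a b]; rewrite /cintegral; apply: complex_ext => /=.
- under eq_Rintegral do rewrite cReM.
  by rewrite RintegralB ?RintegralZl ?cReImE//; exact: integrableZl_EFin.
- under eq_Rintegral do rewrite cImM.
  by rewrite RintegralD ?RintegralZl ?cReImE//; exact: integrableZl_EFin.
Qed.

Lemma cintegral_sum (n : nat) (F : 'I_n -> X -> R[i]) :
  (forall i, cintegrable (F i)) ->
  cintegral mu D (fun x => \sum_i F i x) = \sum_i cintegral mu D (F i).
Proof.
elim: n F => [|n IH] F mF.
  rewrite big_ord0 /cintegral.
  under eq_Rintegral do rewrite big_ord0.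
  under [X in _ +i* X]eq_Rintegral do rewrite big_ord0.
  by rewrite /Rintegral integral0.
have -> : (fun x => \sum_i F i x) =
    (fun x => F ord0 x + \sum_(i < n) F (lift ord0 i) x).
  by apply/funext => x; rewrite big_ord_recl.
rewrite big_ord_recl cintegralD//; first by rewrite IH.
exact: (cintegrable_sum (F := fun i => F (lift ord0 i))).
Qed.

Lemma ae_eq_cintegral F G : cmeasurable F -> cmeasurable G ->
  {ae mu, forall x, D x -> F x = G x} -> cintegral mu D F = cintegral mu D G.
Proof.
move=> [a b] [c e] FG; rewrite /cintegral /Rintegral; congr (fine _ +i* fine _).
- apply: ae_eq_integral => //; try exact/measurable_EFinP.
  by apply: filterS FG => x /= FG Dx; rewrite FG.
- apply: ae_eq_integral => //; try exact/measurable_EFinP.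
  by apply: filterS FG => x /= FG Dx; rewrite FG.
Qed.

(** The factor 2 comes from estimating the real and the imaginary parts
    separately. *)
Lemma cnorm_cintegral_le F (h : X -> R) : cmeasurable F -> measurable_fun D h ->
  {ae mu, forall x, D x -> cnorm (F x) <= h x} ->
  ((cnorm (cintegral mu D F))%:E <= 2%:E * \int[mu]_(x in D) `|(h x)|%:E)%E.
Proof.
move=> mF mh Fh; have [a b] := mF.
have key (f : X -> R) : measurable_fun D f ->
    {ae mu, forall x, D x -> `|f x| <= h x} ->
    (`|\int[mu]_(x in D) f x|%:E <= \int[mu]_(x in D) `|h x|%:E)%E.
  move=> mf fh; rewrite /Rintegral.
  have [ff|nff] := boolP (\int[mu]_(x in D) (f x)%:E \is a fin_num)%E; last first.
    suff -> : fine (\int[mu]_(x in D) (f x)%:E)%E = 0.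
      by rewrite normr0; exact: integral_ge0.
    by move: nff; case: (\int[mu]_(x in D) (f x)%:E)%E.
  rewrite -abse_EFin fineK//.
  apply: le_trans; first by apply: le_abse_integral => //; exact/measurable_EFinP.
  apply: ae_ge0_le_integral => //.
  - by apply: measurableT_comp => //; exact/measurable_EFinP.
  - by apply/measurable_EFinP; exact: measurableT_comp.
  - apply: filterS fh => x /= fh Dx; rewrite lee_fin.
    exact: le_trans (fh Dx) (ler_norm _).
have := cnorm_le_ReIm (cintegral mu D F); rewrite -lee_fin => /le_trans; apply.
rewrite mule_natl mule2n EFinD; apply: leeD.
- by apply: key => //; apply: filterS Fh => x /= Fh Dx;
    exact: le_trans (normr_Re _) (Fh Dx).
- by apply: key => //; apply: filterS Fh => x /= Fh Dx;
    exact: le_trans (normr_Im _) (Fh Dx).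
Qed.

End ComplexIntegral.

(** * The space L^2 of two-component fields *)

Section L2Space.
Variable R : realType.
Local Notation mu2 := (mu2 R).
Implicit Types f g h : vfield R.
Implicit Types u v : 'cV[R[i]]_2.

Definition measurable_vf f := forall i, cmeasurable setT (fun x => f x i 0).

Definition vsq (u : 'cV[R[i]]_2) : R := \sum_i cnorm (u i 0) ^+ 2.

Definition dot (u v : 'cV[R[i]]_2) : R[i] := \sum_i u i 0 * ((v i 0)^*)%R.

Lemma dotJ u v : dot u v = ((dot v u)^*)%R.
Proof.
rewrite /dot rmorph_sum/=; apply: eq_bigr => i _.
by rewrite rmorphM/= conjCK mulrC.
Qed.

Lemma vsq_ge0 u : 0 <= vsq u.
Proof. by apply: sumr_ge0 => i _; exact: sqr_ge0. Qed.

Lemma cnorm_le_vsq u i : cnorm (u i 0) ^+ 2 <= vsq u.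
Proof. by rewrite /vsq (bigD1 i)//= lerDl; apply: sumr_ge0 => j _; exact: sqr_ge0. Qed.

Lemma vsq_eq0 u : vsq u = 0 -> u = 0.
Proof.
move=> u0; apply/colP => i; rewrite mxE; apply: cnorm_eq0; apply/eqP.
by rewrite -sqrf_eq0 eq_le sqr_ge0 andbT -u0 cnorm_le_vsq.
Qed.

Lemma dotvv u : dot u u = (vsq u)%:C.
Proof. by rewrite /vsq rmorph_sum; apply: eq_bigr => i _; exact: mulJ. Qed.

Lemma cnorm_dot_le u v : cnorm (dot u v) <= vsq u + vsq v.
Proof.
rewrite /dot /vsq !big_ord_recl !big_ord0 !addr0.
apply: le_trans (cnormD _ _) _; rewrite !cnormM !cnormJ.
set a := cnorm _; set b := cnorm _; set c := cnorm _; set e := cnorm _.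
have := sqr_ge0 (a - b); have := sqr_ge0 (c - e).
have : 0 <= a ^+ 2 by exact: sqr_ge0.
have : 0 <= b ^+ 2 by exact: sqr_ge0.
have : 0 <= c ^+ 2 by exact: sqr_ge0.
have : 0 <= e ^+ 2 by exact: sqr_ge0.
by lra.
Qed.

Lemma vsqD_le u v (a : R[i]) : vsq (u + a *: v) <= 2 * vsq u + 2 * cnorm a ^+ 2 * vsq v.
Proof.
rewrite /vsq !mulr_sumr -big_split/=; apply: ler_sum => i _.
rewrite !mxE; set x := u i 0; set y := v i 0.
have : cnorm (x + a * y) <= cnorm x + cnorm a * cnorm y.
  by rewrite -cnormM cnormD.
move=> h; have h2 : cnorm (x + a * y) ^+ 2 <= (cnorm x + cnorm a * cnorm y) ^+ 2.
  by rewrite ler_pXn2r// nnegrE ?addr_ge0 ?mulr_ge0// cnorm_ge0.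
apply: le_trans h2 _; have := sqr_ge0 (cnorm x - cnorm a * cnorm y).
by rewrite -subr_ge0 => H; rewrite -subr_ge0; apply: le_trans H _; rewrite le_eqVlt; apply/orP; left; apply/eqP; ring.
Qed.

Lemma measurable_vsq f : measurable_vf f ->
  measurable_fun setT (fun x => vsq (f x)).
Proof.
move=> mf; apply: measurable_sum => i; apply: measurable_funX.
exact: measurable_cnorm.
Qed.

Lemma measurable_vfD f g (a : R[i]) : measurable_vf f -> measurable_vf g ->
  measurable_vf (fun x => f x + a *: g x).
Proof.
move=> mf mg i; under eq_fun do rewrite !mxE.
by apply: cmeasurableD => //; apply: cmeasurableM => //; exact: cmeasurable_cst.
Qed.

Lemma cmeasurable_dot f g : measurable_vf f -> measurable_vf g ->
  cmeasurable setT (fun x => dot (f x) (g x)).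
Proof.
move=> mf mg; apply: cmeasurable_sum => i; apply: cmeasurableM => //.
exact: cmeasurableJ.
Qed.

Lemma measurable_vsq_EFin f : measurable_vf f ->
  measurable_fun setT (fun x => (vsq (f x))%:E).
Proof. by move=> mf; apply/measurable_EFinP; exact: measurable_vsq. Qed.

Lemma Lfun2P (u : plane R -> R) : measurable_fun setT u ->
  (\int[mu2]_x (u x ^+ 2)%:E < +oo)%E -> u \in Lfun mu2 2%:E.
Proof.
move=> mu iu; rewrite inE; apply/andP; split; rewrite inE//=.
rewrite /finite_norm unlock/= poweR_lty//.
apply: le_lt_trans iu; apply: ge0_le_integral => //.
- apply/measurable_EFinP.
  apply/(@measurableT_comp _ _ _ _ _ _ (fun x : R => x `^ 2)%R) => //.
  exact: measurableT_comp.
- by apply/measurable_EFinP; exact: measurable_funX.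
- by move=> x _; rewrite lee_fin powR_mulrn// real_normK ?num_real.
Qed.

Lemma L2_measurable f : L2 f -> measurable_vf f.
Proof. by move=> f2 i; have [/andP[/[!inE] a _] /andP[/[!inE] b _]] := f2 i. Qed.

Lemma L2P f : L2 f <->
  measurable_vf f /\ (\int[mu2]_x (vsq (f x))%:E < +oo)%E.
Proof.
split=> [f2|[mf fi] i].
  split; first exact: L2_measurable.
  suff : mu2.-integrable setT (fun x => (vsq (f x))%:E).
    move=> /integrableP[_]; apply: le_lt_trans; apply: ge0_le_integral => //.
    - by move=> x _; rewrite lee_fin vsq_ge0.
    - exact: measurable_vsq_EFin (L2_measurable f2).
    - by apply: measurableT_comp => //; exact: measurable_vsq_EFin (L2_measurable f2).
    - by move=> x _ /=; rewrite lee_fin ler_norm.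
  rewrite /vsq; under eq_fun do rewrite big_ord_recl big_ord1 !sqr_cnorm !EFinD.
  have h i : mu2.-integrable setT (fun x => (Re (f x i 0) ^+ 2)%:E) /\
     mu2.-integrable setT (fun x => (Im (f x i 0) ^+ 2)%:E).
    have [a b] := f2 i; split; first exact: (Lfun2_integrable_sqr a).
    exact: (Lfun2_integrable_sqr b).
  by apply: integrableD => //; apply: integrableD => //; apply h.
have [a b] := mf i.
by split; apply: Lfun2P => //; apply: le_lt_trans fi; apply: ge0_le_integral => //;
  rewrite ?EFin_measurable//; try (by move=> x _; rewrite lee_fin ?sqr_ge0 ?vsq_ge0);
  try (by apply/measurable_EFinP; (exact: measurable_funX || exact: measurable_vsq));
  move=> x _; rewrite lee_fin; apply: le_trans (cnorm_le_vsq _ i);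
  rewrite sqr_cnorm ?lerDl ?lerDr ?sqr_ge0.
Qed.

Lemma L2_le f (h : plane R -> R) : measurable_vf f -> measurable_fun setT h ->
  (forall x, 0 <= h x) -> {ae mu2, forall x, vsq (f x) <= h x} ->
  (\int[mu2]_x (h x)%:E < +oo)%E -> L2 f.
Proof.
move=> mf mh h0 fh hi; apply/L2P; split=> //; apply: le_lt_trans hi.
apply: ae_ge0_le_integral => //.
- by move=> x _; rewrite lee_fin vsq_ge0.
- exact: measurable_vsq_EFin.
- by move=> x _; rewrite lee_fin.
- exact/measurable_EFinP.
- by apply: filterS fh => x /= fh _; rewrite lee_fin.
Qed.

Lemma integrable_vsq f : L2 f -> mu2.-integrable setT (fun x => (vsq (f x))%:E).
Proof.
move=> /L2P[mf fi]; apply/integrableP; split.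
  exact: measurable_vsq_EFin.
apply: le_lt_trans fi; apply: ge0_le_integral => //.
- by apply: measurableT_comp => //; exact: measurable_vsq_EFin.
- exact: measurable_vsq_EFin.
- by move=> x _ /=; rewrite lee_fin ger0_norm// vsq_ge0.
Qed.

Lemma L2D f g (a : R[i]) : L2 f -> L2 g -> L2 (fun x => f x + a *: g x).
Proof.
move=> f2 g2; have [mf fi] := (L2P f).1 f2; have [mg gi] := (L2P g).1 g2.
apply: (@L2_le _ (fun x => 2 * vsq (f x) + 2 * cnorm a ^+ 2 * vsq (g x))).
- exact: measurable_vfD.
- by apply: measurable_funD; apply: measurable_funM => //;
    (exact: measurable_cst || exact: measurable_vsq).
- by move=> x; apply: addr_ge0; rewrite !mulr_ge0 ?vsq_ge0 ?exprn_ge0 ?cnorm_ge0.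
- by apply: aeW => x; exact: vsqD_le.
- apply: integrable_lty => //.
  have -> : (fun x => (2 * vsq (f x) + 2 * cnorm a ^+ 2 * vsq (g x))%:E) =
      ((fun x => 2%:E * (vsq (f x))%:E) \+
       (fun x => (2 * cnorm a ^+ 2)%R%:E * (vsq (g x))%:E))%E.
    by apply/funext => x; rewrite /= EFinD !EFinM.
  by apply: integrableD => //; apply: integrableZl => //; exact: integrable_vsq.
Qed.

Lemma L20 : L2 (fun _ : plane R => 0 : 'cV[R[i]]_2).
Proof.
apply/L2P; split.
  by move=> i; under eq_fun do rewrite mxE; exact: cmeasurable_cst.
have -> : vsq (0 : 'cV[R[i]]_2) = 0.
  by rewrite /vsq big1 // => i _; rewrite mxE cnorm0 expr0n.
by rewrite integral0.
Qed.

Lemma L2Z f (a : R[i]) : L2 f -> L2 (fun x => a *: f x).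
Proof.
move=> f2; have := L2D a L20 f2.
by under eq_fun do rewrite add0r.
Qed.

Lemma cintegrable_dot f g : L2 f -> L2 g ->
  cintegrable mu2 setT (fun x => dot (f x) (g x)).
Proof.
move=> f2 g2; apply: (@le_cintegrable _ _ _ _ _ _ _ (fun x => vsq (f x) + vsq (g x))) => //.
- by apply: cmeasurable_dot; exact: L2_measurable.
- have -> : EFin \o (fun x => vsq (f x) + vsq (g x)) =
     ((fun x => (vsq (f x))%:E) \+ (fun x => (vsq (g x))%:E))%E by apply/funext.
  by apply: integrableD => //; exact: integrable_vsq.
- by move=> x _; exact: cnorm_dot_le.
Qed.

Lemma innerDl f g h (a : R[i]) : L2 f -> L2 g -> L2 h ->
  inner (fun x => f x + a *: g x) h = inner f h + a * inner g h.
Proof.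
move=> f2 g2 h2; rewrite /inner -cintegralZ//; last exact: cintegrable_dot.
rewrite -cintegralD//; [|exact: cintegrable_dot|].
  congr cintegral; apply/funext => x; rewrite mulr_sumr -big_split/=.
  by apply: eq_bigr => i _; rewrite !mxE mulrDl mulrA.
by apply: cintegrableZ => //; exact: cintegrable_dot.
Qed.

Lemma innerJ f g : inner f g = ((inner g f)^*)%R.
Proof.
by rewrite /inner -cintegral_conj; congr cintegral; apply/funext => x; exact: dotJ.
Qed.

Lemma innerDr f g h (a : R[i]) : L2 f -> L2 g -> L2 h ->
  inner h (fun x => f x + a *: g x) = inner h f + (a^*)%R * inner h g.
Proof.
move=> f2 g2 h2; by rewrite innerJ innerDl// rmorphD rmorphM/= -!innerJ.
Qed.

Lemma inner_aeql f f' g : L2 f -> L2 f' -> L2 g -> aeq f f' ->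
  inner f g = inner f' g.
Proof.
move=> f2 f2' g2 ff'; apply: ae_eq_cintegral => //.
- by apply: cmeasurable_dot; exact: L2_measurable.
- by apply: cmeasurable_dot; exact: L2_measurable.
- by apply: filterS ff' => x /= -> _.
Qed.

Lemma inner_aeqr f f' g : L2 f -> L2 f' -> L2 g -> aeq f f' ->
  inner g f = inner g f'.
Proof.
by move=> f2 f2' g2 ff'; rewrite innerJ (inner_aeql _ f2')// -innerJ.
Qed.

Lemma innerff f : inner f f = (\int[mu2]_x vsq (f x))%:C.
Proof.
rewrite /inner /cintegral; apply: complex_ext => /=.
- by under eq_Rintegral do rewrite -/(dot _ _) dotvv/=.
- under eq_Rintegral do rewrite -/(dot _ _) dotvv/=.
  by rewrite /Rintegral integral0.
Qed.

Lemma innerff_norm f : inner f f = (norm2 f ^+ 2)%:C.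
Proof.
rewrite /norm2 innerff sqr_sqrtr//=.
by apply: Rintegral_ge0 => x _; exact: vsq_ge0.
Qed.

Lemma norm2_ge0 f : 0 <= norm2 f. Proof. exact: sqrtr_ge0. Qed.

Lemma norm2_eq0 f : L2 f -> norm2 f = 0 -> aeq f (fun=> 0).
Proof.
move=> f2 f0; have : inner f f = 0 by rewrite innerff_norm f0 expr0n.
rewrite innerff => /(congr1 (@complex.Re _))/=; rewrite /Rintegral => i0.
have ifv := integrable_vsq f2.
have : (\int[mu2]_x `|(vsq (f x))%:E| = 0)%E.
  under eq_integral do rewrite gee0_abs ?lee_fin ?vsq_ge0//.
  by rewrite -[LHS]fineK ?i0// integrable_fin_num.
move/ae_eq_integral_abs => /(_ measurableT).
have mv : measurable_fun setT (fun x => (vsq (f x))%:E).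
  exact: measurable_vsq_EFin (L2_measurable f2).
move=> /(_ mv); apply: filterS => x /= /(_ I)[]; exact: vsq_eq0.
Qed.

Lemma inner0r f : inner f (fun=> 0) = 0.
Proof.
rewrite /inner (_ : (fun x => _) = fun=> 0).
  by rewrite /cintegral /Rintegral integral0.
by apply/funext => x; rewrite big1// => i _; rewrite mxE rmorph0 mulr0.
Qed.

Lemma cauchy_schwarz f g : L2 f -> L2 g -> cnorm (inner f g) <= norm2 f * norm2 g.
Proof.
move=> f2 g2.
have [g0|gn0] := eqVneq (norm2 g) 0.
  rewrite (@inner_aeqr g (fun=> 0))//; [|exact: L20|exact: norm2_eq0].
  by rewrite inner0r cnorm0 mulr_ge0 ?norm2_ge0.
have gp : 0 < norm2 g by rewrite lt_def gn0 norm2_ge0.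
(* [h] is the component of [f] orthogonal to [g]. *)
pose c : R[i] := - inner f g / (norm2 g ^+ 2)%:C.
pose h x := f x + c *: g x.
have h2 : L2 h by exact: L2D.
have hh : 0 <= norm2 h ^+ 2 by exact: sqr_ge0.
have cn0 : (norm2 g ^+ 2)%:C != 0 :> R[i].
  by apply/eqP => /complexI/eqP; rewrite expf_eq0/= gt_eqF.
have E : (norm2 h ^+ 2)%:C =
    (norm2 f ^+ 2 - cnorm (inner f g) ^+ 2 / norm2 g ^+ 2)%:C :> R[i].
  rewrite -innerff_norm innerDl// !innerDr//.
  have cJ : (c^*)%R = - ((inner f g)^*)%R / (norm2 g ^+ 2)%:C.
    rewrite /c; set w := inner f g; set t := (norm2 g ^+ 2)%:C.
    rewrite rmorphM/= fmorphV/= rmorphN/=; congr (_ / _).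
    by apply: complex_ext; rewrite cReImE/= ?oppr0.
  rewrite cJ (innerJ g f) !innerff_norm /c rmorphB fmorph_div/=.
  rewrite -[(cnorm _ ^+ 2)%:C]mulJ.
  move: cn0 ((inner f g)^*)%R (inner f g) (norm2 f ^+ 2)%:C.
  move: (norm2 g ^+ 2)%:C => t t0 wJ w s.
  by field.
move: hh; move/complexI : E => ->; rewrite subr_ge0 ler_pdivrMr ?exprn_gt0//.
by rewrite -exprMn ler_pXn2r// nnegrE ?mulr_ge0 ?cnorm_ge0 ?norm2_ge0.
Qed.

Lemma norm2D f g : L2 f -> L2 g ->
  norm2 (fun x => f x + 1 *: g x) <= norm2 f + norm2 g.
Proof.
move=> f2 g2; rewrite -(@ler_pXn2r _ 2)// ?nnegrE ?addr_ge0 ?norm2_ge0//.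
have h2 := L2D 1 f2 g2.
have : norm2 (fun x => f x + 1 *: g x) ^+ 2 =
    norm2 f ^+ 2 + norm2 g ^+ 2 + 2 * Re (inner f g).
  apply: complexI; rewrite -innerff_norm innerDl// !innerDr// !innerff_norm.
  rewrite (innerJ g f) rmorph1 !mul1r; apply: complex_ext; rewrite !cReImE/=; ring.
move=> ->; rewrite sqrrD.
have := le_trans (ler_norm _) (le_trans (normr_Re _) (cauchy_schwarz f2 g2)).
by rewrite mulr2n; lra.
Qed.

Lemma norm2Z f (a : R[i]) : L2 f -> norm2 (fun x => a *: f x) = cnorm a * norm2 f.
Proof.
move=> f2; rewrite /norm2 !innerff -[cnorm a]ger0_norm ?cnorm_ge0// -sqrtr_sqr.
rewrite -sqrtrM ?sqr_ge0//=; congr Num.sqrt; rewrite -RintegralZl//.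
  apply: eq_Rintegral => x _; rewrite /vsq mulr_sumr; apply: eq_bigr => i _.
  by rewrite mxE cnormM exprMn.
exact: integrable_vsq.
Qed.

Lemma norm2_aeq f g : L2 f -> L2 g -> aeq f g -> norm2 f = norm2 g.
Proof.
move=> f2 g2 fg; rewrite /norm2 (inner_aeql f2 g2 f2 fg) (inner_aeqr f2 g2 g2 fg).
by [].
Qed.

End L2Space.

(** * Trigonometric integrals over circles *)

Lemma lebesgue_measure_turn (R : realType) :
  @lebesgue_measure R `[0, 2 * pi]%classic = (2 * pi)%:E.
Proof.
have := @lebesgue_measure_itv R `[0, 2 * pi]%R.
by rewrite /= lte_fin mulr_gt0 ?pi_gt0// -EFinB subr0.
Qed.

Section Contour.
Variable R : realType.
Implicit Types F G : R -> R[i].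
Local Notation leb := (@lebesgue_measure R).

Definition ccontinuous F :=
  continuous (fun t => Re (F t) : R) /\ continuous (fun t => Im (F t) : R).

Lemma ccontinuous_cst (c : R[i]) : ccontinuous (fun=> c).
Proof. by split=> t; exact: cvg_cst. Qed.

Lemma ccontinuousD F G : ccontinuous F -> ccontinuous G ->
  ccontinuous (fun t => F t + G t).
Proof.
move=> [a b] [c e]; split.
- under eq_fun do rewrite cReD.
  by move=> t; apply: cvgD; [exact: a|exact: c].
- under eq_fun do rewrite cImD.
  by move=> t; apply: cvgD; [exact: b|exact: e].
Qed.

Lemma ccontinuousM F G : ccontinuous F -> ccontinuous G ->
  ccontinuous (fun t => F t * G t).
Proof.
move=> [a b] [c e]; split.
- under eq_fun do rewrite cReM.
  by move=> t; apply: cvgB; apply: cvgM; [exact: a|exact: c|exact: b|exact: e].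
- under eq_fun do rewrite cImM.
  by move=> t; apply: cvgD; apply: cvgM; [exact: a|exact: e|exact: b|exact: c].
Qed.

Lemma ccontinuousX F n : ccontinuous F -> ccontinuous (fun t => F t ^+ n).
Proof.
move=> cF; elim: n => [|n IH]; first exact: ccontinuous_cst.
by under eq_fun do rewrite exprS; exact: ccontinuousM.
Qed.

Lemma ccontinuous_circle (r : R) : ccontinuous (circle r).
Proof.
split=> t /=; apply: cvgM; try exact: cvg_cst.
- exact: continuous_cos.
- exact: continuous_sin.
Qed.

Lemma ccontinuous_integrable F (a b : R) : ccontinuous F ->
  cintegrable leb `[a, b] F.
Proof.
move=> [cr ci]; split; apply: continuous_compact_integrable;
  (exact: segment_compact || exact: continuous_subspaceT).
Qed.

Lemma cnorm_circle (r t : R) : 0 <= r -> cnorm (circle r t) = r.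
Proof.
move=> r0; rewrite /cnorm/= !exprMn -mulrDr cos2Dsin2 mulr1 sqrtr_sqr.
by rewrite ger0_norm.
Qed.

Lemma circleX (r t : R) n : circle r t ^+ n = circle (r ^+ n) (n%:R * t).
Proof.
elim: n => [|n IH].
  by rewrite expr0 mul0r /circle cos0 sin0 !expr0 mulr1 mulr0.
rewrite exprS IH -natr1 mulrDl mul1r exprS.
apply: complex_ext; rewrite ?cReM ?cImM /= ?cosD ?sinD; ring.
Qed.

Lemma integral_cos_sin n : (0 < n)%N ->
  (\int[leb]_(t in `[0, 2 * pi]) cos (n%:R * t) = 0 /\
   \int[leb]_(t in `[0, 2 * pi]) sin (n%:R * t) = 0)%R.
Proof.
move=> n0; have nR : (n%:R : R) != 0 by rewrite pnatr_eq0 -lt0n.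
have pi2 : 0 < 2 * pi :> R by rewrite mulr_gt0// pi_gt0.
have dl (t : R) : is_derive t 1 (fun t => n%:R * t : R) (n%:R : R).
  apply: (is_derive_eq (is_deriveZ (n%:R : R) (is_derive_id t (1 : R)))).
  by rewrite [_ *: 1]mulr1.
have key (f F : R -> R) : (forall t : R, is_derive t (1 : R) F (f t)) ->
    continuous f -> F (2 * pi) = F 0 -> \int[leb]_(t in `[0, 2 * pi]) f t = 0.
  move=> dF cf F0; rewrite /Rintegral (@continuous_FTC2 _ f F)//.
  - by rewrite F0 subee.
  - exact: continuous_subspaceT.
  - have cF : continuous F.
      move=> t; apply: differentiable_continuous; apply/derivable1_diffP.
      by have [] := dF t.
    split.
    + by move=> t _; have [] := dF t.
    + by apply: cvg_at_right_filter; exact: cF.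
    + by apply: cvg_at_left_filter; exact: cF.
  - by move=> t _; rewrite derive1E; have [_ ->] := dF t.
have cl : continuous (fun t : R => n%:R * t).
  by move=> t; apply: cvgM; [exact: cvg_cst|exact: cvg_id].
have per : n%:R * (2 * pi) = 0 + (pi *+ 2) *+ n :> R.
  by rewrite add0r -[RHS]mulr_natl -[pi *+ 2]mulr_natl.
split.
- apply: (key _ (fun t => n%:R^-1 * sin (n%:R * t))).
  + move=> t; have h := is_derive1_comp (is_derive_sin (n%:R * t)) (dl t).
    apply: (is_derive_eq (is_deriveZ (n%:R^-1 : R) h)).
    by rewrite [_ *: _]mulrCA mulVf// mulr1.
  + by move=> t; apply: continuous_comp; [exact: cl|exact: continuous_cos].
  + by rewrite per mulr0 periodicn ?sin0//; exact: sinD2pi.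
- apply: (key _ (fun t => - n%:R^-1 * cos (n%:R * t))).
  + move=> t; have h := is_derive1_comp (is_derive_cos (n%:R * t)) (dl t).
    apply: (is_derive_eq (is_deriveZ (- n%:R^-1 : R) h)).
    by rewrite -[_ *: _]/(_ * _); field.
  + by move=> t; apply: continuous_comp; [exact: cl|exact: continuous_sin].
  + by rewrite per mulr0 periodicn ?cos0//; exact: cosD2pi.
Qed.

(** On the circle, z^n dz = i r^(n+1) e^(i (n+1) t) dt is a trigonometric
    monomial of mean zero. *)
Lemma circle_integral_pow (r : R) n : circle_integral r (fun z => z ^+ n) = 0.
Proof.
rewrite /circle_integral /cintegral.
have E t : circle r t ^+ n * ('i%C * circle r t) = 'i%C * circle (r ^+ n.+1) (n.+1%:R * t).
  by rewrite mulrCA -exprSr circleX.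
have [c0 s0] := integral_cos_sin (ltn0Sn n).
have ci (f : R -> R) : continuous f ->
    leb.-integrable `[0, 2 * pi] (EFin \o (fun t => f (n.+1%:R * t))).
  move=> cf; apply: continuous_compact_integrable; first exact: segment_compact.
  apply: continuous_subspaceT => t; apply: continuous_comp; last exact: cf.
  by apply: cvgM; [exact: cvg_cst|exact: cvg_id].
apply: complex_ext => /=.
- under eq_Rintegral do rewrite E /= mul0r mul1r sub0r -mulNr.
  by rewrite RintegralZl ?s0 ?mulr0//; apply: ci; exact: continuous_sin.
- under eq_Rintegral do rewrite E /= mul0r mul1r add0r.
  by rewrite RintegralZl ?c0 ?mulr0//; apply: ci; exact: continuous_cos.
Qed.

Lemma circle_integral_inv (r : R) : 0 < r ->
  circle_integral r (fun z => z^-1) = 2 * pi%:C * 'i%C.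
Proof.
move=> r0; rewrite /circle_integral (_ : (fun t => _) = fun=> 'i%C); last first.
  apply/funext => t; rewrite mulrCA mulVf ?mulr1//; apply/eqP => c0.
  by have := cnorm_circle t (ltW r0); rewrite c0 cnorm0; lra.
rewrite /cintegral [Re 'i%C]/= [Im 'i%C]/= !Rintegral_cst// mul0r mul1r.
have -> : fine (leb `[0, 2 * pi]%classic) = 2 * pi.
  exact: (congr1 fine (lebesgue_measure_turn R)).
by apply: complex_ext; rewrite !cReImE/=; ring.
Qed.

End Contour.

(** * Riesz projections of symmetric operators *)

Lemma innerZl (R : realType) (f g : vfield R) (a : R[i]) : L2 f -> L2 g ->
  inner (fun x => a *: f x) g = a * inner f g.
Proof.
move=> f2 g2; have := innerDl a (L20 R) f2 g2.
rewrite (_ : (fun x => 0 + a *: f x) = fun x => a *: f x); last first.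
  by apply/funext => x; rewrite add0r.
by move=> ->; rewrite innerJ inner0r rmorph0 add0r.
Qed.

Lemma cnorm_i (R : realType) : cnorm ('i%C : R[i]) = 1.
Proof. by rewrite /cnorm/= expr0n add0r expr1n sqrtr1. Qed.

Lemma cnorm_nat (R : realType) n : cnorm (n%:R : R[i]) = n%:R.
Proof. by apply: complexI; rewrite -cnormE normr_nat rmorph_nat. Qed.

Section CircleIntegral.
Variable R : realType.
Implicit Types F G : R[i] -> R[i].
Local Notation leb := (@lebesgue_measure R).

Lemma ccontinuous_integrand (r : R) F : ccontinuous (fun t => F (circle r t)) ->
  cintegrable leb `[0, 2 * pi] (fun t => F (circle r t) * ('i%C * circle r t)).
Proof.
move=> cF; apply: ccontinuous_integrable; apply: ccontinuousM => //.
by apply: ccontinuousM; [exact: ccontinuous_cst|exact: ccontinuous_circle].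
Qed.

Lemma circle_integralD (r : R) F G : ccontinuous (fun t => F (circle r t)) ->
  ccontinuous (fun t => G (circle r t)) ->
  circle_integral r (fun z => F z + G z) = circle_integral r F + circle_integral r G.
Proof.
move=> cF cG; rewrite /circle_integral -cintegralD//;
  try exact: ccontinuous_integrand.
by congr cintegral; apply/funext => t; rewrite mulrDl.
Qed.

Lemma circle_integralZ (r : R) (c : R[i]) F : ccontinuous (fun t => F (circle r t)) ->
  circle_integral r (fun z => c * F z) = c * circle_integral r F.
Proof.
move=> cF; rewrite /circle_integral -cintegralZ//; last exact: ccontinuous_integrand.
by congr cintegral; apply/funext => t; rewrite -mulrA.
Qed.

Lemma circle_integral_bound (r M : R) F : 0 <= r -> 0 <= M ->
  ccontinuous (fun t => F (circle r t)) ->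
  (forall t, cnorm (F (circle r t)) <= M) ->
  cnorm (circle_integral r F) <= 4 * pi * (M * r).
Proof.
move=> r0 M0 cF FM.
have := @cnorm_cintegral_le _ _ _ leb `[0, 2 * pi] (measurable_itv _)
  (fun t => F (circle r t) * ('i%C * circle r t)) (fun=> M * r).
have pi2 : 0 < 2 * pi :> R by rewrite mulr_gt0 ?pi_gt0.
rewrite integral_cst// [X in (_ * (_ * X))%E](_ : _ = (2 * pi)%:E); last first.
  exact: lebesgue_measure_turn.
rewrite ger0_norm ?mulr_ge0// -!EFinM lee_fin => h.
apply: le_trans (h _ _ _) _ => //.
- by have /cintegrable_measurable := ccontinuous_integrand cF.
- apply: aeW => t _; rewrite !cnormM cnorm_circle//.
  by rewrite cnorm_i mul1r ler_wpM2r.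
- by rewrite le_eqVlt; apply/orP; left; apply/eqP; ring.
Qed.

End CircleIntegral.

Section RieszSymmetric.
Variable R : realType.
Variables (H : set (vfield R)) (A P : vfield R -> vfield R).
Hypothesis HL2 : H `<=` @L2 R.
Hypothesis HD : forall f g (a : R[i]), H f -> H g -> H (fun x => f x + a *: g x).
Hypothesis HA : forall f, H f -> H (A f).
Hypothesis symA : forall f g, H f -> H g -> inner (A f) g = inner f (A g).

(** The difference f - g lies in H and serves as the test field. *)
Lemma aeq_inner f g : H f -> H g -> (forall h, H h -> inner f h = inner g h) ->
  aeq f g.
Proof.
move=> Hf Hg fg; pose d x := f x + (-1) *: g x.
have Hd : H d by exact: HD.
have d0 : norm2 d = 0.
  apply/eqP; rewrite -sqrf_eq0; apply/eqP/complexI; rewrite -innerff_norm.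
  rewrite innerDl; [|exact: HL2..].
  by rewrite fg// mulN1r subrr.
have := norm2_eq0 (HL2 Hd) d0; apply: filterS => x /=.
by rewrite /d scaleN1r => /eqP; rewrite subr_eq0 => /eqP.
Qed.

(** Symmetry forces linearity up to null sets: both sides have the same inner
    products with the elements of H. *)
Lemma symmetric_linear f g (a : R[i]) : H f -> H g ->
  aeq (A (fun x => f x + a *: g x)) (fun x => A f x + a *: A g x).
Proof.
move=> Hf Hg; apply: aeq_inner.
- by apply: HA; exact: HD.
- by apply: HD; exact: HA.
move=> h Hh; rewrite symA//; last exact: HD.
rewrite !innerDl; try by apply: HL2; try exact: HA.
by rewrite !symA.
Qed.

Lemma symmetric_aeq f g : H f -> H g -> aeq f g -> aeq (A f) (A g).
Proof.
move=> Hf Hg fg; apply: aeq_inner; [exact: HA|exact: HA|] => h Hh.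
rewrite !symA//; apply: inner_aeql => //; try exact: HL2.
by apply: HL2; exact: HA.
Qed.

Section resolvent.
Variables (z : R[i]) (Rz : vfield R -> vfield R).
Hypothesis rz : is_resolvent H A z Rz.

Let HRz f : H f -> H (Rz f). Proof. by case: rz => h _ _; exact: h. Qed.

Lemma resolvent_eq f : H f -> aeq (fun x => z *: Rz f x - A (Rz f) x) f.
Proof.
move=> Hf; case: rz => _ e _; apply/e => //; first exact: HRz.
by apply: aeW.
Qed.

Lemma A_resolvent f : H f ->
  aeq (A (Rz f)) (fun x => z *: Rz f x + (-1) *: f x).
Proof.
move=> Hf; have := resolvent_eq Hf; apply: filterS => x /= <-.
by rewrite scaleN1r opprB addrC subrK.
Qed.

(** A is moved to the left, where A R(z) f = z R(z) f - f. *)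
Lemma inner_resolvent_A f g : H f -> H g ->
  inner (Rz f) (A g) = z * inner (Rz f) g - inner f g.
Proof.
move=> Hf Hg; have HR := HRz Hf; rewrite -symA//.
have L2z : L2 (fun x => z *: Rz f x) by apply: L2Z; exact: HL2.
rewrite (inner_aeql _ _ _ (A_resolvent Hf)); last 3 first.
- by apply: HL2; exact: HA.
- by apply: L2D => //; exact: HL2.
- exact: HL2.
rewrite innerDl ?innerZl ?mulN1r//; exact: HL2.
Qed.

(** As <A R f, R f> is real for symmetric A, taking imaginary parts in
    [inner_resolvent_A] at g = R f gives Im z |R f|^2 = Im <f, R f>; this is the
    bound of the resolvent by the inverse distance to the real axis. *)
Lemma inner_resolvent_bound f g : H f -> H g ->
  `|Im z| * cnorm (inner (Rz f) g) <= norm2 f * norm2 g.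
Proof.
move=> Hf Hg; have HR := HRz Hf.
have key : `|Im z| * norm2 (Rz f) <= norm2 f.
  have E : Im z * norm2 (Rz f) ^+ 2 = Im (inner f (Rz f)).
    have := inner_resolvent_A Hf HR; rewrite innerff_norm => e.
    have : Im (inner (Rz f) (A (Rz f))) = 0.
      have := innerJ (Rz f) (A (Rz f)); rewrite symA// => /(congr1 (@complex.Im _)).
      by rewrite cReImE; lra.
    by rewrite e !cReImE/=; lra.
  have B : `|Im z| * norm2 (Rz f) ^+ 2 <= norm2 f * norm2 (Rz f).
    apply: le_trans (cauchy_schwarz (HL2 Hf) (HL2 HR)); apply: le_trans (normr_Im _).
    by rewrite -E normrM (ger0_norm (sqr_ge0 _)).
  have := norm2_ge0 (Rz f); rewrite le_eqVlt => /predU1P[<-|np].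
    by rewrite mulr0 norm2_ge0.
  by rewrite -(ler_pM2r np) -mulrA -expr2.
have cs := cauchy_schwarz (HL2 HR) (HL2 Hg).
apply: le_trans (ler_wpM2l (normr_ge0 _) cs) _.
by rewrite mulrA ler_wpM2r ?norm2_ge0.
Qed.

End resolvent.

Lemma resolvent_identity (z w : R[i]) Rz Rw f :
  is_resolvent H A z Rz -> is_resolvent H A w Rw -> H f ->
  aeq (fun x => Rw f x + (-1) *: Rz f x) (Rz (fun x => (z - w) *: Rw f x)).
Proof.
move=> rz rw Hf.
have HR : H (Rz f) by case: rz => h _ _; exact: h.
have HW : H (Rw f) by case: rw => h _ _; exact: h.
have HZ (a : R[i]) g : H g -> H (fun x => a *: g x).
  move=> Hg; have := HD (a - 1) Hg Hg.
  rewrite (_ : (fun x => _) = (fun x => a *: g x))//.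
  by apply/funext => x; rewrite scalerBl scale1r addrC subrK.
case: (rz) => _ e _; apply/e; [exact: HZ|exact: HD|].
have := symmetric_linear (-1) HW HR; have := A_resolvent rz Hf.
have := A_resolvent rw Hf; apply: filterS3 => x /= -> -> ->.
by apply/matrixP => i j; rewrite !mxE; ring.
Qed.

(** The resolvent identity bounds |R(w) f - R(z) f| by C |z - w| |R(w) f|.  The
    norm of R(w) is not controlled uniformly in w, but when C |z - w| <= 1/2 the
    part of R(w) f that differs from R(z) f is absorbed in the left-hand side. *)
Lemma resolvent_lipschitz (z : R[i]) Rz f : is_resolvent H A z Rz -> H f ->
  exists K d : R, [/\ 0 <= K, 0 < d & forall w Rw, is_resolvent H A w Rw ->
    cnorm (z - w) < d ->
    norm2 (fun x => Rw f x + (-1) *: Rz f x) <= K * cnorm (z - w)].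
Proof.
move=> rz Hf; have HR : H (Rz f) by case: rz => h _ _; exact: h.
have [c cR] : exists c : R, forall g, H g -> norm2 (Rz g) <= c * norm2 g by case: rz.
pose C := `|c| + 1.
have C0 : 0 < C by rewrite ltr_wpDl.
exists (2 * C * norm2 (Rz f)), (2 * C)^-1; split.
- by rewrite !mulr_ge0 ?norm2_ge0// ltW.
- by rewrite invr_gt0 mulr_gt0.
move=> w Rw rw zw.
have HW : H (Rw f) by case: rw => h _ _; exact: h.
have HZ (a : R[i]) g : H g -> H (fun x => a *: g x).
  move=> Hg; have := HD (a - 1) Hg Hg.
  rewrite (_ : (fun x => _) = (fun x => a *: g x))//.
  by apply/funext => x; rewrite scalerBl scale1r addrC subrK.
set d := (fun x => _).
have Hd : H d by exact: HD.
have e1 : norm2 d <= C * cnorm (z - w) * norm2 (Rw f).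
  rewrite (norm2_aeq _ _ (resolvent_identity rz rw Hf)); first last.
  - by apply: HL2; case: rz => h _ _; apply: h; exact: HZ.
  - exact: HL2.
  apply: le_trans (cR _ (HZ _ _ HW)) _; rewrite norm2Z; last exact: HL2.
  rewrite -mulrA ler_wpM2r ?mulr_ge0 ?cnorm_ge0 ?norm2_ge0//.
  by apply: le_trans (ler_norm _) _; rewrite lerDl.
have e2 : norm2 (Rw f) <= norm2 (Rz f) + norm2 d.
  have := norm2D (HL2 HR) (HL2 Hd).
  rewrite (_ : (fun x => _) = Rw f)//; apply/funext => x.
  by rewrite /d scale1r scaleN1r addrC subrK.
have zw2 : C * cnorm (z - w) <= 2^-1.
  rewrite -(ler_pM2l (ltr0n R 2)) mulrA mulfV ?pnatr_eq0// -ler_pdivlMl ?mulr_gt0//.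
  by rewrite mulr1 ltW.
have n0 := norm2_ge0 d; have m0 := norm2_ge0 (Rz f); have k0 := cnorm_ge0 (z - w).
have : C * cnorm (z - w) * norm2 (Rw f) <=
    C * cnorm (z - w) * norm2 (Rz f) + 2^-1 * norm2 d.
  apply: le_trans (ler_wpM2l _ e2) _; first by rewrite mulr_ge0// ltW.
  by rewrite mulrDr lerD2l ler_wpM2r.
by move=> e3; rewrite (_ : 2 * C * norm2 (Rz f) * cnorm (z - w) =
  2 * (C * cnorm (z - w) * norm2 (Rz f))); [lra|ring].
Qed.

Section projection.
Variables (rho : R) (res : R[i] -> vfield R -> vfield R).
Hypothesis rho0 : 0 < rho.
Hypothesis resP : forall z, 0 < `|z| < rho%:C -> is_resolvent H A z (res z).

Lemma circle_resolvent (r t : R) : 0 < r < rho ->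
  is_resolvent H A (circle r t) (res (circle r t)).
Proof.
move=> /andP[r0 r1]; apply: resP; rewrite cnormE cnorm_circle ?ltW//.
by apply/andP; split; [rewrite -(ltcR 0 r) in r0|rewrite ltcR].
Qed.

(** Continuity along the circles is what makes the contour integrals additive in
    the integrand. *)
Lemma ccontinuous_resolvent (r : R) f g : 0 < r < rho -> H f -> H g ->
  ccontinuous (fun t => inner (res (circle r t) f) g).
Proof.
move=> rr Hf Hg.
suff key t (e : R) : 0 < e -> \forall s \near t,
    cnorm (inner (res (circle r t) f) g - inner (res (circle r s) f) g) < e.
  split=> t; apply/cvgrPdist_lt => e e0; have := key t e e0; apply: filterS => s.
  - by move/(le_lt_trans _); apply; rewrite -cReN -cReD; exact: normr_Re.
  - by move/(le_lt_trans _); apply; rewrite -cImN -cImD; exact: normr_Im.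
move=> e0; have rt := circle_resolvent t rr.
have Ht : H (res (circle r t) f) by case: rt => h _ _; exact: h.
have [K [d [K0 d0 Kd]]] := resolvent_lipschitz rt Hf.
have g0 := norm2_ge0 g.
pose e' := e / (K * norm2 g + 1).
have e'0 : 0 < e' by rewrite divr_gt0// ltr_wpDl// mulr_ge0.
pose m := Num.min d e'.
have m0 : 0 < m by rewrite lt_min d0.
have [cr ci] := ccontinuous_circle r.
have m20 : 0 < m / 2 by rewrite divr_gt0.
have /cvgrPdist_lt /(_ _ m20) nr := cr t.
have /cvgrPdist_lt /(_ _ m20) ni := ci t.
apply: filterS2 nr ni => s nr ni.
have zs : cnorm (circle r t - circle r s) < m.
  apply: le_lt_trans (cnorm_le_ReIm _) _.
  by rewrite !cReImE; lra.
have rs := circle_resolvent s rr.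
have Hs : H (res (circle r s) f) by case: rs => h _ _; exact: h.
move: zs; rewrite lt_min => /andP[zd ze].
have := Kd _ _ rs zd; set dd := (fun x => _) => hd.
have Hdd : H dd by exact: HD.
have -> : inner (res (circle r t) f) g - inner (res (circle r s) f) g = - inner dd g.
  by rewrite innerDl; [rewrite mulN1r opprB|exact: HL2..].
rewrite cnormN; apply: le_lt_trans (cauchy_schwarz (HL2 Hdd) (HL2 Hg)) _.
apply: le_lt_trans (ler_wpM2r g0 hd) _.
rewrite mulrAC.
have KG : 0 < K * norm2 g + 1 by rewrite ltr_wpDl// mulr_ge0.
move: ze; rewrite /e' ltr_pdivlMr// => ze.
apply: le_lt_trans ze; rewrite [leRHS]mulrC ler_wpM2r ?cnorm_ge0// lerDl//.
Qed.

Hypothesis PH : forall f, H f -> H (P f).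
Hypothesis Pint : forall r : R, 0 < r < rho -> forall f g, H f -> H g ->
  inner (P f) g =
  (2 * pi%:C * 'i%C)^-1 * circle_integral r (fun z => inner (res z f) g).

Lemma cnorm_2pii : cnorm (2 * pi%:C * 'i%C : R[i]) = 2 * pi.
Proof.
by rewrite !cnormM cnorm_i mulr1 cnormC cnorm_nat ger0_norm ?pi_ge0.
Qed.

(** By [inner_resolvent_A], <R(z) f, A^3 g> - r^2 <R(z) f, A g> equals
    (z^3 - r^2 z) <R(z) f, g> up to a polynomial in z, whose contour integral
    vanishes.  On the circle z^3 - r^2 z = 2 i z^2 Im z, and the factor Im z
    compensates the growth of the resolvent at the real axis. *)
Lemma third_moment_bound (r : R) f g : 0 < r < rho -> H f -> H g ->
  cnorm (inner (P f) (A (A (A g))) - (r ^+ 2)%:C * inner (P f) (A g)) <=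
  4 * r ^+ 3 * (norm2 f * norm2 g).
Proof.
move=> rr Hf Hg; have r0 : 0 < r by case/andP: rr.
have [HAg HAAg] : H (A g) /\ H (A (A g)) by split; do !apply: HA.
rewrite !(Pint rr)//; last exact: HA.
set C := _^-1; set r2 := (r ^+ 2)%:C.
rewrite mulrCA -mulrBr cnormM.
pose E z := (z ^+ 3 - r2 * z) * inner (res z f) g.
pose a := inner f g; pose b := inner f (A g); pose c := inner f (A (A g)).
have cX n := ccontinuousX n (ccontinuous_circle r).
have cc := @ccontinuous_cst R.
have cres h : H h -> ccontinuous (fun t => inner (res (circle r t) f) h).
  exact: ccontinuous_resolvent.
have cE : ccontinuous (fun t => E (circle r t)).
  apply: ccontinuousM; last exact: cres.
  apply: ccontinuousD; first exact: cX.
  under eq_fun do rewrite -mulNr.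
  by apply: ccontinuousM => //; exact: ccontinuous_circle.
have c2 : ccontinuous (fun t => - a * circle r t ^+ 2) by exact: ccontinuousM.
have c1 : ccontinuous (fun t => - b * circle r t ^+ 1) by exact: ccontinuousM.
have c0 : ccontinuous (fun t => (r2 * a - c) * circle r t ^+ 0) by exact: ccontinuousM.
have -> : circle_integral r (fun z => inner (res z f) (A (A (A g)))) -
    r2 * circle_integral r (fun z => inner (res z f) (A g)) = circle_integral r E.
  rewrite -mulNr -circle_integralZ; last exact: cres.
  rewrite -circle_integralD; first last.
  - by apply: ccontinuousM => //; exact: cres.
  - by apply: cres; apply: HA.
  transitivity (circle_integral r (fun z => E z +
      (- a * z ^+ 2 + (- b * z ^+ 1 + (r2 * a - c) * z ^+ 0)))).
    rewrite /circle_integral; congr cintegral; apply/funext => t.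
    have rt := circle_resolvent t rr.
    rewrite !(inner_resolvent_A rt)// /E -/a -/b -/c.
    by congr (_ * _); ring.
  rewrite circle_integralD//; last by do 2!apply: ccontinuousD => //.
  rewrite circle_integralD//; last by apply: ccontinuousD.
  rewrite circle_integralD// !circle_integralZ// !circle_integral_pow.
  by rewrite !mulr0 !addr0.
have N0 : 0 <= norm2 f * norm2 g by rewrite mulr_ge0 ?norm2_ge0.
have EB t : cnorm (E (circle r t)) <= 2 * r ^+ 2 * (norm2 f * norm2 g).
  have rt := circle_resolvent t rr.
  have := inner_resolvent_bound rt Hf Hg; rewrite /E cnormM.
  have -> : circle r t ^+ 3 - r2 * circle r t =
     circle r t * circle r t * (2 * (Im (circle r t))%:C * 'i%C).
    have -> : r2 = circle r t * ((circle r t)^*)%R by rewrite mulJ cnorm_circle// ltW.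
    by apply: complex_ext; rewrite !exprS expr0 !cReImE/=; ring.
  move=> h; rewrite !cnormM (cnorm_circle t (ltW r0)).
  rewrite (cnorm_nat R 2) cnorm_i mulr1 [cnorm _%:C]cnormC.
  have h2 : 2 * r ^+ 2 * (`|Im (circle r t)| * cnorm (inner (res (circle r t) f) g))
      <= 2 * r ^+ 2 * (norm2 f * norm2 g).
    by apply: ler_wpM2l h; rewrite mulr_ge0// sqr_ge0.
  apply: le_trans h2.
  by rewrite le_eqVlt; apply/orP; left; apply/eqP; ring.
have M0 : 0 <= 2 * r ^+ 2 * (norm2 f * norm2 g).
  by apply: mulr_ge0 => //; rewrite mulr_ge0// sqr_ge0.
have B := circle_integral_bound (ltW r0) M0 cE EB.
rewrite /C cnormV cnorm_2pii.
have p0 := pi_gt0 R.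
rewrite ler_pdivrMl ?mulr_gt0//; apply: le_trans B _.
by rewrite le_eqVlt; apply/orP; left; apply/eqP; ring.
Qed.

(** Subtracting the bounds of [third_moment_bound] for r and r / 2 eliminates the
    third moment and leaves |<P f, A g>| <= 8 |f| |g| r for every small r. *)
Lemma inner_riesz_A f g : H f -> H g -> inner (P f) (A g) = 0.
Proof.
move=> Hf Hg; apply: cnorm_eq0; set m := inner (P f) (A g).
set N := norm2 f * norm2 g.
have N0 : 0 <= N by rewrite mulr_ge0 ?norm2_ge0.
have key (r : R) : 0 < r < rho -> cnorm m <= 8 * N * r.
  move=> /andP[r0 r1].
  have h1 := third_moment_bound (_ : 0 < r < rho) Hf Hg.
  have h2 := third_moment_bound (_ : 0 < r / 2 < rho) Hf Hg.
  have {h1} := h1 _; rewrite r0 r1 => /(_ isT) h1.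
  have {h2} := h2 _; rewrite divr_gt0// => h2.
  have {}h2 := h2 (_ : r / 2 < rho); have rr : r / 2 < rho by lra.
  have {h2} := h2 rr.
  move: h1; rewrite -/m -/N; set m3 := inner _ _ => h1 h2.
  have e : (r ^+ 2 - (r / 2) ^+ 2)%:C * m =
    (m3 - ((r / 2) ^+ 2)%:C * m) + - (m3 - (r ^+ 2)%:C * m).
    by rewrite rmorphB/=; ring.
  have : cnorm ((r ^+ 2 - (r / 2) ^+ 2)%:C * m) <= 4 * (r / 2) ^+ 3 * N + 4 * r ^+ 3 * N.
    by rewrite e; apply: le_trans (cnormD _ _) _; rewrite cnormN lerD.
  rewrite cnormM cnormC.
  have -> : r ^+ 2 - (r / 2) ^+ 2 = 3 / 4 * r ^+ 2 by field.
  have r20 : 0 < 3 / 4 * r ^+ 2 by rewrite mulr_gt0 ?exprn_gt0.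
  rewrite (ger0_norm (ltW r20)) => h.
  rewrite -(ler_pM2l r20); apply: le_trans h _.
  have : 0 <= r ^+ 3 * N by rewrite mulr_ge0// exprn_ge0// ltW.
  have -> : 4 * (r / 2) ^+ 3 * N = 1 / 2 * (r ^+ 3 * N) by field.
  have -> : 3 / 4 * r ^+ 2 * (8 * N * r) = 6 * (r ^+ 3 * N) by field.
  by lra.
apply/eqP; rewrite eq_le cnorm_ge0 andbT; apply/ler_addgt0Pr => e e0; rewrite add0r.
pose r := Num.min (rho / 2) (e / (8 * N + 1)).
have D0 : 0 < 8 * N + 1 by rewrite ltr_wpDl// mulr_ge0.
have r0 : 0 < r by rewrite lt_min !divr_gt0.
have rr : 0 < r < rho.
  by rewrite r0 /r gt_min ltr_pdivrMr// ltr_pMr// ltr1n.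
apply: le_trans (key _ rr) _.
have : r <= e / (8 * N + 1) by rewrite ge_min lexx orbT.
rewrite ler_pdivlMr// => h; apply: le_trans h; rewrite mulrC ler_wpM2l ?ltW//.
by rewrite ltrDl.
Qed.

(** If A g = 0 then [inner_resolvent_A] reads <R(z) f, g> = <f, g> / z, whose
    contour integral is 2 pi i <f, g>. *)
Lemma inner_riesz_ker f g : H f -> H g -> aeq (A g) (fun=> 0) ->
  inner (P f) g = inner f g.
Proof.
move=> Hf Hg g0; have r0 : 0 < rho / 2 by rewrite divr_gt0.
have rr : 0 < rho / 2 < rho by rewrite r0 ltr_pdivrMr// ltr_pMr// ltr1n.
rewrite (Pint rr)//.
transitivity ((2 * pi%:C * 'i%C)^-1 *
    circle_integral (rho / 2) (fun z => inner f g * z^-1)).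
  congr (_ * _); rewrite /circle_integral; congr cintegral; apply/funext => t.
  congr (_ * _); have rt := circle_resolvent t rr.
  have Ht : H (res (circle (rho / 2) t) f) by case: rt => h _ _; exact: h.
  have := inner_resolvent_A rt Hf Hg.
  rewrite (inner_aeqr _ _ _ g0) ?inner0r; last 3 first.
  - by apply: HL2; exact: HA.
  - exact: L20.
  - exact: HL2.
  move/esym/eqP; rewrite subr_eq0 => /eqP <-; rewrite mulrAC mulfV ?mul1r//.
  apply/eqP => c0; have := cnorm_circle t (ltW r0).
  by rewrite c0 cnorm0; lra.
rewrite circle_integralZ.
  rewrite circle_integral_inv// mulrCA mulVf ?mulr1//.
  by apply/eqP => c0; have := cnorm_2pii; rewrite c0 cnorm0; have := pi_gt0 R; lra.
have [a b] := @ccontinuous_circle R (rho / 2).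
have E t : (circle (rho / 2) t)^-1 =
    ((rho / 2) ^- 2)%:C * ((circle (rho / 2) t)^*)%R.
  have z0 : circle (rho / 2) t != 0.
    apply/eqP => c0; have := cnorm_circle t (ltW r0).
    by rewrite c0 cnorm0; lra.
  apply: (mulfI z0); rewrite mulfV// mulrCA mulJ cnorm_circle ?ltW//.
  by rewrite -rmorphM/= mulVf// expf_eq0/= gt_eqF.
under eq_fun do rewrite E.
apply: ccontinuousM; first exact: ccontinuous_cst.
split; first by under eq_fun do rewrite cReJ.
under eq_fun do rewrite cImJ.
by move=> t; apply: cvgN; exact: b.
Qed.

End projection.

Hypothesis rP : riesz_projection0 H A P.

Lemma riesz_projection_mem f : H f -> H (P f).
Proof. by case: rP => h _; exact: h. Qed.

(** <A P f, g> = <P f, A g> vanishes for all g in H by [inner_riesz_A]. *)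
Lemma riesz_projection_sub_ker f : H f -> aeq (A (P f)) (fun=> 0).
Proof.
move=> Hf; have HPf := riesz_projection_mem Hf.
have H0 : H (fun=> 0).
  have := HD (-1) Hf Hf; rewrite (_ : (fun x => _) = fun=> 0)//.
  by apply/funext => x; rewrite scaleN1r subrr.
apply: aeq_inner => //; first exact: HA.
move=> g Hg; rewrite symA// [RHS]innerJ inner0r rmorph0.
by case: rP => PH [rho [res [rho0 resP Pint]]]; exact: (inner_riesz_A rho0 resP Pint Hf Hg).
Qed.

Lemma inner_riesz_projection f g : H f -> H g -> aeq (A g) (fun=> 0) ->
  inner (P f) g = inner f g.
Proof.
move=> Hf Hg g0.
by case: rP => PH [rho [res [rho0 resP Pint]]]; exact: (inner_riesz_ker rho0 resP Pint Hf Hg g0).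
Qed.

(** P f - f belongs to the kernel of A and, by [inner_riesz_projection], is
    orthogonal to that kernel. *)
Lemma riesz_projection_ker f : H f -> aeq (A f) (fun=> 0) -> aeq (P f) f.
Proof.
move=> Hf f0; have HPf := riesz_projection_mem Hf.
pose d x := P f x + (-1) *: f x.
have Hd : H d by exact: HD.
have d0 : aeq (A d) (fun=> 0).
  have := symmetric_linear (-1) HPf Hf; have := riesz_projection_sub_ker Hf.
  move: f0; apply: filterS3 => x /= e1 e2 ->.
  by rewrite e1 e2 scaler0 addr0.
have : norm2 d = 0.
  apply/eqP; rewrite -sqrf_eq0; apply/eqP/complexI; rewrite -innerff_norm.
  rewrite {1}/d innerDl; [|exact: HL2..].
  by rewrite inner_riesz_projection// mulN1r subrr.
move/(norm2_eq0 (HL2 Hd)); apply: filterS => x /=.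
by rewrite /d scaleN1r => /eqP; rewrite subr_eq0 => /eqP.
Qed.

End RieszSymmetric.

(** * Power kernels on the line *)

Section PowerIntegrals.
Variable R : realType.
Local Notation leb := (@lebesgue_measure R).

Lemma measurable_shift (t : R) :
  measurable_fun setT ((fun s => s - t) : measurableTypeR R -> measurableTypeR R).
Proof. by apply: measurable_funB => //; exact: measurable_cst. Qed.

Lemma integral_shift (t : R) (f : measurableTypeR R -> \bar R) :
  measurable_fun setT f -> (forall s, 0 <= f s)%E ->
  (\int[leb]_s f ((s : R) - t)%R = \int[leb]_s f s)%E.
Proof.
move=> mf f0; have ms := measurable_shift t.
pose phi : {mfun measurableTypeR R >-> measurableTypeR R} :=
  HB.pack ((fun s => s - t) : measurableTypeR R -> measurableTypeR R)
    (isMeasurableFun.Build _ _ _ _ _ ms).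
rewrite -[LHS]/(\int[leb]_(s in phi @^-1` setT) (f \o phi) s)%E.
rewrite -(@ge0_integral_pushforward _ _ _ _ _ _ ms)//.
apply: eq_measure_integral => A mA _ /=; apply/esym.
apply: (@lebesgue_measure_unique R (pushforward leb phi)) => // _ [[a b]] _ <-.
rewrite -[RHS]/(leb (phi @^-1` _)).
have -> : phi @^-1` `]a, b] = `](a + t), (b + t)]%classic; last first.
  by rewrite /= !lebesgue_measure_itv/= !lte_fin ltrD2r -!EFinB opprD addrACA subrr addr0.
by apply/seteqP; split => s /=; rewrite !in_itv/= ltrBrDr lerBlDr.
Qed.

Lemma integral_bigcup_le (F : (set (measurableTypeR R))^nat)
    (f : measurableTypeR R -> R) (C : R) :
  nondecreasing_seq F -> (forall i, measurable (F i)) ->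
  measurable_fun setT f -> (forall s, 0 <= f s) ->
  (forall i, \int[leb]_(s in F i) (f s)%:E <= C%:E)%E ->
  (\int[leb]_(s in \bigcup_i F i) (f s)%:E <= C%:E)%E.
Proof.
move=> ndF mF mf f0 FC.
have cv : (\int[leb]_(s in F i) (f s)%:E @[i --> \oo] -->
    \int[leb]_(s in \bigcup_i F i) (f s)%:E)%E.
  apply: ge0_nondecreasing_set_cvg_integral => //.
  - by move=> i; apply/measurable_EFinP; exact: measurable_funS mf.
  - by move=> i s _; rewrite lee_fin.
rewrite -(cvg_lim _ cv)//; apply: lime_le; first by apply/cvg_ex; eexists; exact: cv.
by apply: nearW => i; exact: FC.
Qed.

Lemma integral_powR (p a b : R) : 0 < a -> a < b -> p + 1 != 0 ->
  (\int[leb]_(s in `[a, b]) (s `^ p)%:E =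
   ((b `^ (p + 1) - a `^ (p + 1)) / (p + 1))%:E)%E.
Proof.
move=> a0 ab p1.
have dF (s : R) : 0 < s ->
    is_derive s (1 : R) (fun s => (p + 1)^-1 * s `^ (p + 1)) (s `^ p).
  move=> s0; apply: (is_derive_eq (is_deriveZ ((p + 1)^-1 : R) (is_derive1_powR (p + 1) s0))).
  by rewrite -[_ *: _]/(_ * _) mulrA mulVf// mul1r addrK.
have dp (s : R) : 0 < s -> derivable (fun s => s `^ p) s (1 : R).
  by move=> s0; have [] := is_derive1_powR p s0.
have cont (f : R -> R) : (forall s : R, 0 < s -> derivable f s (1 : R)) ->
    forall s : R, 0 < s -> {for s, continuous f}.
  move=> df s s0; apply: differentiable_continuous; apply/derivable1_diffP.
  exact: df.
have cF (s : R) : 0 < s -> {for s, continuous (fun s => (p + 1)^-1 * s `^ (p + 1))}.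
  by move=> s0; apply: (cont _ _ _ s0) => u u0; case: (dF u u0).
rewrite (@continuous_FTC2 _ _ (fun s => (p + 1)^-1 * s `^ (p + 1)))//.
- by rewrite -EFinB -mulrBr mulrC.
- apply: continuous_in_subspaceT => s; rewrite inE/= in_itv/= => /andP[as_ _].
  by apply: cont => //; exact: lt_le_trans as_.
- split.
  + move=> s; rewrite in_itv/= => /andP[as_ _].
    by have [] := dF s (lt_trans a0 as_).
  + by apply: cvg_at_right_filter; exact: cF.
  + by apply: cvg_at_left_filter; apply: cF; exact: lt_trans ab.
- move=> s; rewrite in_itv/= => /andP[as_ _].
  by rewrite derive1E; have [_ ->] := dF s (lt_trans a0 as_).
Qed.

(** Integrable at 0 when a < 1 and at infinity when 1 < c.  The summand 1 serves
    [powR_le_majorant] at the points s with |s| < 1 <= |s - t|. *)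
Definition powR_majorant (a c s : R) : R := if `|s| < 1 then 1 + `|s| `^ (- a) else `|s| `^ (- c).

Lemma powR_majorant_ge0 a c s : 0 <= powR_majorant a c s.
Proof. by rewrite /powR_majorant; case: ifP => _; rewrite ?addr_ge0 ?powR_ge0. Qed.

Lemma measurable_norm_powR (p : R) :
  measurable_fun setT (fun s : measurableTypeR R => `|s| `^ p : R).
Proof.
exact/(@measurableT_comp _ _ _ _ _ _ (fun x : R => x `^ p)%R).
Qed.

Lemma measurable_powR_majorant a c :
  measurable_fun setT (powR_majorant a c : measurableTypeR R -> R).
Proof.
apply: measurable_fun_ifT.
- by apply: measurable_fun_ltr; last exact: measurable_cst.
- by apply: measurable_funD; [exact: measurable_cst|exact: measurable_norm_powR].
- exact: measurable_norm_powR.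
Qed.

(** The half-line is exhausted by the intervals [1/(n+1), n+2], on which the two
    powers are integrated explicitly on either side of 1. *)
Lemma integral_powR_majorant_pos a c : 0 <= a < 1 -> 1 < c -> exists2 C : R, 0 <= C &
  (\int[leb]_(s in `]0%R, +oo[) (powR_majorant a c s)%:E <= C%:E)%E.
Proof.
move=> /andP[a0 a1] c1.
have mt := measurable_powR_majorant a c.
pose F n := (`[n.+1%:R^-1, n.+2%:R] : set R)%classic.
have cover : `]0%R, +oo[%classic = \bigcup_n F n.
  apply/seteqP; split=> [s|s [n _]]; rewrite /F/= !in_itv/= ?andbT => s0.
    have [n nP] : exists n, s^-1 <= n.+1%:R /\ s <= n.+1%:R.
      pose m := Num.max s^-1 s.
      exists (Num.truncn m); have := truncnS_gt m.
      by rewrite gt_max => /andP[h1 h2]; split; exact: ltW.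
    case: nP => h1 h2; exists n => //=; rewrite in_itv/=; apply/andP; split.
      by rewrite -[leRHS]invrK lef_pV2// posrE// invr_gt0.
    by apply: le_trans h2 _; rewrite ler_nat.
  by case/andP: s0 => s0 _; apply: lt_le_trans s0; rewrite invr_gt0.
have a1' : 0 < 1 - a by rewrite subr_gt0.
have c1' : 0 < c - 1 by rewrite subr_gt0.
exists (1 + (1 - a)^-1 + (c - 1)^-1).
  by rewrite !addr_ge0// invr_ge0 ltW.
rewrite cover; apply: integral_bigcup_le => //.
- move=> m n mn; rewrite subsetEset => s; rewrite /F/= !in_itv/= => /andP[h1 h2].
  apply/andP; split.
    by apply: le_trans h1; rewrite lef_pV2 ?posrE// ler_nat ltnS.
  by apply: le_trans h2 _; rewrite ler_nat !ltnS.
- by move=> i; exact: measurable_itv.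
- exact: powR_majorant_ge0.
move=> n.
have e0 : 0 < n.+1%:R^-1 :> R by rewrite invr_gt0.
have e1 : n.+1%:R^-1 <= 1 :> R by rewrite invf_le1// ler1n.
have e2 : 1 < n.+2%:R :> R by rewrite ltr1n.
have FE : F n = `[n.+1%:R^-1, 1%R]%classic `|` `]1%R, n.+2%:R]%classic.
  by rewrite /F; apply: itv_bndbnd_setU; rewrite bnd_simp// ltW.
have mtS D : measurable_fun D (fun s : measurableTypeR R => (powR_majorant a c s)%:E).
  by apply/measurable_EFinP; exact: measurable_funS mt.
have mpS p D : measurable_fun D (fun s : measurableTypeR R => (s `^ p)%:E).
  by apply/measurable_EFinP; exact: (measurable_funS _ _ (measurable_powR p)).
rewrite FE ge0_integral_setU//=; last 2 first.
- by move=> s _; rewrite lee_fin powR_majorant_ge0.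
- rewrite disj_set2E; apply/eqP/seteqP; split=> // s [] /=; rewrite !in_itv/=.
  by move=> /andP[_ h1] /andP[h2 _]; have := lt_le_trans h2 h1; rewrite ltxx.
rewrite EFinD; apply: leeD.
- apply: (@le_trans _ _ (\int[leb]_(s in `[(n.+1%:R^-1)%R, 1%R]) (1%:E + (s `^ (- a))%:E)%E)%E).
    apply: ge0_le_integral => //.
    + by move=> s _; rewrite lee_fin powR_majorant_ge0.
    + by apply: emeasurable_funD => //; exact: measurable_cst.
    + move=> s /=; rewrite in_itv/= => /andP[h1 h2]; rewrite -EFinD lee_fin /powR_majorant.
      have s0 : 0 < s by exact: lt_le_trans h1.
      rewrite (ger0_norm (ltW s0)); have [h3//|h3] := ltP (s : R) 1.
      have -> : s = 1 by apply/eqP; rewrite eq_le h2 h3.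
      by rewrite !powR1 lerDl.
  rewrite ge0_integralD//; last by move=> s _; rewrite lee_fin powR_ge0.
  rewrite integral_cst// mul1e EFinD; apply: leeD.
    suff : (leb `[n.+1%:R^-1%R, 1%R]%classic <= 1)%E by [].
    rewrite lebesgue_measure_itv/=.
    by case: ifP => _; rewrite -?EFinB lee_fin// lerBlDr lerDl ltW.
  have [->|ne1] := eqVneq (n.+1%:R^-1 : R) 1.
    rewrite set_itv1 integral_set1// lee_fin invr_ge0 ltW//.
  rewrite integral_powR//; first last.
  + by rewrite addrC gt_eqF.
  + by rewrite lt_neqAle ne1.
  rewrite lee_fin powR1 [- a + 1]addrC; apply: ler_piMl.
    by rewrite invr_ge0 ltW.
  by rewrite lerBlDr lerDl powR_ge0.
- apply: (@le_trans _ _ (\int[leb]_(s in `[1%R, n.+2%:R%R]) (s `^ (- c))%:E)%E).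
    apply: (@le_trans _ _ (\int[leb]_(s in `]1%R, n.+2%:R%R]) (s `^ (- c))%:E)%E).
      apply: ge0_le_integral => //.
      + by move=> s _; rewrite lee_fin powR_majorant_ge0.
      + move=> s /=; rewrite in_itv/= => /andP[h1 h2]; rewrite lee_fin /powR_majorant.
        rewrite ger0_norm ?(ltW (lt_trans ltr01 h1))//.
        by rewrite ltNge (ltW h1).
    apply: ge0_subset_integral => //.
    + by move=> s _; rewrite lee_fin powR_ge0.
    + by move=> s /=; rewrite !in_itv/= => /andP[/ltW -> ->].
  rewrite integral_powR//; last by rewrite addrC subr_eq0 lt_eqF.
  rewrite lee_fin powR1 (_ : - c + 1 = - (c - 1)); last by rewrite opprB addrC.
  rewrite invrN mulrN -mulNr opprB.
  apply: ler_piMl; first by rewrite invr_ge0 ltW.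
  by rewrite lerBlDr lerDl powR_ge0.
Qed.

Lemma integral_powR_majorant a c : 0 <= a < 1 -> 1 < c -> exists2 C : R, 0 <= C &
  (\int[leb]_s (powR_majorant a c s)%:E <= C%:E)%E.
Proof.
move=> a01 c1; have [C C0 HC] := integral_powR_majorant_pos a01 c1.
exists (C + C); first by rewrite addr_ge0.
have mt : measurable_fun setT (fun s : measurableTypeR R => (powR_majorant a c s)%:E).
  by apply/measurable_EFinP; exact: measurable_powR_majorant.
have -> : [set: measurableTypeR R] = `]-oo, 0%R]%classic `|` `]0%R, +oo[%classic.
  apply/seteqP; split=> // s _ /=; rewrite !in_itv/= andbT.
  by case: (leP s 0) => h; [left|right].
rewrite ge0_integral_setU//=; first last.
- rewrite disj_set2E; apply/eqP/seteqP; split=> // s [] /=; rewrite !in_itv/= andbT.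
  by move=> h1 h2; have := lt_le_trans h2 h1; rewrite ltxx.
- by move=> s _; rewrite lee_fin powR_majorant_ge0.
- exact: measurable_funS mt.
rewrite EFinD leeD//.
have := @ge0_integration_by_substitution0 R (fun s => (powR_majorant a c s)%:E) mt.
move=> /(_ (fun s => powR_majorant_ge0 a c s)).
under [in X in _ = X]eq_integral do rewrite /powR_majorant normrN -/(powR_majorant a c _).
move=> <-; rewrite -integral_itv_obnd_cbnd//.
exact: measurable_funS mt.
Qed.

(** Where |s - t| and |s| are both at least 1, the product is at most the power
    -(a + b) of the smaller of the two. *)
Lemma powR_le_majorant (a b s t : R) : 0 <= a -> 0 <= b ->
  `|s - t| `^ (- a) * (1 + `|s|) `^ (- b) <=
  powR_majorant a (a + b) (s - t) + powR_majorant a (a + b) s.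
Proof.
move=> a0 b0.
have anti (p x y : R) : 0 <= p -> 0 < x -> x <= y -> y `^ (- p) <= x `^ (- p).
  move=> p0 x0 xy; have y0 := lt_le_trans x0 xy.
  by rewrite !powRN lef_pV2 ?posrE ?powR_gt0// ge0_ler_powR// nnegrE ltW.
have one p : 1 `^ p = 1 :> R by rewrite powR1.
have J0 : 1 <= 1 + `|s| by rewrite lerDl.
have J1 : (1 + `|s|) `^ (- b) <= 1 by rewrite -[leRHS](one (- b)) anti.
have u0 : 0 <= `|s - t| `^ (- a) by exact: powR_ge0.
have [u1|u1] := ltP `|s - t| 1.
  have h : `|s - t| `^ (- a) * (1 + `|s|) `^ (- b) <= `|s - t| `^ (- a).
    by rewrite ler_piMr.
  have := powR_majorant_ge0 a (a + b) s; rewrite [powR_majorant _ _ (s - t)]/powR_majorant u1; lra.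
have ua : `|s - t| `^ (- a) <= 1 by rewrite -[leRHS](one (- a)) anti.
have [s1|s1] := ltP `|s| 1.
  have := powR_majorant_ge0 a (a + b) (s - t); rewrite [powR_majorant _ _ s]/powR_majorant s1.
  have := powR_ge0 `|s| (- a).
  have := mulr_ile1 u0 (powR_ge0 _ _) ua J1; lra.
have s0 : 0 < `|s| by exact: lt_le_trans s1.
have t0 : 0 < `|s - t| by exact: lt_le_trans u1.
have Js : (1 + `|s|) `^ (- b) <= `|s| `^ (- b) by rewrite anti// lerDr.
rewrite /powR_majorant !ltNge u1 s1/=.
have split (x : R) : 0 < x -> x `^ (- (a + b)) = x `^ (- a) * x `^ (- b).
  by move=> x0; rewrite opprD powRD// (gt_eqF x0) implybT.
have [st|st] := leP `|s| `|s - t|.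
  apply: (@le_trans _ _ (`|s| `^ (- (a + b)))); last by rewrite lerDr powR_ge0.
  by rewrite split// ler_pM ?powR_ge0// anti.
apply: (@le_trans _ _ (`|s - t| `^ (- (a + b)))); last by rewrite lerDl powR_ge0.
rewrite split// ler_pM ?powR_ge0//; apply: le_trans Js _; rewrite anti// ltW//.
Qed.

(** The bound is uniform in t because the integral of the translated majorant
    does not depend on t. *)
Lemma integral_kernel_le (a b : R) : 0 <= a < 1 -> 0 <= b -> 1 < a + b ->
  exists2 C : R, 0 <= C & forall t : R,
    (\int[leb]_s (`|s - t| `^ (- a) * (1 + `|s|) `^ (- b))%:E <= C%:E)%E.
Proof.
move=> a01 b0 ab; have [C C0 HC] := integral_powR_majorant a01 ab.
have a0 : 0 <= a by case/andP: a01.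
exists (C + C); first by rewrite addr_ge0.
have mt : measurable_fun setT (fun s : measurableTypeR R => (powR_majorant a (a + b) s)%:E).
  by apply/measurable_EFinP; exact: measurable_powR_majorant.
move=> t.
have mts : measurable_fun setT (fun s : measurableTypeR R => (powR_majorant a (a + b) ((s : R) - t))%:E).
  exact: (measurableT_comp mt (measurable_shift t)).
apply: (@le_trans _ _ (\int[leb]_s ((powR_majorant a (a + b) ((s : R) - t)%R)%:E +
    (powR_majorant a (a + b) s)%:E)%E)%E).
  apply: ge0_le_integral => //.
  - apply/measurable_EFinP; apply: measurable_funM.
      exact: (measurableT_comp (measurable_norm_powR (- a)) (measurable_shift t)).
    apply/(@measurableT_comp _ _ _ _ _ _ (fun x : R => x `^ (- b))%R) => //.
    by apply: measurable_funD; [exact: measurable_cst|].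
  - exact: emeasurable_funD.
  - by move=> s _; rewrite -EFinD lee_fin; exact: powR_le_majorant.
rewrite ge0_integralD//; try by move=> s _; rewrite lee_fin powR_majorant_ge0.
rewrite (@integral_shift t (fun s => (powR_majorant a (a + b) s)%:E))//; last first.
  by move=> s; rewrite lee_fin powR_majorant_ge0.
by rewrite EFinD leeD.
Qed.

End PowerIntegrals.

(** * The Schur test *)

Section SchurTest.
Local Open Scope ereal_scope.
Context d (X : measurableType d) (R : realType).
Variable mu : {sigma_finite_measure set X -> \bar R}.
Variables (k : X * X -> R) (p q : X -> R) (C : R).
Hypothesis mk : measurable_fun setT k.
Hypothesis k0 : forall z, (0 <= k z)%R.
Hypothesis mp : measurable_fun setT p.
Hypothesis p0 : forall x, (0 < p x)%R.
Hypothesis mq : measurable_fun setT q.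
Hypothesis q0 : forall x, (0 < q x)%R.
Hypothesis C0 : (0 < C)%R.
Hypothesis kq : forall x, \int[mu]_y (k (x, y) * q y)%:E <= (C * p x)%:E.
Hypothesis kp : forall y, \int[mu]_x (k (x, y) * p x)%:E <= (C * q y)%:E.

Lemma measurable_section (g : X * X -> R) x : measurable_fun setT g ->
  measurable_fun setT (fun y => (g (x, y))%:E).
Proof. by move=> mg; apply/measurable_EFinP; exact: measurableT_comp. Qed.

Lemma measurable_section2 (g : X * X -> R) y : measurable_fun setT g ->
  measurable_fun setT (fun x => (g (x, y))%:E).
Proof. by move=> mg; apply/measurable_EFinP; exact: measurableT_comp. Qed.

Lemma integral_kernel_measurable (g : X * X -> R) : measurable_fun setT g ->
  (forall z, (0 <= g z)%R) -> measurable_fun setT (fun x => \int[mu]_y (g (x, y))%:E).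
Proof.
move=> mg g0.
apply: (@measurable_fun_fubini_tonelli_F _ _ _ _ _ mu (fun z => (g z)%:E)).
- exact/measurable_EFinP.
- by move=> z; rewrite lee_fin.
Qed.

Variable f : X -> R.
Hypothesis mf : measurable_fun setT f.
Hypothesis f0 : forall x, (0 <= f x)%R.
Hypothesis f2 : \int[mu]_x (f x ^+ 2)%:E < +oo.

Let S x := \int[mu]_y (k (x, y) * f y)%:E.
Let W x := \int[mu]_y (k (x, y) * (f y ^+ 2 / q y))%:E.

Let mfst (g : X -> R) : measurable_fun setT g -> measurable_fun setT (fun z : X * X => g z.1).
Proof. by move=> mg; exact: (measurableT_comp mg measurable_fst). Qed.

Let msnd (g : X -> R) : measurable_fun setT g -> measurable_fun setT (fun z : X * X => g z.2).
Proof. by move=> mg; exact: (measurableT_comp mg measurable_snd). Qed.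

Let mf2q : measurable_fun setT (fun y => (f y ^+ 2 / q y)%R).
Proof.
apply: measurable_funM; first exact: measurable_funX.
have -> : (fun x => (q x)^-1%R) = (fun x => (q x) `^ (-1))%R.
  by apply/funext => x; rewrite powR_inv1// ltW.
exact: (measurableT_comp (measurable_powR _) mq).
Qed.

Let f2q_ge0 y : (0 <= f y ^+ 2 / q y)%R.
Proof. by rewrite divr_ge0 ?sqr_ge0// ltW. Qed.

Let mS : measurable_fun setT S.
Proof.
apply: (@integral_kernel_measurable (fun z => (k z * f z.2)%R)).
- by apply: measurable_funM => //; exact: msnd.
- by move=> z; rewrite mulr_ge0.
Qed.

Let mW : measurable_fun setT W.
Proof.
apply: (@integral_kernel_measurable (fun z => (k z * (f z.2 ^+ 2 / q z.2))%R)).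
- by apply: measurable_funM => //; exact: (msnd mf2q).
- by move=> z; rewrite mulr_ge0// divr_ge0// ?sqr_ge0// ltW.
Qed.

Let S0 x : 0 <= S x.
Proof. by apply: integral_ge0 => y _; rewrite lee_fin mulr_ge0. Qed.

Let W0 x : 0 <= W x.
Proof.
by apply: integral_ge0 => y _; rewrite lee_fin mulr_ge0// divr_ge0// ?sqr_ge0// ltW.
Qed.

(** Young's inequality f y <= l q y / 2 + f y ^ 2 / (2 l q y), integrated against k. *)
Lemma schur_young x (w l : R) : (0 < l)%R -> W x = w%:E ->
  S x <= (l / 2 * (C * p x) + w / (2 * l))%:E.
Proof.
move=> l0 Ww.
have h : S x <= \int[mu]_y ((l / 2)%:E * (k (x, y) * q y)%:E +
    (2 * l)^-1%:E * (k (x, y) * (f y ^+ 2 / q y))%:E).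
  apply: ge0_le_integral => //.
  - by move=> y _; rewrite lee_fin mulr_ge0.
  - apply: (measurable_section x (g := fun z => (k z * f z.2)%R)).
    by apply: measurable_funM => //; exact: msnd.
  - apply: emeasurable_funD; apply: measurable_funeM.
    + apply: (measurable_section x (g := fun z => (k z * q z.2)%R)).
      by apply: measurable_funM => //; exact: msnd.
    + apply: (measurable_section x (g := fun z => (k z * (f z.2 ^+ 2 / q z.2))%R)).
      by apply: measurable_funM => //; exact: (msnd mf2q).
  - move=> y _; rewrite -!EFinM -EFinD lee_fin.
    have qy := q0 y; have ky := k0 (x, y).
    have -> : (l / 2 * (k (x, y) * q y) + (2 * l)^-1 * (k (x, y) * (f y ^+ 2 / q y)) =
      k (x, y) * f y + k (x, y) * (l * q y - f y) ^+ 2 / (2 * l * q y))%R.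
      by field; rewrite !gt_eqF.
    rewrite lerDl; apply: divr_ge0; first by rewrite mulr_ge0 ?sqr_ge0.
    by apply/ltW; rewrite !mulr_gt0.
apply: le_trans h _; rewrite ge0_integralD//; first last.
- apply: measurable_funeM; apply: (measurable_section x (g := fun z => (k z * (f z.2 ^+ 2 / q z.2))%R)).
  by apply: measurable_funM => //; exact: (msnd mf2q).
- move=> y _; rewrite -EFinM lee_fin; apply: mulr_ge0; last exact: mulr_ge0.
  by rewrite invr_ge0 mulr_ge0// ltW.
- apply: measurable_funeM; apply: (measurable_section x (g := fun z => (k z * q z.2)%R)).
  by apply: measurable_funM => //; exact: msnd.
- move=> y _; rewrite -EFinM lee_fin; apply: mulr_ge0; first by rewrite divr_ge0// ltW.
  by apply: mulr_ge0 => //; exact: ltW.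
rewrite ge0_integralZl//; first last.
- by rewrite lee_fin divr_ge0// ltW.
- move=> y _; rewrite lee_fin mulr_ge0//; exact: ltW.
- apply: (measurable_section x (g := fun z => (k z * q z.2)%R)).
  by apply: measurable_funM => //; exact: msnd.
rewrite ge0_integralZl//; first last.
- by rewrite lee_fin invr_ge0 mulr_ge0// ltW.
- move=> y _; rewrite lee_fin mulr_ge0// divr_ge0 ?sqr_ge0//; exact: ltW.
- apply: (measurable_section x (g := fun z => (k z * (f z.2 ^+ 2 / q z.2))%R)).
  by apply: measurable_funM => //; exact: (msnd mf2q).
rewrite EFinD; apply: leeD.
- rewrite [leRHS]EFinM; apply: lee_wpmul2l => //.
  by rewrite lee_fin divr_ge0// ltW.
- by rewrite -[X in _ * X]/(W x) Ww -EFinM lee_fin mulrC.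
Qed.

(** The best choice in [schur_young] is l = S x / (C p x). *)
Lemma schur_cauchy x : S x * S x <= (C * p x)%:E * W x.
Proof.
have a0 : (0 < C * p x)%R by rewrite mulr_gt0.
have := W0 x; case Ww : (W x) => [w| |] // w0; last first.
  by rewrite mulry gtr0_sg// mul1e leey.
have := schur_young ltr01 Ww; have := S0 x; have Y := fun l l0 => @schur_young x w l l0 Ww.
case Ss : (S x) => [s| |] //; rewrite lee_fin => s0 _.
rewrite -!EFinM lee_fin.
move: s0; rewrite le_eqVlt => /predU1P[<-|s0].
  by rewrite mul0r mulr_ge0// ?ltW// -lee_fin.
have := Y (s / (C * p x))%R (divr_gt0 s0 a0); rewrite Ss lee_fin => h.
have e : (s / (C * p x) / 2 * (C * p x) + w / (2 * (s / (C * p x))) =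
   s / 2 + (C * p x * w) / (2 * s))%R.
  by field; rewrite !gt_eqF//.
move: h; rewrite e => h.
have : (s / 2 <= (C * p x * w) / (2 * s))%R by lra.
rewrite ler_pdivlMr ?mulr_gt0// => {}h.
by apply: le_trans h; rewrite le_eqVlt; apply/orP; left; apply/eqP; field.
Qed.

(** By [schur_cauchy] the integral of S^2 is at most that of C p W; Tonelli's
    theorem exchanges the order of integration, and the second Schur bound
    turns the weight p into q, which cancels the denominator in W. *)
Lemma integral_S2 : \int[mu]_x (S x * S x) < +oo.
Proof.
have step1 : \int[mu]_x (S x * S x) <= \int[mu]_x ((C * p x)%:E * W x).
  apply: ge0_le_integral => //.
  - by move=> x _; rewrite mule_ge0.
  - exact: emeasurable_funM.
  - apply: emeasurable_funM => //; apply/measurable_EFinP.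
    by apply: measurable_funM => //; exact: measurable_cst.
  - by move=> x _; exact: schur_cauchy.
apply: le_lt_trans step1 _.
have mF : measurable_fun setT (fun z : X * X => (k z * p z.1 * (f z.2 ^+ 2 / q z.2))%:E).
  apply/measurable_EFinP; apply: measurable_funM; last exact: (msnd mf2q).
  by apply: measurable_funM => //; exact: mfst.
have F0 z : 0 <= (k z * p z.1 * (f z.2 ^+ 2 / q z.2))%:E.
  by rewrite lee_fin mulr_ge0 ?divr_ge0 ?mulr_ge0 ?sqr_ge0// ltW.
have step2 : \int[mu]_x ((C * p x)%:E * W x) =
    C%:E * \int[mu]_x \int[mu]_y (k (x, y) * p x * (f y ^+ 2 / q y))%:E.
  transitivity (\int[mu]_x (C%:E * \int[mu]_y (k (x, y) * p x * (f y ^+ 2 / q y))%:E)).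
    2: rewrite ge0_integralZl//.
    2: exact: (measurable_fun_fubini_tonelli_F (fun z : X * X => (k z * p z.1 * (f z.2 ^+ 2 / q z.2))%:E)).
    2: by move=> x _; apply: integral_ge0 => y _; exact: (F0 (x, y)).
    2: by rewrite lee_fin ltW.
  apply: eq_integral => x _; rewrite EFinM -muleA; congr (_ * _).
  transitivity (\int[mu]_y ((p x)%:E * (k (x, y) * (f y ^+ 2 / q y))%:E)); last first.
    by apply: eq_integral => y _; rewrite -EFinM; congr (_%:E); ring.
  rewrite ge0_integralZl//.
  - apply: (measurable_section x (g := fun z => (k z * (f z.2 ^+ 2 / q z.2))%R)).
    by apply: measurable_funM => //; exact: (msnd mf2q).
  - by move=> y _; rewrite lee_fin mulr_ge0// divr_ge0// ?sqr_ge0// ltW.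
  - by rewrite lee_fin ltW.
rewrite step2 (fubini_tonelli (fun z : X * X => (k z * p z.1 * (f z.2 ^+ 2 / q z.2))%:E))//=.
have step3 y : \int[mu]_x (k (x, y) * p x * (f y ^+ 2 / q y))%:E <= C%:E * (f y ^+ 2)%:E.
  under eq_integral do rewrite mulrC EFinM.
  rewrite ge0_integralZl//; first last.
  - by rewrite lee_fin divr_ge0 ?sqr_ge0// ltW.
  - by move=> x _; rewrite lee_fin mulr_ge0// ltW.
  - apply: (measurable_section2 y (g := fun z => (k z * p z.1)%R)).
    by apply: measurable_funM => //; exact: mfst.
  apply: (@le_trans _ _ ((f y ^+ 2 / q y)%:E * (C * q y)%:E)).
    by apply: lee_wpmul2l => //; rewrite lee_fin divr_ge0 ?sqr_ge0// ltW.
  by rewrite -!EFinM lee_fin le_eqVlt; apply/orP; left; apply/eqP; field; rewrite gt_eqF.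
rewrite lte_mul_pinfty ?lee_fin ?ltW//.
apply: (@le_lt_trans _ _ (\int[mu]_y (C%:E * (f y ^+ 2)%:E))).
  apply: ge0_le_integral => //.
  - by move=> y _; apply: integral_ge0 => x _; exact: (F0 (x, y)).
  - exact: (measurable_fun_fubini_tonelli_G (fun z : X * X => (k z * p z.1 * (f z.2 ^+ 2 / q z.2))%:E)).
  - by apply: measurable_funeM; apply/measurable_EFinP; exact: measurable_funX.
rewrite ge0_integralZl//; first last.
- by rewrite lee_fin ltW.
- by move=> y _; rewrite lee_fin sqr_ge0.
- by apply/measurable_EFinP; exact: measurable_funX.
by rewrite lte_mul_pinfty ?lee_fin ?ltW.
Qed.

Lemma schur_test : exists h : X -> R,
  [/\ measurable_fun setT h, (forall x, (0 <= h x)%R),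
      \int[mu]_x (h x ^+ 2)%:E < +oo &
      {ae mu, forall x, \int[mu]_y (k (x, y) * f y)%:E = (h x)%:E}].
Proof.
exists (fine \o S).
have SS0 x : 0 <= S x * S x by rewrite mule_ge0.
have mSS : measurable_fun setT (fun x => S x * S x) by exact: emeasurable_funM.
have fineS : {ae mu, forall x, S x = (fine (S x))%:E}.
  have : mu.-integrable setT (fun x => S x * S x).
    apply/integrableP; split=> //.
    under eq_integral do rewrite gee0_abs//.
    exact: integral_S2.
  move/integrable_ae => /(_ measurableT); apply: filterS => x /= /(_ I) h.
  rewrite fineK// ge0_fin_numE// ltey; apply/eqP => Sy.
  by move: h; rewrite Sy.
split=> //.
- exact: measurableT_comp.
- by move=> x; exact: fine_ge0.
- rewrite (ae_eq_integral (fun x => S x * S x))//; first exact: integral_S2.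
  + apply/measurable_EFinP; apply: measurable_funX; exact: measurableT_comp.
  + by apply: filterS fineS => x /= e _; rewrite [in RHS]e expr2.
Qed.

End SchurTest.

(** * A weighted singular kernel on the plane *)

(** The underlying measure of the packed structure is convertible to [m], so that
    results on iterated integrals for the former apply verbatim to the latter. *)
Definition sigma_finite_pack d (T : measurableType d) (R : realType)
    (m : {measure set T -> \bar R}) (h : sigma_finite setT m) :
    {sigma_finite_measure set T -> \bar R} :=
  SigmaFiniteMeasure.Pack (SigmaFiniteMeasure.Class
    (Measure.measure_function_Content_isMeasure_mixin (Measure.class m))
    (isSFinite.Axioms_ T R m (sfinite_measure_sigma_finite h))
    (isSigmaFinite.Axioms_ T R m h)).

Section PlaneKernel.
Variable R : realType.
Local Notation leb := (@lebesgue_measure R).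
Local Notation mu2 := (mu2 R).
Implicit Types x y : plane R.

Lemma mu2_sigma_finite : sigma_finite setT mu2.
Proof.
have /sigma_finiteP[F [TF ndF Foo]] := sigma_finiteT leb.
exists (fun n => F n `*` F n).
  rewrite -setXTT TF predeqE => -[x y]; split.
    move=> [/= [n _ Fnx] [k _ Gky]]; exists (maxn n k) => //; split.
    - by move: x Fnx; exact/subsetPset/ndF/leq_maxl.
    - by move: y Gky; exact/subsetPset/ndF/leq_maxr.
  by move=> [n _ []/= ? ?]; split; exists n.
move=> k; have [? ?] := Foo k.
split; first exact: measurableX.
by rewrite [X in (X < _)%E]product_measure1E// lte_mul_pinfty// ge0_fin_numE.
Qed.

Definition smu2 : {sigma_finite_measure set (plane R) -> \bar R} :=
  sigma_finite_pack mu2_sigma_finite.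

Definition absp x : R := Num.sqrt (sqnorm x).

Lemma sqnorm_ge0 x : 0 <= sqnorm x.
Proof. by rewrite addr_ge0 ?sqr_ge0. Qed.

Lemma absp_ge0 x : 0 <= absp x. Proof. exact: sqrtr_ge0. Qed.

Lemma sqr_absp x : absp x ^+ 2 = sqnorm x.
Proof. by rewrite sqr_sqrtr// sqnorm_ge0. Qed.

Lemma japanese_ge1 x : 1 <= japanese x.
Proof. by rewrite -[leLHS]sqrtr1 ler_wsqrtr// lerDl sqnorm_ge0. Qed.

Lemma japanese_gt0 x : 0 < japanese x.
Proof. exact: lt_le_trans (japanese_ge1 x). Qed.

Lemma sqr_japanese x : japanese x ^+ 2 = 1 + sqnorm x.
Proof. by rewrite sqr_sqrtr// addr_ge0// sqnorm_ge0. Qed.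

(** The product [jap1 x.1 * jap1 x.2] is at most 2 <x>^2, so negative powers of
    <x> are dominated by products of functions of one coordinate. *)
Definition jap1 (s : R) : R := 1 + `|s|.

Lemma jap1_ge1 s : 1 <= jap1 s. Proof. by rewrite /jap1 lerDl. Qed.
Lemma jap1_gt0 s : 0 < jap1 s. Proof. exact: lt_le_trans (jap1_ge1 s). Qed.

Lemma jap1_le_japanese x : jap1 x.1 * jap1 x.2 <= 2 * japanese x ^+ 2.
Proof.
rewrite sqr_japanese /jap1 /sqnorm.
rewrite -[x.1 ^+ 2]real_normK ?num_real// -[x.2 ^+ 2]real_normK ?num_real//.
set a := `|x.1|; set b := `|x.2|.
have := sqr_ge0 (a - b); have := sqr_ge0 (a - 1); have := sqr_ge0 (b - 1).
by nra.
Qed.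

Lemma powRN_le (c a b p : R) : 0 < a -> 1 <= c -> a <= c * b -> 0 <= p ->
  b `^ (- p) <= c `^ p * a `^ (- p).
Proof.
move=> a0 c1 ab p0; have c0 : 0 < c by exact: lt_le_trans c1.
have b0 : 0 < b by rewrite -(pmulr_rgt0 _ c0); exact: lt_le_trans ab.
rewrite !powRN ler_pdivlMr ?powR_gt0// mulrC ler_pdivrMr ?powR_gt0//.
rewrite -powRM ?(ltW c0) ?(ltW b0)//.
by apply: ge0_ler_powR; rewrite // nnegrE ?mulr_ge0 ?(ltW a0) ?(ltW b0) ?(ltW c0).
Qed.

Lemma sqr_powR (a p : R) : 0 <= a -> (a ^+ 2) `^ p = a `^ (2 * p).
Proof. by move=> a0; rewrite -powR_mulrn// -powRrM. Qed.

Lemma japanese_powR_le x (p : R) : 0 <= p ->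
  japanese x `^ (- (2 * p)) <= 2 `^ p * (jap1 x.1 `^ (- p) * jap1 x.2 `^ (- p)).
Proof.
move=> p0; rewrite -powRM ?(ltW (jap1_gt0 _))// -mulrN -sqr_powR ?(ltW (japanese_gt0 _))//.
apply: (powRN_le _ _ (jap1_le_japanese x) p0); first by rewrite mulr_gt0 ?jap1_gt0.
by rewrite ler1n.
Qed.

(** By |x.1| |x.2| <= |x|^2.  The coordinates must not vanish, since the powers of
    0 on the right-hand side would then be 0. *)
Lemma absp_powR_le x (p : R) : 0 <= p -> x.1 != 0 -> x.2 != 0 ->
  absp x `^ (- (2 * p)) <= `|x.1| `^ (- p) * `|x.2| `^ (- p).
Proof.
move=> p0 x1 x2; rewrite -powRM// -mulrN -sqr_powR ?absp_ge0// -[leRHS]mul1r.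
have -> : 1 = 1 `^ p :> R by rewrite powR1.
apply: powRN_le => //; first by rewrite mulr_gt0// normr_gt0.
rewrite mul1r sqr_absp /sqnorm -[x.1 ^+ 2]real_normK ?num_real//.
rewrite -[x.2 ^+ 2]real_normK ?num_real//.
have := normr_ge0 x.1; have := normr_ge0 x.2.
move: `|x.1| `|x.2| => a b b0 a0.
by have := sqr_ge0 (a - b); have := mulr_ge0 a0 b0; nra.
Qed.

Lemma measurable_jap1_powR (p : R) :
  measurable_fun setT (fun s : measurableTypeR R => jap1 s `^ p).
Proof.
apply/(@measurableT_comp _ _ _ _ _ _ (fun x : R => x `^ p)%R) => //.
by apply: measurable_funD; [exact: measurable_cst|].
Qed.

Lemma measurable_japanese : measurable_fun setT (fun x => japanese x).
Proof.
apply: (measurableT_comp (@measurable_sqrt R)); apply: measurable_funD; first exact: measurable_cst.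
by apply: measurable_funD; apply: measurable_funX.
Qed.

Lemma measurable_japanese_powR (p : R) :
  measurable_fun setT (fun x => japanese x `^ p).
Proof.
apply/(@measurableT_comp _ _ _ _ _ _ (fun x : R => x `^ p)%R) => //.
exact: measurable_japanese.
Qed.

Lemma measurable_sub x : measurable_fun setT (fun y => x - y).
Proof.
apply/prod_measurable_funP; split.
- exact: (measurable_funB (measurable_cst _) measurable_fst).
- exact: (measurable_funB (measurable_cst _) measurable_snd).
Qed.

Lemma measurable_absp : measurable_fun setT absp.
Proof.
apply: (measurableT_comp (@measurable_sqrt R)).
by apply: measurable_funD; apply: measurable_funX.
Qed.

Lemma measurable_absp_powR x (p : R) :
  measurable_fun setT (fun y => absp (x - y) `^ p).
Proof.
apply/(@measurableT_comp _ _ _ _ _ _ (fun x : R => x `^ p)%R) => //.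
exact: (measurableT_comp measurable_absp (measurable_sub x)).
Qed.

Lemma integral_tensor (u v : measurableTypeR R -> R) :
  measurable_fun setT u -> measurable_fun setT v ->
  (forall s, 0 <= u s) -> (forall s, 0 <= v s) ->
  (\int[mu2]_x (u x.1 * v x.2)%:E = \int[leb]_s (u s)%:E * \int[leb]_t (v t)%:E)%E.
Proof.
move=> mu mv u0 v0.
have mf : measurable_fun setT (fun x => (u x.1 * v x.2)%:E).
  apply/measurable_EFinP; apply: measurable_funM.
    exact: (measurableT_comp mu measurable_fst).
  exact: (measurableT_comp mv measurable_snd).
rewrite (fubini_tonelli1 _ mf) => [|z]; last by rewrite lee_fin mulr_ge0.
rewrite /fubini_F /=.
under eq_integral => s _.
  under eq_integral do rewrite EFinM.
  rewrite ge0_integralZl//; first last.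
  - by rewrite lee_fin.
  - by move=> t _; rewrite lee_fin.
  - exact/measurable_EFinP.
  over.
rewrite /= ge0_integralZr//.
- exact/measurable_EFinP.
- by move=> s _; rewrite lee_fin.
- by apply: integral_ge0 => t _; rewrite lee_fin.
Qed.

(** The tensor bound is integrable since each factor decays like |s|^-(p/2). *)
Lemma integral_japanese (p : R) : 2 < p ->
  (\int[mu2]_x (japanese x `^ (- p))%:E < +oo)%E.
Proof.
move=> p2; have p21 : 1 < p / 2 by rewrite ltr_pdivlMr// mul1r.
have p20 : 0 <= p / 2 by rewrite ltW// (lt_trans ltr01).
have h01 : 0 <= (0 : R) < 1 by rewrite lexx ltr01.
have h1 : 1 < 0 + p / 2 by rewrite add0r.
have [C C0 HC] := integral_kernel_le h01 p20 h1.
have I1 : (\int[leb]_s (jap1 s `^ (- (p / 2)))%:E <= C%:E)%E.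
  apply: le_trans (HC 0); rewrite le_eqVlt; apply/orP; left; apply/eqP.
  by apply: eq_integral => s _; rewrite oppr0 powRr0 mul1r.
have mj := measurable_jap1_powR (- (p / 2)).
apply: (@le_lt_trans _ _ (\int[mu2]_x ((2 `^ (p / 2))%:E *
    (jap1 x.1 `^ (- (p / 2)) * jap1 x.2 `^ (- (p / 2)))%:E))%E).
  apply: ge0_le_integral => //.
  - by move=> x _; rewrite lee_fin powR_ge0.
  - by apply/measurable_EFinP; exact: measurable_japanese_powR.
  - apply: measurable_funeM; apply/measurable_EFinP; apply: measurable_funM.
      exact: (measurableT_comp mj measurable_fst).
    exact: (measurableT_comp mj measurable_snd).
  - move=> x _; rewrite -EFinM lee_fin; apply: le_trans (japanese_powR_le x p20).
    by rewrite mulrCA mulfV ?mulr1// pnatr_eq0.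
rewrite ge0_integralZl; [|by []| |by move=> x _; rewrite lee_fin mulr_ge0 ?powR_ge0
  |by rewrite lee_fin powR_ge0]; last first.
  apply/measurable_EFinP; apply: measurable_funM.
    exact: (measurableT_comp mj measurable_fst).
  exact: (measurableT_comp mj measurable_snd).
rewrite (integral_tensor mj mj) => [|s|s]; rewrite ?powR_ge0//.
have I0 : (0 <= \int[leb]_s (jap1 s `^ (- (p / 2)))%:E)%E.
  by apply: integral_ge0 => s _; rewrite lee_fin powR_ge0.
rewrite lte_mul_pinfty ?lee_fin ?powR_ge0//.
by rewrite lte_mul_pinfty// ?ge0_fin_numE//; apply: le_lt_trans I1 _; rewrite ltry.
Qed.

Lemma ae_coords (a : plane R) :
  {ae mu2, forall y, (a - y).1 != 0 /\ (a - y).2 != 0}.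
Proof.
have n1 : mu2.-negligible ([set a.1] `*` setT).
  apply/negligibleP; first exact: measurableX.
  rewrite [LHS]product_measure1E//.
  by rewrite [X in (X * _)%E](_ : _ = 0%E) ?mul0e//; exact: lebesgue_measure_set1.
have n2 : mu2.-negligible (setT `*` [set a.2]).
  apply/negligibleP; first exact: measurableX.
  rewrite [LHS]product_measure1E//.
  by rewrite [X in (_ * X)%E](_ : _ = 0%E) ?mule0//; exact: lebesgue_measure_set1.
apply: negligibleS (negligibleU n1 n2) => y /= /not_andP[] /negP; rewrite negbK subr_eq0.
- by move=> /eqP e; left; split => //=.
- by move=> /eqP e; right; split => //=.
Qed.

Section weighted_kernel.
Variable dl : R.
Hypothesis dl0 : 0 < dl < 2^-1.

(** The exponent of the Schur weights q = J^-(sg/2) and p = J^-(1/2).  In y the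
    total decay 1/2 + dl/2 + sg/2 = 1 + dl/4 exceeds 1; in x, [k1_p] relies on
    dl < sg < dl + 1. *)
Let sg : R := 1 - dl / 2.

Let k1 (z : measurableTypeR R * measurableTypeR R) : R :=
  jap1 z.1 `^ (- 2^-1) * `|z.1 - z.2| `^ (- 2^-1) * jap1 z.2 `^ (- (dl / 2)).

Let k1_ge0 z : 0 <= k1 z.
Proof. by rewrite /k1 !mulr_ge0 ?powR_ge0. Qed.

Let measurable_k1 : measurable_fun setT k1.
Proof.
apply: measurable_funM; first apply: measurable_funM.
- exact: (measurableT_comp (measurable_jap1_powR _) measurable_fst).
- apply: (measurableT_comp (measurable_norm_powR _)).
  exact: (measurable_funB measurable_fst measurable_snd).
- exact: (measurableT_comp (measurable_jap1_powR _) measurable_snd).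
Qed.

Let k1_q : exists2 C, 0 < C & forall s : R,
  (\int[leb]_t (k1 (s, t) * jap1 t `^ (- (sg / 2)))%:E <= (C * jap1 s `^ (- 2^-1))%:E)%E.
Proof.
have /andP[d0 d1] := dl0.
have h01 : 0 <= (2^-1 : R) < 1 by rewrite invr_ge0 ler0n invf_lt1 ?ltr1n ?ltr0n.
pose b := dl / 2 + sg / 2.
have b0 : 0 <= b by rewrite /b /sg; lra.
have h1 : 1 < 2^-1 + b by rewrite /b /sg; lra.
have [C C0 HC] := integral_kernel_le h01 b0 h1.
exists (C + 1); first by rewrite ltr_wpDl.
move=> s; apply: (@le_trans _ _ (\int[leb]_t ((jap1 s `^ (- 2^-1))%:E *
    (`|(t : R) - s| `^ (- 2^-1) * (1 + `|(t : R)|) `^ (- b))%:E))%E).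
  rewrite le_eqVlt; apply/orP; left; apply/eqP; apply: eq_integral => t _.
  rewrite -EFinM /k1/= distrC; congr (_%:E).
  have -> : - b = - (dl / 2) + - (sg / 2) by rewrite /b opprD.
  have Jt0 : 1 + `|(t : R)| != 0 by rewrite gt_eqF// (jap1_gt0 t).
  rewrite powRD ?Jt0 ?implybT//.
  by rewrite /jap1; ring.
have mk : measurable_fun setT (fun t : measurableTypeR R =>
    (`|(t : R) - s| `^ (- 2^-1) * (1 + `|(t : R)|) `^ (- b))%:E).
  apply/measurable_EFinP; apply: measurable_funM; last exact: (measurable_jap1_powR _).
  exact: (measurableT_comp (measurable_norm_powR _) (measurable_shift s)).
rewrite ge0_integralZl; [|by []|by []|by move=> t _; rewrite lee_fin mulr_ge0 ?powR_ge0
  |by rewrite lee_fin powR_ge0].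
rewrite [(C + 1) * _]mulrC EFinM; apply: lee_wpmul2l; first by rewrite lee_fin powR_ge0.
by apply: le_trans (HC s) _; rewrite lee_fin lerDl.
Qed.

(** The integral over s has to decay in t like J(t)^-(sg/2), whereas the kernel only
    supplies J(t)^-(dl/2).  The surplus factor J(t)^e, with e = (sg - dl) / 2, is
    distributed by J(t)^e <= 2 (J(s)^e + |s - t|^e) over two convergent integrals
    in s. *)
Let k1_p : exists2 C, 0 < C & forall t : R,
  (\int[leb]_s (k1 (s, t) * jap1 s `^ (- 2^-1))%:E <= (C * jap1 t `^ (- (sg / 2)))%:E)%E.
Proof.
have /andP[d0 d1] := dl0.
pose e := (sg - dl) / 2.
have [e0 e1] : 0 < e /\ e < 2^-1 by rewrite /e /sg; split; lra.
have h01 : 0 <= (2^-1 : R) < 1 by rewrite invr_ge0 ler0n invf_lt1 ?ltr1n ?ltr0n.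
have h02 : 0 <= 2^-1 - e < 1 by apply/andP; split; lra.
have b1 : 0 <= 1 - e by lra.
have c1 : 1 < 2^-1 + (1 - e) by lra.
have c2 : 1 < 2^-1 - e + 1 by lra.
have [C1 C10 HC1] := integral_kernel_le h01 b1 c1.
have [C2 C20 HC2] := integral_kernel_le h02 ler01 c2.
exists (2 * (C1 + C2) + 1).
  by rewrite ltr_wpDl// mulr_ge0// addr_ge0.
move=> t.
have Je (s : R) : jap1 t `^ e <= 2 * (jap1 s `^ e + `|s - t| `^ e).
  have Jt : jap1 t <= jap1 s + `|s - t|.
    rewrite /jap1 -addrA lerD2l.
    by have := ler_normB s (s - t); rewrite subKr.
  have two : 2 `^ e <= 2 :> R.
    by apply: ler1_powR; lra.
  pose m := Num.max (jap1 s) `|s - t|.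
  have m0 : 0 <= m by rewrite le_max normr_ge0 orbT.
  have Jm : jap1 t <= 2 * m.
    apply: le_trans Jt _; rewrite mulr_natl mulr2n lerD// le_max lexx ?orbT//.
  have h : jap1 t `^ e <= 2 * m `^ e.
    apply: (@le_trans _ _ ((2 * m) `^ e)).
      apply: ge0_ler_powR; [exact: ltW| |by rewrite nnegrE mulr_ge0|exact: Jm].
      by rewrite nnegrE; exact/ltW/jap1_gt0.
    by rewrite powRM// ler_wpM2r ?powR_ge0.
  apply: le_trans h _; rewrite ler_pM2l//.
  rewrite /m /Num.max; case: ifP => _; first by rewrite lerDr powR_ge0.
  by rewrite lerDl powR_ge0.
have pt (s : R) : k1 (s, t) * jap1 s `^ (- 2^-1) <= 2 * jap1 t `^ (- (sg / 2)) *
    (`|s - t| `^ (- 2^-1) * (1 + `|s|) `^ (- (1 - e)) +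
     `|s - t| `^ (- (2^-1 - e)) * (1 + `|s|) `^ (- 1)).
  have Js0 : jap1 s != 0 by rewrite gt_eqF// jap1_gt0.
  have Jt0 : jap1 t != 0 by rewrite gt_eqF// jap1_gt0.
  have E1 : jap1 t `^ (- (dl / 2)) = jap1 t `^ (- (sg / 2)) * jap1 t `^ e.
    have -> : - (dl / 2) = - (sg / 2) + e by rewrite /e; field.
    by rewrite powRD ?Jt0 ?implybT.
  have E2 : jap1 s `^ (- 1) = jap1 s `^ (- 2^-1) * jap1 s `^ (- 2^-1).
    by rewrite -powRD ?Js0 ?implybT//; congr (_ `^ _); field.
  have E3 : jap1 s `^ (- (1 - e)) = jap1 s `^ (- 1) * jap1 s `^ e.
    by rewrite -powRD ?Js0 ?implybT//; congr (_ `^ _); ring.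
  have E4 : `|s - t| `^ (- 2^-1) * `|s - t| `^ e <= `|s - t| `^ (- (2^-1 - e)).
    have [->|u0] := eqVneq `|s - t| 0.
      by rewrite [X in _ * X]powR0 ?gt_eqF// mulr0 powR_ge0.
    have -> : - (2^-1 - e) = - 2^-1 + e by ring.
    by rewrite [leRHS]powRD ?u0 ?implybT.
  rewrite -/(jap1 s) /k1/= E1 E3.
  set u := `|s - t| `^ (- 2^-1); set v := `|s - t| `^ e.
  have u0 : 0 <= u by exact: powR_ge0.
  apply: (@le_trans _ _ (jap1 s `^ (- 1) * u * jap1 t `^ (- (sg / 2)) *
     (2 * (jap1 s `^ e + v)))).
    have -> : jap1 s `^ (- 2^-1) * u * (jap1 t `^ (- (sg / 2)) * jap1 t `^ e) *
      jap1 s `^ (- 2^-1) = jap1 s `^ (- 1) * u * jap1 t `^ (- (sg / 2)) * jap1 t `^ e.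
      by rewrite E2; ring.
    by apply: ler_wpM2l => //; rewrite !mulr_ge0 ?powR_ge0.
  have -> : jap1 s `^ (- 1) * u * jap1 t `^ (- (sg / 2)) * (2 * (jap1 s `^ e + v)) =
    2 * jap1 t `^ (- (sg / 2)) * (u * (jap1 s `^ (- 1) * jap1 s `^ e) +
      u * v * jap1 s `^ (- 1)) by ring.
  by apply: ler_wpM2l; rewrite ?mulr_ge0 ?powR_ge0// lerD2l ler_wpM2r ?powR_ge0.
have mk a b : measurable_fun setT (fun s : measurableTypeR R =>
    (`|(s : R) - t| `^ a * (1 + `|(s : R)|) `^ b)%:E).
  apply/measurable_EFinP; apply: measurable_funM; last exact: (measurable_jap1_powR _).
  exact: (measurableT_comp (measurable_norm_powR _) (measurable_shift t)).
apply: (@le_trans _ _ (\int[leb]_s ((2 * jap1 t `^ (- (sg / 2)))%:E *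
   ((`|(s : R) - t| `^ (- 2^-1) * (1 + `|(s : R)|) `^ (- (1 - e)))%:E +
    (`|(s : R) - t| `^ (- (2^-1 - e)) * (1 + `|(s : R)|) `^ (- 1))%:E)))%E).
  apply: ge0_le_integral => //.
  - by move=> s _; rewrite lee_fin mulr_ge0 ?powR_ge0.
  - apply/measurable_EFinP; apply: measurable_funM; last exact: measurable_jap1_powR.
    by apply: (measurableT_comp measurable_k1).
  - by apply: measurable_funeM; exact: emeasurable_funD.
  - by move=> s _; rewrite -EFinD -EFinM lee_fin; exact: pt.
rewrite ge0_integralZl; [|by []|exact: emeasurable_funD
  |by move=> s _; rewrite -EFinD lee_fin addr_ge0 ?mulr_ge0 ?powR_ge0
  |by rewrite lee_fin mulr_ge0 ?powR_ge0].
rewrite ge0_integralD//; try by move=> s _; rewrite lee_fin mulr_ge0 ?powR_ge0.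
apply: (@le_trans _ _ ((2 * jap1 t `^ (- (sg / 2)))%:E * (C1 + C2)%:E)%E).
  apply: lee_wpmul2l; first by rewrite lee_fin mulr_ge0 ?powR_ge0.
  by rewrite EFinD leeD.
rewrite -EFinM lee_fin.
have -> : 2 * jap1 t `^ (- (sg / 2)) * (C1 + C2) =
  2 * (C1 + C2) * jap1 t `^ (- (sg / 2)) by ring.
by apply: ler_wpM2r; [exact: powR_ge0 | rewrite lerDl].
Qed.

(** Away from the coordinate lines through x, the kernel is dominated by the
    product of the one-dimensional kernels [k1] in the two coordinates; the Schur
    bounds [k1_q] and [k1_p] multiply as well. *)
Lemma integral_absp_kernel (f : plane R -> R) : measurable_fun setT f ->
  (forall x, 0 <= f x) -> (\int[mu2]_x (f x ^+ 2)%:E < +oo)%E ->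
  exists h : plane R -> R,
  [/\ measurable_fun setT h, (forall x, 0 <= h x),
      (\int[mu2]_x (h x ^+ 2)%:E < +oo)%E &
      {ae mu2, forall x, (\int[mu2]_y (japanese x `^ (- 1) * absp (x - y) `^ (- 1) *
         japanese y `^ (- dl) * f y)%:E <= (h x)%:E)%E}].
Proof.
move=> mf f0 f2; have /andP[d0 d1] := dl0.
have [C1 C10 HC1] := k1_q; have [C2 C20 HC2] := k1_p.
pose C := Num.max (C1 * C1) (C2 * C2).
have C0 : 0 < C by rewrite lt_max mulr_gt0.
pose k (z : plane R * plane R) := k1 (z.1.1, z.2.1) * k1 (z.1.2, z.2.2).
pose p x := jap1 x.1 `^ (- 2^-1) * jap1 x.2 `^ (- 2^-1).
pose q x := jap1 x.1 `^ (- (sg / 2)) * jap1 x.2 `^ (- (sg / 2)).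
have mk : measurable_fun setT k.
  apply: measurable_funM; apply: (measurableT_comp measurable_k1).
  - apply/prod_measurable_funP; split.
    + exact: (measurableT_comp measurable_fst measurable_fst).
    + exact: (measurableT_comp measurable_fst measurable_snd).
  - apply/prod_measurable_funP; split.
    + exact: (measurableT_comp measurable_snd measurable_fst).
    + exact: (measurableT_comp measurable_snd measurable_snd).
have k0 z : 0 <= k z by rewrite mulr_ge0.
have mJ2 (e : R) : measurable_fun setT (fun x : plane R => jap1 x.1 `^ e * jap1 x.2 `^ e).
  apply: measurable_funM.
    exact: (measurableT_comp (measurable_jap1_powR _) measurable_fst).
  exact: (measurableT_comp (measurable_jap1_powR _) measurable_snd).
have J20 (e : R) x : 0 < jap1 x.1 `^ e * jap1 x.2 `^ e.
  by rewrite mulr_gt0 ?powR_gt0 ?jap1_gt0.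
have mk1s (s : R) : measurable_fun setT (fun t : measurableTypeR R => k1 (s, t)).
  exact: (measurableT_comp measurable_k1).
have mk1t (t : R) : measurable_fun setT (fun s : measurableTypeR R => k1 (s, t)).
  exact: (measurableT_comp measurable_k1).
have kq x : (\int[smu2]_y (k (x, y) * q y)%:E <= (C * p x)%:E)%E.
  have mq s : measurable_fun setT (fun t => k1 (s, t) * jap1 t `^ (- (sg / 2))).
    by apply: measurable_funM => //; exact: measurable_jap1_powR.
  have q0 s t : 0 <= k1 (s, t) * jap1 t `^ (- (sg / 2)) by rewrite mulr_ge0 ?powR_ge0.
  have h := integral_tensor (mq x.1) (mq x.2) (q0 x.1) (q0 x.2).
  have -> : (\int[smu2]_y (k (x, y) * q y)%:E = \int[mu2]_y (k1 (x.1, y.1) * jap1 y.1 `^ (- (sg / 2)) *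
     (k1 (x.2, y.2) * jap1 y.2 `^ (- (sg / 2))))%:E)%E.
    by apply: eq_integral => y _; rewrite /k /q/=; congr (_%:E); ring.
  rewrite h; apply: (@le_trans _ _ ((C1 * jap1 x.1 `^ (- 2^-1))%:E * (C1 * jap1 x.2 `^ (- 2^-1))%:E)%E).
    by apply: lee_pmul; try by [exact: HC1|apply: integral_ge0 => s _; rewrite lee_fin mulr_ge0 ?powR_ge0].
  rewrite -EFinM lee_fin mulrACA; apply: ler_wpM2r; first exact/ltW/J20.
  by rewrite le_max lexx.
have kp y : (\int[smu2]_x (k (x, y) * p x)%:E <= (C * q y)%:E)%E.
  have mq t : measurable_fun setT (fun s => k1 (s, t) * jap1 s `^ (- 2^-1)).
    by apply: measurable_funM => //; exact: measurable_jap1_powR.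
  have q0 t s : 0 <= k1 (s, t) * jap1 s `^ (- 2^-1) by rewrite mulr_ge0 ?powR_ge0.
  have h := integral_tensor (mq y.1) (mq y.2) (q0 y.1) (q0 y.2).
  have -> : (\int[smu2]_x (k (x, y) * p x)%:E = \int[mu2]_x (k1 (x.1, y.1) * jap1 x.1 `^ (- 2^-1) *
     (k1 (x.2, y.2) * jap1 x.2 `^ (- 2^-1)))%:E)%E.
    by apply: eq_integral => x _; rewrite /k /p/=; congr (_%:E); ring.
  rewrite h; apply: (@le_trans _ _ ((C2 * jap1 y.1 `^ (- (sg / 2)))%:E * (C2 * jap1 y.2 `^ (- (sg / 2)))%:E)%E).
    by apply: lee_pmul; try by [exact: HC2|apply: integral_ge0 => s _; rewrite lee_fin mulr_ge0 ?powR_ge0].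
  rewrite -EFinM lee_fin mulrACA; apply: ler_wpM2r; first exact/ltW/J20.
  by rewrite le_max lexx orbT.
have [h [mh h0 h2 hS]] := @schur_test _ _ R smu2 k p q C mk k0 (mJ2 _) (J20 _)
  (mJ2 _) (J20 _) C0 kq kp f mf f0 f2.
pose K : R := 2 `^ 2^-1 * 2 `^ (dl / 2).
have K0 : 0 <= K by rewrite mulr_ge0 ?powR_ge0.
have pt x y : (x - y).1 != 0 -> (x - y).2 != 0 ->
    japanese x `^ (- 1) * absp (x - y) `^ (- 1) * japanese y `^ (- dl) <= K * k (x, y).
  move=> n1 n2.
  have h20 : 0 <= (2^-1 : R) by rewrite invr_ge0.
  have hd0 : 0 <= dl / 2 by rewrite divr_ge0// ltW.
  have e1 : (1 : R) = 2 * 2^-1 by rewrite mulfV// pnatr_eq0.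
  have ed : dl = 2 * (dl / 2) by field.
  have := japanese_powR_le x h20; rewrite -e1 => b1.
  have := absp_powR_le h20 n1 n2; rewrite -e1 => b2.
  have := japanese_powR_le y hd0; rewrite -ed => b3.
  have := ler_pM (mulr_ge0 (powR_ge0 _ _) (powR_ge0 _ _)) (powR_ge0 _ _)
    (ler_pM (powR_ge0 _ _) (powR_ge0 _ _) b1 b2) b3.
  move/le_trans; apply; rewrite le_eqVlt; apply/orP; left; apply/eqP.
  by rewrite /K /k /k1/=; ring.
exists (fun x => K * h x); split.
- by apply: measurable_funM => //; exact: measurable_cst.
- by move=> x; rewrite mulr_ge0.
- under eq_integral do rewrite exprMn EFinM.
  rewrite ge0_integralZl; [|by []|by apply/measurable_EFinP; exact: measurable_funX
    |by move=> x _; rewrite lee_fin sqr_ge0|by rewrite lee_fin sqr_ge0].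
  by rewrite lte_mul_pinfty// lee_fin sqr_ge0.
- apply: filterS hS => x hx; rewrite EFinM -hx.
  have mkf : measurable_fun setT (fun y => (k (x, y) * f y)%:E).
    apply/measurable_EFinP; apply: measurable_funM => //.
    exact: measurableT_comp.
  rewrite -ge0_integralZl; [|by []|exact: mkf|by move=> y _; rewrite lee_fin mulr_ge0
    |by rewrite lee_fin].
  apply: ae_ge0_le_integral => //.
  + by move=> y _; rewrite lee_fin !mulr_ge0 ?powR_ge0.
  + apply/measurable_EFinP; apply: measurable_funM => //.
    apply: measurable_funM; last exact: measurable_japanese_powR.
    by apply: measurable_funM; [exact: measurable_cst|exact: measurable_absp_powR].
  + by move=> y _; rewrite -EFinM lee_fin mulr_ge0// mulr_ge0.
  + exact: measurable_funeM.
  + apply: filterS (ae_coords x) => y [n1 n2] _; rewrite -EFinM lee_fin mulrA.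
    by apply: ler_wpM2r => //; exact: pt.
Qed.

End weighted_kernel.
End PlaneKernel.

(** * Iterated complex integrals and the Dirac kernel *)

Section ParametricIntegral.
Context d (X : measurableType d) (R : realType).
Variable mu : {sigma_finite_measure set X -> \bar R}.

Lemma measurable_Rintegral_section (g : X * X -> R) : measurable_fun setT g ->
  measurable_fun setT (fun x => \int[mu]_y g (x, y)).
Proof.
move=> mg; have mE : measurable_fun setT (EFin \o g) by exact/measurable_EFinP.
have mf : measurable_fun setT (@fine R) by exact: fine_measurable.
apply: (measurableT_comp mf).
have -> : (fun x => \int[mu]_y (g (x, y))%:E)%E = (fun x =>
    \int[mu]_y ((EFin \o g)^\+%E (x, y)) - \int[mu]_y ((EFin \o g)^\-%E (x, y)))%E.
  apply/funext => x; rewrite [LHS]integralE.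
  by congr (_ - _)%E; apply: eq_integral => y _; rewrite ?funeposE ?funenegE.
apply: emeasurable_funB.
- apply: measurable_fun_fubini_tonelli_F; first exact: measurable_funepos.
  by move=> z; exact: funepos_ge0.
- apply: measurable_fun_fubini_tonelli_F; first exact: measurable_funeneg.
  by move=> z; exact: funeneg_ge0.
Qed.

Lemma cmeasurable_cintegral (F : X * X -> R[i]) : cmeasurable setT F ->
  cmeasurable setT (fun x => cintegral mu setT (fun y => F (x, y))).
Proof.
move=> [mR mI]; split.
- exact: (measurable_Rintegral_section mR).
- exact: (measurable_Rintegral_section mI).
Qed.

(** The inner real-valued integrals agree with the extended ones only where these
    are finite, which by integrability is almost everywhere. *)
Lemma Rintegral_swap (g : X * X -> R) : measurable_fun setT g ->
  (\int[mu]_x \int[mu]_y `|g (x, y)|%:E < +oo)%E ->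
  \int[mu]_x (\int[mu]_y g (x, y)) = \int[mu]_y (\int[mu]_x g (x, y)).
Proof.
move=> mg gy.
have mE : measurable_fun setT (EFin \o g) by exact/measurable_EFinP.
have ig : (mu \x mu)%E.-integrable setT (EFin \o g).
  by apply/(integrable12ltyP _ _ mE).
have fin1 := integrable_fubini_F ig.
pose g' z := g (z.2, z.1).
have mg' : measurable_fun setT g'.
  apply: (measurableT_comp mg); apply/prod_measurable_funP; split => /=.
    exact: measurable_snd.
  exact: measurable_fst.
have mE' : measurable_fun setT (EFin \o g') by exact/measurable_EFinP.
have ig' : (mu \x mu)%E.-integrable setT (EFin \o g').
  apply/(integrable12ltyP _ _ mE'); apply: le_lt_trans gy; rewrite le_eqVlt.
  apply/orP; left; apply/eqP; apply: (@fubini_tonelli _ _ _ _ _ mu mu (fun z => `|g' z|%:E)).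
    by apply/measurable_EFinP; exact: measurableT_comp.
  by move=> z; rewrite lee_fin.
have fin2 := integrable_fubini_F ig'.
have H := Fubini ig.
rewrite /Rintegral; congr fine; transitivity (\int[mu]_x \int[mu]_y (g (x, y))%:E)%E.
  apply: ae_eq_integral => //.
  - by apply/measurable_EFinP; exact: measurable_Rintegral_section.
  - exact: (measurable_int _ fin1).
  - by apply: filterS (integrable_ae measurableT fin1) => x /= h _; rewrite fineK//; exact: h.
transitivity (\int[mu]_y \int[mu]_x (g (x, y))%:E)%E; first exact: H.
apply/esym/ae_eq_integral => //.
- apply/measurable_EFinP.
  exact: (measurable_Rintegral_section mg').
- exact: (measurable_int _ fin2).
- by apply: filterS (integrable_ae measurableT fin2) => x /= h _; rewrite fineK//; exact: h.
Qed.

Lemma cintegral_swap (F : X * X -> R[i]) : cmeasurable setT F ->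
  (\int[mu]_x \int[mu]_y (cnorm (F (x, y)))%:E < +oo)%E ->
  cintegral mu setT (fun x => cintegral mu setT (fun y => F (x, y))) =
  cintegral mu setT (fun y => cintegral mu setT (fun x => F (x, y))).
Proof.
move=> mF Fy; have mN := measurable_cnorm mF.
have dom (g : X * X -> R) : measurable_fun setT g -> (forall z, `|g z| <= cnorm (F z)) ->
    (\int[mu]_x \int[mu]_y `|g (x, y)|%:E < +oo)%E.
  move=> mg gN; apply: le_lt_trans Fy; apply: ge0_le_integral => //.
  - by move=> x _; apply: integral_ge0 => y _; rewrite lee_fin.
  - apply: (integral_kernel_measurable mu (g := fun z => `|g z|)) => //.
    exact: measurableT_comp.
  - by apply: (integral_kernel_measurable mu mN) => z; exact: cnorm_ge0.
  - move=> x _; apply: ge0_le_integral => //.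
    + by apply/measurable_EFinP; apply: measurableT_comp => //; exact: measurableT_comp.
    + by apply/measurable_EFinP; exact: (measurableT_comp mN).
    + by move=> y _; rewrite lee_fin gN.
case: (mF) => mR mI; apply: complex_ext.
- apply: (Rintegral_swap mR (dom _ mR _)) => z; exact: normr_Re.
- apply: (Rintegral_swap mI (dom _ mI _)) => z; exact: normr_Im.
Qed.

End ParametricIntegral.

Section MatrixBounds.
Variable R : realType.
Implicit Types (M : 'M[R[i]]_2) (u w : 'cV[R[i]]_2) (z x y : plane R).

(** The l^1 norm is used besides [vsq] because matrix bounds and integrals of
    single entries add up in it without square roots. *)
Definition l1 u : R := \sum_k cnorm (u k 0).

Lemma l1_ge0 u : 0 <= l1 u.
Proof. by apply: sumr_ge0 => i _; exact: cnorm_ge0. Qed.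

Lemma cnorm_le_l1 u i : cnorm (u i 0) <= l1 u.
Proof. by rewrite /l1 (bigD1 i)//= lerDl sumr_ge0// => k _; exact: cnorm_ge0. Qed.

Lemma cnorm_sum (n : nat) (F : 'I_n -> R[i]) : cnorm (\sum_i F i) <= \sum_i cnorm (F i).
Proof.
elim/big_ind2 : _ => [|a b c e h1 h2|//]; first by rewrite cnorm0.
by apply: le_trans (cnormD _ _) _; exact: lerD.
Qed.

Lemma cnorm_mulmx_le M u (m : R) i : (forall j, cnorm (M i j) <= m) ->
  cnorm ((M *m u) i 0) <= m * l1 u.
Proof.
move=> Mm; rewrite mxE; apply: le_trans (cnorm_sum _) _.
rewrite mulr_sumr; apply: ler_sum => j _; rewrite cnormM.
by apply: ler_wpM2r; [exact: cnorm_ge0|].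
Qed.

Lemma l1_mulmx_le M u (m : R) : (forall i j, cnorm (M i j) <= m) ->
  l1 (M *m u) <= 2 * m * l1 u.
Proof.
move=> Mm; rewrite {1}/l1 big_ord_recl big_ord1.
have h i := cnorm_mulmx_le u (Mm i).
by apply: le_trans (lerD (h _) (h _)) _; rewrite -mulrA mulr_natl mulr2n.
Qed.

Lemma sqr_l1_le u : l1 u ^+ 2 <= 2 * vsq u.
Proof.
rewrite /l1 /vsq !big_ord_recl !big_ord0 !addr0.
by have := sqr_ge0 (cnorm (u ord0 0) - cnorm (u (lift ord0 ord0) 0)); nra.
Qed.

Lemma vsq_le_l1 u : vsq u <= l1 u ^+ 2.
Proof.
rewrite /l1 /vsq !big_ord_recl !big_ord0 !addr0.
have := mulr_ge0 (cnorm_ge0 (u ord0 0)) (cnorm_ge0 (u (lift ord0 ord0) 0)).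
by nra.
Qed.

Lemma dot_mulmxl M u w : dot (M *m u) w = dot u ((M^t*)%sesqui *m w).
Proof.
rewrite /dot; under eq_bigr do rewrite mxE mulr_suml.
rewrite exchange_big/=; apply: eq_bigr => j _.
rewrite mxE rmorph_sum/= mulr_sumr; apply: eq_bigr => i _.
by rewrite !mxE rmorphM/= conjCK mulrCA mulrA.
Qed.

Lemma cnorm_dot_l1 u w : cnorm (dot u w) <= l1 u * l1 w.
Proof.
rewrite /dot; apply: le_trans (cnorm_sum _) _; rewrite {1}/l1 mulr_suml.
apply: ler_sum => i _; rewrite cnormM cnormJ; apply: ler_wpM2l.
  exact: cnorm_ge0.
exact: cnorm_le_l1.
Qed.

Lemma plane_ext z x : z.1 = x.1 -> z.2 = x.2 -> z = x.
Proof. by case: z x => [a b] [c e] /= -> ->. Qed.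

Definition scale_plane (c : R) z : plane R := (c * z.1, c * z.2).

Lemma alpha_dotE z i j : alpha_dot z i j =
  if i == j then 0 else z.1 +i* (if i == 0 then - z.2 else z.2).
Proof.
rewrite !mxE; case: ifP => _; first by rewrite !mulr0 addr0.
by case: ifP => _; apply: complex_ext; rewrite !cReImE/=; ring.
Qed.

Lemma alpha_dot_scale_plane (c : R) z : alpha_dot (scale_plane c z) = c%:C *: alpha_dot z.
Proof.
apply/matrixP => i j; rewrite [RHS]mxE !alpha_dotE; case: ifP => _; first by rewrite mulr0.
by case: ifP => _; apply: complex_ext; rewrite !cReImE/=; ring.
Qed.

Lemma alpha_dotB z x : alpha_dot (z - x) = alpha_dot z - alpha_dot x.
Proof.
apply/matrixP => i j.
have -> : (alpha_dot z - alpha_dot x) i j = alpha_dot z i j - alpha_dot x i j.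
  by rewrite mxE [X in _ + X]mxE.
rewrite !alpha_dotE.
case: ifP => _; first by rewrite subr0.
by case: ifP => _; apply: complex_ext; rewrite !cReImE/=; ring.
Qed.

Lemma alpha_dotN z : alpha_dot (- z) = - alpha_dot z.
Proof.
by rewrite -[- z]add0r alpha_dotB; apply/matrixP => i j; rewrite !mxE/= !rmorph0 !mul0r !add0r.
Qed.

Lemma alpha_dot_adj z : (alpha_dot z)^t* = alpha_dot z.
Proof.
apply/matrixP => i j; rewrite mxE mxE !alpha_dotE eq_sym; case: ifP => [_|]; first by rewrite rmorph0.
by case: i j => [[|[|//]] ?] [[|[|//]] ?] //= _; apply: complex_ext; rewrite !cReImE/=; ring.
Qed.

Lemma absp_scale_plane (c : R) z : absp (scale_plane c z) = `|c| * absp z.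
Proof.
rewrite /absp /sqnorm /= !exprMn -mulrDr sqrtrM ?sqr_ge0//.
by rewrite sqrtr_sqr.
Qed.

Lemma cnorm_alpha_dot_le z i j : cnorm (alpha_dot z i j) <= absp z.
Proof.
rewrite alpha_dotE; case: ifP => _; first by rewrite cnorm0 absp_ge0.
by rewrite /cnorm /absp /sqnorm /=; case: ifP => _; rewrite ?sqrrN.
Qed.

(** The convolution kernel of [G00]. *)
Definition dirac_kernel z : 'M[R[i]]_2 := ('i%C / (2 * pi * sqnorm z)%:C) *: alpha_dot z.

(** The asymptotic form of [dirac_kernel] at infinity, made bounded at 0 by putting
    <x>^2 in place of |x|^2. *)
Definition tail_kernel x : 'M[R[i]]_2 :=
  ('i%C / (2 * pi * (1 + sqnorm x))%:C) *: alpha_dot x.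

Lemma i_alpha_scale_plane (c : R) z : ('i%C / c%:C) *: alpha_dot z = 'i%C *: alpha_dot (scale_plane c^-1 z).
Proof. by rewrite alpha_dot_scale_plane scalerA -fmorphV. Qed.

Lemma dirac_kernelE z : dirac_kernel z = 'i%C *: alpha_dot (scale_plane (2 * pi * sqnorm z)^-1 z).
Proof. exact: i_alpha_scale_plane. Qed.

Lemma cnorm_i_alpha_dot_le z i j : cnorm (('i%C *: alpha_dot z) i j) <= absp z.
Proof. by rewrite mxE cnormM cnorm_i mul1r; exact: cnorm_alpha_dot_le. Qed.

Lemma two_pi_ge1 : 1 <= 2 * pi :> R.
Proof. by have := @pi_ge2 R; lra. Qed.

Lemma invr_two_piM_le (a : R) : 0 <= a -> (2 * pi * a)^-1 <= a^-1.
Proof.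
move=> a0; have p0 : 0 < 2 * pi :> R by exact: lt_le_trans two_pi_ge1.
rewrite invfM -[leRHS]mul1r; apply: ler_wpM2r; first by rewrite invr_ge0.
by rewrite invf_le1// two_pi_ge1.
Qed.

Lemma powRN1 (a : R) : 0 <= a -> a `^ (- 1) = a^-1.
Proof.
by move=> a0; rewrite -powR_inv1.
Qed.

Lemma cnorm_dirac_kernel_le z i j : cnorm (dirac_kernel z i j) <= absp z `^ (- 1).
Proof.
rewrite dirac_kernelE; apply: le_trans (cnorm_i_alpha_dot_le _ _ _) _.
have s0 := sqnorm_ge0 z.
rewrite absp_scale_plane ger0_norm ?invr_ge0 ?mulr_ge0 ?pi_ge0// powRN1 ?absp_ge0//.
apply: (@le_trans _ _ ((sqnorm z)^-1 * absp z)).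
  by apply: ler_wpM2r; [exact: absp_ge0 | exact: invr_two_piM_le].
rewrite -sqr_absp; have [->|a0] := eqVneq (absp z) 0; first by rewrite mulr0 invr0.
by rewrite expr2 invfM -mulrA mulVf// mulr1.
Qed.

Lemma dirac_kernel_adj z : (dirac_kernel z)^t* = dirac_kernel (- z).
Proof.
rewrite !dirac_kernelE; have -> : sqnorm (- z) = sqnorm z by rewrite /sqnorm /= !sqrrN.
have -> : scale_plane (2 * pi * sqnorm z)^-1 (- z) = - scale_plane (2 * pi * sqnorm z)^-1 z.
  by rewrite /scale_plane/= !mulrN.
rewrite alpha_dotN -{2}alpha_dot_adj.
by apply/matrixP => i j; rewrite !mxE; apply: complex_ext; rewrite !cReImE/=; ring.
Qed.

(** The left-hand side equals |u|^2 (1 + 2 x.y + |x|^2 |y|^2), and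
    2 x.y <= |x|^2 + |y|^2. *)
Lemma sqnorm_kernel_difference x y (u := x - y) :
  sqnorm (scale_plane (1 + sqnorm x) u - scale_plane (sqnorm u) x) <=
  sqnorm u * ((1 + sqnorm x) * (1 + sqnorm y)).
Proof.
rewrite /u /sqnorm /=; case: x y u => [a b] [c e] _ /=.
have -> : ((1 + (a ^+ 2 + b ^+ 2)) * (a - c) - ((a - c) ^+ 2 + (b - e) ^+ 2) * a) ^+ 2 +
 ((1 + (a ^+ 2 + b ^+ 2)) * (b - e) - ((a - c) ^+ 2 + (b - e) ^+ 2) * b) ^+ 2 =
 ((a - c) ^+ 2 + (b - e) ^+ 2) * (1 + 2 * (a * c + b * e) + (a ^+ 2 + b ^+ 2) * (c ^+ 2 + e ^+ 2)).
  by ring.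
apply: ler_wpM2l; first by rewrite addr_ge0 ?sqr_ge0.
have := sqr_ge0 (a - c); have := sqr_ge0 (b - e); nra.
Qed.

(** Over the common denominator |u|^2 <x>^2 the difference of the kernels is
    alpha applied to the vector estimated in [sqnorm_kernel_difference]. *)
Lemma cnorm_kernel_difference_le x y i j : (x - y).1 != 0 ->
  cnorm ((dirac_kernel (x - y) - tail_kernel x) i j) <=
  japanese x `^ (- 1) * absp (x - y) `^ (- 1) * japanese y.
Proof.
move=> u1; set u := x - y.
have su : 0 < sqnorm u.
  by rewrite /sqnorm ltr_pwDl// ?sqr_ge0// lt_neqAle sqr_ge0 eq_sym sqrf_eq0 u1.
have sx : 0 < 1 + sqnorm x by rewrite ltr_pwDl// sqnorm_ge0.
have p0 : 0 < 2 * pi :> R by exact: lt_le_trans two_pi_ge1.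
set N := 2 * pi * (sqnorm u * (1 + sqnorm x)).
have -> : dirac_kernel u - tail_kernel x =
    'i%C *: alpha_dot (scale_plane N^-1 (scale_plane (1 + sqnorm x) u - scale_plane (sqnorm u) x)).
  rewrite dirac_kernelE /tail_kernel i_alpha_scale_plane -scalerBr -alpha_dotB; congr (_ *: alpha_dot _).
  have [su0 sx0] : sqnorm u != 0 /\ 1 + sqnorm x != 0 by rewrite !gt_eqF.
  have pi0 : pi != 0 :> R by rewrite gt_eqF// pi_gt0.
  move: su0 sx0 pi0; rewrite /scale_plane /N /=.
  move: (sqnorm u) (1 + sqnorm x) (pi : R) => su' sx' p su0 sx0 pi0.
  have N1 : (2 * p * (su' * sx'))^-1 * sx' = (2 * p * su')^-1 by field; rewrite su0 sx0 pi0.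
  have N2 : (2 * p * (su' * sx'))^-1 * su' = (2 * p * sx')^-1 by field; rewrite su0 sx0 pi0.
  apply: plane_ext => /=; rewrite -N1 -N2; move: (_^-1) => r; ring.
apply: le_trans (cnorm_i_alpha_dot_le _ _ _) _.
have N0 : 0 <= sqnorm u * (1 + sqnorm x) by rewrite mulr_ge0// ltW.
rewrite absp_scale_plane ger0_norm; last first.
  by rewrite invr_ge0 /N mulr_ge0// ltW.
have J0 (t : plane R) : 0 <= japanese t by exact/ltW/japanese_gt0.
rewrite !powRN1 ?absp_ge0//.
apply: (@le_trans _ _ ((sqnorm u * (1 + sqnorm x))^-1 * (absp u * (japanese x * japanese y)))).
  apply: ler_pM; rewrite ?invr_ge0 ?absp_ge0//.
  - by rewrite /N mulr_ge0// ltW.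
  - exact: invr_two_piM_le.
  - rewrite -[leRHS]ger0_norm ?mulr_ge0 ?absp_ge0// -sqrtr_sqr; apply: ler_wsqrtr.
    by rewrite !exprMn sqr_absp !sqr_japanese; exact: sqnorm_kernel_difference.
rewrite -sqr_absp -sqr_japanese le_eqVlt; apply/orP; left; apply/eqP.
have a0 : absp u != 0 by rewrite -sqrf_eq0 sqr_absp gt_eqF.
have j0 : japanese x != 0 by rewrite gt_eqF// japanese_gt0.
by field; rewrite a0 j0.
Qed.

End MatrixBounds.

(** * The operators v G00 v* and v G11 v* *)

Section BirmanSchwinger.
Variable R : realType.
Local Notation mu2 := (mu2 R).
Implicit Types (f g h : vfield R) (x y : plane R).

Lemma measurable_pwmul (M : mfield R) f : measurable_mx M -> measurable_vf f ->
  measurable_vf (pwmul M f).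
Proof.
move=> mM mf i; rewrite /pwmul; under eq_fun do rewrite mxE.
by apply: cmeasurable_sum => j; apply: cmeasurableM; [exact: mM | exact: mf].
Qed.

Lemma measurable_pwadj (M : mfield R) : measurable_mx M -> measurable_mx (pwadj M).
Proof.
move=> mM i j; suff : cmeasurable setT (fun x => pwadj M x i j) by [].
rewrite /pwadj; under eq_fun do rewrite mxE mxE.
by apply: cmeasurableJ; exact: mM.
Qed.

Lemma measurable_l1 f : measurable_vf f -> measurable_fun setT (fun x => l1 (f x)).
Proof.
move=> mf; apply: measurable_sum => i.
by apply: measurable_cnorm; exact: mf.
Qed.

Lemma L2_of_l1 f (h : plane R -> R) : measurable_vf f -> measurable_fun setT h ->
  {ae mu2, forall x, l1 (f x) <= h x} -> (\int[mu2]_x (h x ^+ 2)%:E < +oo)%E -> L2 f.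
Proof.
move=> mf mh fh h2; apply: (L2_le mf (h := fun x => h x ^+ 2)) => //.
- exact: measurable_funX.
- by move=> x; exact: sqr_ge0.
- apply: filterS fh => x hx; apply: le_trans (vsq_le_l1 _) _.
  by rewrite lerXn2r// nnegrE ?l1_ge0// (le_trans (l1_ge0 _) hx).
Qed.

Lemma L2_l1 f : L2 f -> (\int[mu2]_x (l1 (f x) ^+ 2)%:E < +oo)%E.
Proof.
move=> /L2P[mf f2]; apply: (@le_lt_trans _ _ (\int[mu2]_x (2%:E * (vsq (f x))%:E))%E).
  apply: ge0_le_integral => //.
  - by move=> x _; rewrite lee_fin sqr_ge0.
  - by apply/measurable_EFinP/measurable_funX; exact: measurable_l1.
  - by apply: measurable_funeM; exact: measurable_vsq_EFin.
  - by move=> x _; rewrite -EFinM lee_fin sqr_l1_le.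
rewrite ge0_integralZl; [|by []|exact: measurable_vsq_EFin
  |by move=> x _; rewrite lee_fin vsq_ge0|by rewrite lee_fin].
by rewrite lte_mul_pinfty// lee_fin.
Qed.

Lemma integral_sqrZ (c : R) (h : plane R -> R) : measurable_fun setT h ->
  (\int[mu2]_x (h x ^+ 2)%:E < +oo)%E -> (\int[mu2]_x ((c * h x) ^+ 2)%:E < +oo)%E.
Proof.
move=> mh h2; under eq_integral do rewrite exprMn EFinM.
rewrite ge0_integralZl; [|by []|by apply/measurable_EFinP; exact: measurable_funX
  |by move=> x _; rewrite lee_fin sqr_ge0|by rewrite lee_fin sqr_ge0].
by rewrite lte_mul_pinfty// lee_fin sqr_ge0.
Qed.

Lemma cmeasurable_i_alpha (r : plane R -> R) i j : measurable_fun setT r ->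
  (forall x, 0 <= r x) ->
  cmeasurable setT (fun x => (('i%C / (r x)%:C) *: alpha_dot x) i j).
Proof.
move=> mr r0; under eq_fun => x.
  rewrite mxE alpha_dotE -fmorphV -powRN1//; over.
apply: cmeasurableM.
  apply: cmeasurableM; first exact: cmeasurable_cst.
  apply: cmeasurable_real.
  by apply/(@measurableT_comp _ _ _ _ _ _ (fun x : R => x `^ (- 1))%R).
case: (i == j); first exact: cmeasurable_cst.
split => /=; first exact: measurable_fst.
case: (i == 0); last exact: measurable_snd.
by apply: measurableT_comp => //; exact: measurable_snd.
Qed.

Lemma measurable_sqnorm : measurable_fun setT (@sqnorm R).
Proof. by apply: measurable_funD; apply: measurable_funX. Qed.

Lemma measurable_dirac_kernel : measurable_mx (@dirac_kernel R).
Proof.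
move=> i j; apply: cmeasurable_i_alpha => [|x].
  by apply: measurable_funM; [exact: measurable_cst|exact: measurable_sqnorm].
by rewrite !mulr_ge0 ?pi_ge0// sqnorm_ge0.
Qed.

Lemma measurable_tail_kernel : measurable_mx (@tail_kernel R).
Proof.
move=> i j; apply: (cmeasurable_i_alpha (r := fun x => 2 * pi * (1 + sqnorm x))) => [|x].
  apply: measurable_funM; first exact: measurable_cst.
  by apply: measurable_funD; [exact: measurable_cst|exact: measurable_sqnorm].
by rewrite !mulr_ge0 ?pi_ge0// addr_ge0// sqnorm_ge0.
Qed.

Lemma measurable_diff : measurable_fun setT (fun z : plane R * plane R => z.1 - z.2).
Proof.
apply/prod_measurable_funP; split.
- apply: (measurable_funB (f := fun z : plane R * plane R => z.1.1)
    (g := fun z : plane R * plane R => z.2.1)).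
    exact: (measurableT_comp measurable_fst measurable_fst).
  exact: (measurableT_comp measurable_fst measurable_snd).
- apply: (measurable_funB (f := fun z : plane R * plane R => z.1.2)
    (g := fun z : plane R * plane R => z.2.2)).
    exact: (measurableT_comp measurable_snd measurable_fst).
  exact: (measurableT_comp measurable_snd measurable_snd).
Qed.

Lemma cmeasurable_comp d d' (X : measurableType d) (Y : measurableType d')
    (F : Y -> R[i]) (u : X -> Y) : cmeasurable setT F -> measurable_fun setT u ->
  cmeasurable setT (fun t => F (u t)).
Proof. by move=> [a b] mu; split; [exact: (measurableT_comp a)|exact: (measurableT_comp b)]. Qed.

Lemma cmeasurable_dirac_mulmx h i : measurable_vf h ->
  cmeasurable setT (fun z : plane R * plane R => (dirac_kernel (z.1 - z.2) *m h z.2) i 0).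
Proof.
move=> mh; under eq_fun do rewrite mxE.
apply: cmeasurable_sum => j; apply: cmeasurableM.
  apply: (cmeasurable_comp (F := fun z => dirac_kernel z i j)); last exact: measurable_diff.
  exact: measurable_dirac_kernel.
by apply: (cmeasurable_comp (F := fun z => h z j 0)); [exact: mh|exact: measurable_snd].
Qed.

Lemma cmeasurable_dirac_section h i x : measurable_vf h ->
  cmeasurable setT (fun y => (dirac_kernel (x - y) *m h y) i 0).
Proof.
move=> mh; exact: (cmeasurable_comp (cmeasurable_dirac_mulmx i mh) (measurable_pair1 x)).
Qed.

Lemma G00E h x i : G00 h x i 0 =
  cintegral mu2 setT (fun y => (dirac_kernel (x - y) *m h y) i 0).
Proof. by rewrite mxE. Qed.

Lemma measurable_G00 h : measurable_vf h -> measurable_vf (G00 h).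
Proof.
move=> mh i; under eq_fun do rewrite G00E.
exact: (cmeasurable_cintegral (smu2 R) (cmeasurable_dirac_mulmx i mh)).
Qed.

Definition mean h : 'cV[R[i]]_2 := \col_i cintegral mu2 setT (fun y => h y i 0).

Lemma G11E h x : G11 h x = mean h.
Proof.
by apply/matrixP => i j; rewrite !mxE; congr cintegral; apply/funext => y; rewrite mul1mx.
Qed.

Lemma japanese_powR_ge x (p q : R) : p <= q -> japanese x `^ (- q) <= japanese x `^ (- p).
Proof. by move=> pq; apply: ler_powR; rewrite ?japanese_ge1// lerN2. Qed.

Lemma japaneseM_powR x (p : R) : japanese x * japanese x `^ (- (1 + p)) = japanese x `^ (- p).
Proof.
have j0 := japanese_gt0 x; rewrite -{1}[japanese x]powRr1 ?(ltW j0)// -powRD; last first.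
  by rewrite [japanese x == 0]gt_eqF ?implybT.
by congr (_ `^ _); ring.
Qed.

Variables (v : mfield R) (dl C : R).
Hypothesis dl0 : 0 < dl < 2^-1.
Hypothesis C0 : 0 <= C.
Hypothesis mv : measurable_mx v.
Hypothesis vb : forall x i j, cnorm (v x i j) <= C * japanese x `^ (- (1 + dl)).
Local Notation vs f := (pwmul (pwadj v) f).

Let measurable_vs f : L2 f -> measurable_vf (vs f).
Proof. by move=> /L2_measurable mf; apply: measurable_pwmul => //; exact: measurable_pwadj. Qed.

Let dl_gt0 : 0 < dl. Proof. by case/andP: dl0. Qed.

Lemma l1_pwadj_le f x : l1 (vs f x) <= 2 * C * japanese x `^ (- (1 + dl)) * l1 (f x).
Proof.
rewrite -[2 * C * _]mulrA; apply: l1_mulmx_le => i j.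
by rewrite mxE mxE cnormJ.
Qed.

Lemma l1_pwmul_le f x : l1 (pwmul v f x) <= 2 * C * japanese x `^ (- (1 + dl)) * l1 (f x).
Proof. by rewrite -[2 * C * _]mulrA; exact: l1_mulmx_le. Qed.

(** Every integrand below is dominated by a multiple of [k], whose integral over y is
    a square integrable function of x by [k_bound]. *)
Let k f x y : R :=
  japanese x `^ (- 1) * absp (x - y) `^ (- 1) * japanese y `^ (- dl) * l1 (f y).

Let k_ge0 f x y : 0 <= k f x y.
Proof. by rewrite /k !mulr_ge0 ?powR_ge0 ?l1_ge0. Qed.

Let measurable_k f : L2 f -> measurable_fun setT (fun z : plane R * plane R => k f z.1 z.2).
Proof.
move=> /L2_measurable mf; apply: measurable_funM; [apply: measurable_funM; [apply: measurable_funM|]|].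
- exact: (measurableT_comp (measurable_japanese_powR _) measurable_fst).
- apply/(@measurableT_comp _ _ _ _ _ _ (fun x : R => x `^ (- 1))%R) => //.
  exact: (measurableT_comp (@measurable_absp R) measurable_diff).
- exact: (measurableT_comp (measurable_japanese_powR _) measurable_snd).
- exact: (measurableT_comp (measurable_l1 mf) measurable_snd).
Qed.

Let measurable_k_section f x : L2 f -> measurable_fun setT (k f x).
Proof. by move=> L2f; exact: (measurableT_comp (measurable_k L2f) (measurable_pair1 x)). Qed.

Let k_bound f : L2 f -> exists h : plane R -> R, [/\ measurable_fun setT h,
  (forall x, 0 <= h x), (\int[mu2]_x (h x ^+ 2)%:E < +oo)%E &
  {ae mu2, forall x, (\int[mu2]_y (k f x y)%:E <= (h x)%:E)%E}].
Proof.
move=> L2f; apply: (integral_absp_kernel dl0).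
- exact: (measurable_l1 (L2_measurable L2f)).
- by move=> x; exact: l1_ge0.
- exact: L2_l1.
Qed.

Let integrable_k f x (r : R) : L2 f -> (\int[mu2]_y (k f x y)%:E <= r%:E)%E ->
  mu2.-integrable setT (EFin \o k f x).
Proof.
move=> L2f kr; apply/integrableP; split.
  by apply/measurable_EFinP; exact: measurable_k_section.
apply: le_lt_trans (ltry r); apply: le_trans kr; rewrite le_eqVlt; apply/orP; left.
by apply/eqP; apply: eq_integral => y _ /=; rewrite ger0_norm.
Qed.

Let cnorm_G_integrand f x y i :
  cnorm ((dirac_kernel (x - y) *m vs f y) i 0) <= 2 * C * japanese x * k f x y.
Proof.
apply: le_trans (cnorm_mulmx_le _ (fun j => cnorm_dirac_kernel_le _ i j)) _.
apply: (@le_trans _ _ (absp (x - y) `^ (- 1) * (2 * C * japanese y `^ (- dl) * l1 (f y)))).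
  apply: ler_wpM2l; first exact: powR_ge0.
  apply: le_trans (l1_pwadj_le _ _) _; apply: ler_wpM2r; first exact: l1_ge0.
  apply: ler_wpM2l; first by rewrite mulr_ge0.
  by apply: japanese_powR_ge; rewrite lerDr.
rewrite le_eqVlt; apply/orP; left; apply/eqP; rewrite /k (powRN1 (ltW (japanese_gt0 x))).
have j0 : japanese x != 0 by rewrite gt_eqF// japanese_gt0.
move: (absp _ `^ _) (japanese y `^ _) => a b; by field.
Qed.

Let cnorm_diff_integrand f x y i : (x - y).1 != 0 ->
  cnorm (((dirac_kernel (x - y) - tail_kernel x) *m vs f y) i 0) <= 2 * C * k f x y.
Proof.
move=> u0.
apply: le_trans (cnorm_mulmx_le _ (fun j => cnorm_kernel_difference_le i j u0)) _.
have P0 : 0 <= japanese x `^ (- 1) * absp (x - y) `^ (- 1) by rewrite mulr_ge0 ?powR_ge0.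
apply: (@le_trans _ _ (japanese x `^ (- 1) * absp (x - y) `^ (- 1) * japanese y *
    (2 * C * japanese y `^ (- (1 + dl)) * l1 (f y)))).
  apply: ler_wpM2l; last exact: l1_pwadj_le.
  by rewrite mulr_ge0// ltW// japanese_gt0.
rewrite le_eqVlt; apply/orP; left; apply/eqP; rewrite /k -[in RHS](japaneseM_powR y dl).
by ring.
Qed.

Let cintegrable_G f x (r : R) i : L2 f -> (\int[mu2]_y (k f x y)%:E <= r%:E)%E ->
  cintegrable mu2 setT (fun y => (dirac_kernel (x - y) *m vs f y) i 0).
Proof.
move=> L2f kr; apply: (le_cintegrable measurableT (h := fun y => 2 * C * japanese x * k f x y)).
- exact: cmeasurable_dirac_section (measurable_vs L2f).
- exact: (integrableZl_EFin measurableT _ (integrable_k L2f kr)).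
- by move=> y _; exact: cnorm_G_integrand.
Qed.

Let cnorm_cintegral_k f x (r c : R) (F : plane R -> R[i]) : L2 f -> 0 <= c ->
  (\int[mu2]_y (k f x y)%:E <= r%:E)%E -> cmeasurable setT F ->
  {ae mu2, forall y, cnorm (F y) <= c * k f x y} ->
  cnorm (cintegral mu2 setT F) <= 2 * c * r.
Proof.
move=> L2f c0 kr mF Fk; have mk := measurable_k_section x L2f.
have H : ((cnorm (cintegral mu2 setT F))%:E <= 2 * \int[mu2]_y `|c * k f x y|%:E)%E.
  apply: (cnorm_cintegral_le measurableT mF (h := fun y => c * k f x y)).
    by apply: measurable_funM => //; exact: measurable_cst.
  by apply: filterS Fk => y hy _.
rewrite -lee_fin; apply: le_trans H _.
under eq_integral => y _ do rewrite (ger0_norm (mulr_ge0 c0 (k_ge0 f x y))) EFinM.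
rewrite ge0_integralZl; [|by []|by apply/measurable_EFinP
  |by move=> y _; rewrite lee_fin|by rewrite lee_fin].
rewrite -mulrA 2!EFinM; apply: lee_wpmul2l; first by rewrite lee_fin.
by apply: lee_wpmul2l; rewrite ?lee_fin.
Qed.

(** The factor <x> in the bound [cnorm_G_integrand] is cancelled by the decay of
    v(x). *)
Lemma L2_BirmanSchwinger f : L2 f -> L2 (pwmul v (G00 (vs f))).
Proof.
move=> L2f; have [h [mh h0 h2 hk]] := k_bound L2f.
have mG := measurable_G00 (measurable_vs L2f).
apply: (L2_of_l1 (h := fun x => 16 * C ^+ 2 * h x)).
- exact: measurable_pwmul.
- by apply: measurable_funM => //; exact: measurable_cst.
- apply: filterS hk => x hx; apply: le_trans (l1_pwmul_le _ _) _.
  have j0 := japanese_gt0 x.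
  have G i : cnorm (G00 (vs f) x i 0) <= 2 * (2 * C * japanese x) * h x.
    rewrite G00E; apply: (cnorm_cintegral_k L2f _ hx).
    + by rewrite !mulr_ge0// ltW.
    + exact: cmeasurable_dirac_section (measurable_vs L2f).
    + by apply: aeW => y; exact: cnorm_G_integrand.
  have l1G : l1 (G00 (vs f) x) <= 8 * C * japanese x * h x.
    rewrite /l1 big_ord_recl big_ord1; apply: le_trans (lerD (G _) (G _)) _.
    by rewrite le_eqVlt; apply/orP; left; apply/eqP; ring.
  apply: (@le_trans _ _ (2 * C * japanese x `^ (- 1) * (8 * C * japanese x * h x))).
    apply: ler_pM => //; first by rewrite !mulr_ge0 ?powR_ge0.
      exact: l1_ge0.
    apply: ler_wpM2l; first by rewrite mulr_ge0.
    by apply: japanese_powR_ge; rewrite lerDl ltW.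
  rewrite le_eqVlt; apply/orP; left; apply/eqP; rewrite (powRN1 (ltW j0)).
  have j1 : japanese x != 0 by rewrite gt_eqF.
  by field.
- exact: integral_sqrZ.
Qed.

(** Both |v| and f are square integrable, as 2 (1 + dl) > 2. *)
Lemma cintegrable_pwadj f i : L2 f -> cintegrable mu2 setT (fun y => vs f y i 0).
Proof.
move=> L2f; have mf := L2_measurable L2f.
have i1 : mu2.-integrable setT (fun y => (japanese y `^ (- (2 + 2 * dl)))%:E).
  apply/integrableP; split.
    by apply/measurable_EFinP; exact: measurable_japanese_powR.
  under eq_integral do rewrite gee0_abs ?lee_fin ?powR_ge0//.
  by apply: integral_japanese; rewrite ltrDl mulr_gt0.
have i2 : mu2.-integrable setT (fun y => (l1 (f y) ^+ 2)%:E).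
  apply/integrableP; split.
    by apply/measurable_EFinP/measurable_funX; exact: measurable_l1.
  under eq_integral do rewrite gee0_abs ?lee_fin ?sqr_ge0//.
  exact: L2_l1.
apply: (le_cintegrable measurableT
  (h := fun y => C * (japanese y `^ (- (2 + 2 * dl)) + l1 (f y) ^+ 2))).
- exact: measurable_vs.
- apply: (integrableZl_EFin measurableT).
  have := integrableD measurableT i1 i2; apply: eq_integrable => // y _.
- move=> y _; apply: le_trans (cnorm_le_l1 _ i) _; apply: le_trans (l1_pwadj_le _ _) _.
  have -> : - (2 + 2 * dl) = - (1 + dl) + - (1 + dl) by ring.
  rewrite powRD; last by rewrite [japanese y == 0]gt_eqF ?implybT// japanese_gt0.
  have := powR_ge0 (japanese y) (- (1 + dl)); have := l1_ge0 (f y).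
  move: (_ `^ _) (l1 _) => a b b0 a0.
  rewrite -[2 * C]mulrC -!mulrA; apply: ler_wpM2l => //.
  by have := sqr_ge0 (a - b); nra.
Qed.

Lemma L2_pwmul_cst (c : 'cV[R[i]]_2) : L2 (pwmul v (fun=> c)).
Proof.
apply: (L2_of_l1 (h := fun x => 2 * C * l1 c * japanese x `^ (- (1 + dl)))).
- by apply: measurable_pwmul => // i; exact: cmeasurable_cst.
- by apply: measurable_funM; [exact: measurable_cst|exact: measurable_japanese_powR].
- apply: aeW => x; apply: le_trans (l1_pwmul_le _ _) _.
  by rewrite le_eqVlt; apply/orP; left; apply/eqP; ring.
- apply: integral_sqrZ; first exact: measurable_japanese_powR.
  have -> : (fun x => (japanese x `^ (- (1 + dl)) ^+ 2)%:E) =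
      (fun x => (japanese x `^ (- (2 + 2 * dl)))%:E).
    apply/funext => x; rewrite expr2 -powRD; last first.
      by rewrite [japanese x == 0]gt_eqF ?implybT// japanese_gt0.
    by congr (_ `^ _)%:E; ring.
  by apply: integral_japanese; rewrite ltrDl mulr_gt0.
Qed.

(** v* is moved to the other side of the product, where it meets g. *)
Lemma inner_mean f g : L2 f -> L2 g ->
  inner (pwmul v (G11 (vs f))) g = dot (mean (vs f)) (mean (vs g)).
Proof.
move=> L2f L2g; have ig i := cintegrable_pwadj i L2g.
transitivity (cintegral mu2 setT (fun x => \sum_i mean (vs f) i 0 * ((vs g x i 0)^*)%R)).
  congr cintegral; apply/funext => x.
  by rewrite -[LHS]/(dot _ _) /pwmul G11E dot_mulmxl.
rewrite cintegral_sum//; last first.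
  by move=> i; apply: cintegrableZ => //; exact: cintegrableJ.
apply: eq_bigr => i _; rewrite cintegralZ//; last exact: cintegrableJ.
by rewrite cintegral_conj [mean (vs g) i 0]mxE.
Qed.

(** The difference is the integral of (K(x - y) - tail_kernel x) v*f(y), and its
    integrand is bounded by [k] without the factor <x> that a bound of
    K(x - y) v*f(y) requires. *)
Lemma L2_G00_tail f : L2 f ->
  L2 (fun x => G00 (vs f) x - tail_kernel x *m mean (vs f)).
Proof.
move=> L2f; have [h [mh h0 h2 hk]] := k_bound L2f.
have mG := measurable_G00 (measurable_vs L2f).
have mT : measurable_vf (fun x => tail_kernel x *m mean (vs f)).
  by apply: (measurable_pwmul measurable_tail_kernel) => i; exact: cmeasurable_cst.
apply: (L2_of_l1 (h := fun x => 8 * C * h x)).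
- have := measurable_vfD (-1) mG mT; congr measurable_vf; apply/funext => x.
  by rewrite scaleN1r.
- by apply: measurable_funM => //; exact: measurable_cst.
- apply: filterS hk => x hx.
  have iG i := cintegrable_G i L2f hx.
  have iT i j := cintegrableZ measurableT (tail_kernel x i j) (cintegrable_pwadj j L2f).
  have iS i : cintegrable mu2 setT (fun y => (tail_kernel x *m vs f y) i 0).
    have := cintegrable_sum measurableT (iT i); congr cintegrable; apply/funext => y.
    by rewrite [RHS]mxE.
  have E i : (G00 (vs f) x - tail_kernel x *m mean (vs f)) i 0 =
      cintegral mu2 setT (fun y => ((dirac_kernel (x - y) - tail_kernel x) *m vs f y) i 0).
    have -> : (fun y => ((dirac_kernel (x - y) - tail_kernel x) *m vs f y) i 0) =
        (fun y => (dirac_kernel (x - y) *m vs f y) i 0 + (-1) * (tail_kernel x *m vs f y) i 0).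
      by apply/funext => y; rewrite mulmxBl mxE [X in _ + X]mxE mulN1r.
    rewrite (cintegralD measurableT (iG i) (cintegrableZ measurableT (-1) (iS i))).
    rewrite (cintegralZ measurableT (-1) (iS i)).
    rewrite mulN1r mxE [X in _ + X]mxE G00E; congr (_ - _).
    rewrite mxE; under [in RHS]eq_fun do rewrite mxE.
    rewrite (cintegral_sum measurableT (iT i)); apply: eq_bigr => j _.
    by rewrite (cintegralZ measurableT _ (cintegrable_pwadj j L2f)) [mean _ j 0]mxE.
  have B i : cnorm ((G00 (vs f) x - tail_kernel x *m mean (vs f)) i 0) <= 2 * (2 * C) * h x.
    rewrite E; apply: (cnorm_cintegral_k L2f _ hx).
    + by rewrite mulr_ge0.
    + have := cmeasurableD (cintegrable_measurable (iG i))
        (cmeasurableN (cintegrable_measurable (iS i))).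
      by congr cmeasurable; apply/funext => y; rewrite mulmxBl [RHS]mxE [X in _ = _ + X]mxE.
    + by apply: filterS (ae_coords x) => y [u0 _]; exact: cnorm_diff_integrand.
  rewrite /l1 big_ord_recl big_ord1; apply: le_trans (lerD (B _) (B _)) _.
  by rewrite le_eqVlt; apply/orP; left; apply/eqP; ring.
- exact: integral_sqrZ.
Qed.

Let F f g (z : plane R * plane R) : R[i] := dot (dirac_kernel (z.1 - z.2) *m vs f z.2) (vs g z.1).

Let cmeasurable_F f g : L2 f -> L2 g -> cmeasurable setT (F f g).
Proof.
move=> L2f L2g; apply: cmeasurable_sum => i; apply: cmeasurableM.
  exact: cmeasurable_dirac_mulmx (measurable_vs L2f).
apply: cmeasurableJ; apply: (cmeasurable_comp (F := fun z => vs g z i 0)).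
  exact: measurable_vs.
exact: measurable_fst.
Qed.

Let inner_FE f g : L2 f -> L2 g -> inner (pwmul v (G00 (vs f))) g =
  cintegral mu2 setT (fun x => cintegral mu2 setT (fun y => F f g (x, y))).
Proof.
move=> L2f L2g; have [h [mh h0 h2 hk]] := k_bound L2f.
apply: ae_eq_cintegral => //.
- apply: cmeasurable_dot; last exact: L2_measurable.
  by apply: measurable_pwmul => //; apply: measurable_G00; exact: measurable_vs.
- exact: (cmeasurable_cintegral (smu2 R) (cmeasurable_F L2f L2g)).
- apply: filterS hk => x hx _; rewrite -[LHS]/(dot _ _) dot_mulmxl.
  have iG i := cintegrable_G i L2f hx.
  rewrite /F /dot cintegral_sum//=; last first.
    move=> i; have := cintegrableZ measurableT ((vs g x i 0)^*)%R (iG i).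
    by congr cintegrable; apply/funext => y; rewrite mulrC.
  apply: eq_bigr => i _; rewrite G00E mulrC -cintegralZ//.
  by congr cintegral; apply/funext => y; rewrite mulrC.
Qed.

Let F_integrable f g : L2 f -> L2 g ->
  (\int[mu2]_x \int[mu2]_y (cnorm (F f g (x, y)))%:E < +oo)%E.
Proof.
move=> L2f L2g; have [h [mh h0 h2 hk]] := k_bound L2f.
have mg := measurable_l1 (L2_measurable L2g).
have mF := measurable_cnorm (cmeasurable_F L2f L2g).
have g2 := L2_l1 L2g.
pose c := 8 * C ^+ 2.
have c0 : 0 <= c by rewrite /c mulr_ge0 ?sqr_ge0.
have Fk x y : cnorm (F f g (x, y)) <= c * l1 (g x) * k f x y.
  apply: le_trans (cnorm_dot_l1 _ _) _.
  have j0 := japanese_gt0 x.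
  apply: (@le_trans _ _ ((4 * C * japanese x * k f x y) * (2 * C * japanese x `^ (- 1) * l1 (g x)))).
    apply: ler_pM; rewrite ?l1_ge0//.
      rewrite /l1 big_ord_recl big_ord1.
      apply: le_trans (lerD (cnorm_G_integrand _ _ _ _) (cnorm_G_integrand _ _ _ _)) _.
      by rewrite le_eqVlt; apply/orP; left; apply/eqP; ring.
    apply: le_trans (l1_pwadj_le _ _) _; apply: ler_wpM2r; first exact: l1_ge0.
    apply: ler_wpM2l; first by rewrite mulr_ge0.
    by apply: japanese_powR_ge; rewrite lerDl ltW.
  rewrite le_eqVlt; apply/orP; left; apply/eqP; rewrite (powRN1 (ltW j0)) /c.
  have j1 : japanese x != 0 by rewrite gt_eqF.
  move: (k f x y) => a; by field.
apply: (@le_lt_trans _ _ (\int[mu2]_x (c%:E * ((l1 (g x) ^+ 2)%:E + (h x ^+ 2)%:E)))%E).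
  apply: ae_ge0_le_integral => //.
  - by move=> x _; apply: integral_ge0 => y _; rewrite lee_fin cnorm_ge0.
  - by apply: (integral_kernel_measurable (smu2 R) mF) => z; exact: cnorm_ge0.
  - by move=> x _; rewrite -EFinD -EFinM lee_fin mulr_ge0// addr_ge0// sqr_ge0.
  - apply: measurable_funeM; apply: emeasurable_funD; apply/measurable_EFinP/measurable_funX => //.
  - apply: filterS hk => x hx _.
    apply: (@le_trans _ _ (\int[mu2]_y ((c * l1 (g x))%:E * (k f x y)%:E))%E).
      apply: ge0_le_integral => //.
      + by move=> y _; rewrite lee_fin cnorm_ge0.
      + by apply/measurable_EFinP; exact: (measurableT_comp mF (measurable_pair1 x)).
      + by apply: measurable_funeM; apply/measurable_EFinP; exact: measurable_k_section.
      + by move=> y _; rewrite -EFinM lee_fin Fk.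
    rewrite ge0_integralZl; [|by []|by apply/measurable_EFinP; exact: measurable_k_section
      |by move=> y _; rewrite lee_fin|by rewrite lee_fin mulr_ge0 ?l1_ge0].
    apply: (@le_trans _ _ ((c * l1 (g x))%:E * (h x)%:E)%E).
      by apply: lee_wpmul2l; rewrite ?lee_fin ?mulr_ge0 ?l1_ge0.
    rewrite -EFinM -EFinD -EFinM lee_fin -mulrA; apply: ler_wpM2l => //.
    by have := sqr_ge0 (l1 (g x) - h x); have := mulr_ge0 (l1_ge0 (g x)) (h0 x); nra.
rewrite ge0_integralZl; [|by []|
  |by move=> x _; rewrite -EFinD lee_fin addr_ge0 ?sqr_ge0|by rewrite lee_fin]; last first.
  by apply: emeasurable_funD; apply/measurable_EFinP/measurable_funX.
rewrite ge0_integralD//; [|by move=> x _; rewrite lee_fin sqr_ge0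
  |by apply/measurable_EFinP/measurable_funX|by move=> x _; rewrite lee_fin sqr_ge0
  |by apply/measurable_EFinP/measurable_funX].
by rewrite lte_mul_pinfty ?lee_fin// lte_add_pinfty.
Qed.

Let F_swap f g x y : F f g (x, y) = ((F g f (y, x))^*)%R.
Proof.
by rewrite /F /= dot_mulmxl dirac_kernel_adj opprB dotJ.
Qed.

(** Both sides are double integrals of <K(x - y) v*f(y), v*g(x)>, in the two orders
    of integration. *)
Lemma BirmanSchwinger_symmetric f g : L2 f -> L2 g ->
  inner (pwmul v (G00 (vs f))) g = inner f (pwmul v (G00 (vs g))).
Proof.
move=> L2f L2g.
have swap := cintegral_swap (mu := smu2 R) (cmeasurable_F L2f L2g) (F_integrable L2f L2g).
apply: (etrans (inner_FE L2f L2g)); apply: (etrans swap).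
apply/esym/(etrans (innerJ f _))/(etrans (congr1 (fun z => (z^*)%R) (inner_FE L2g L2f))).
rewrite -cintegral_conj; congr cintegral; apply/funext => y.
rewrite -cintegral_conj; congr cintegral; apply/funext => x.
by rewrite -F_swap.
Qed.

End BirmanSchwinger.

(** * The far field and the decay of v *)

Section TailKernel.
Variable R : realType.
Local Notation mu2 := (mu2 R).
Local Notation leb := (@lebesgue_measure R).
Implicit Types (x : plane R) (c : 'cV[R[i]]_2).

Lemma vsq_alpha_dot x c : vsq (alpha_dot x *m c) = sqnorm x * vsq c.
Proof.
rewrite /vsq !big_ord_recl !big_ord0 !addr0 !mxE !big_ord_recl !big_ord0 !addr0.
rewrite !alpha_dotE/= !mul0r add0r addr0 !cnormM !exprMn ![cnorm (_ +i* _) ^+ 2]sqr_cnorm/=.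
by rewrite /sqnorm; ring.
Qed.

Lemma vsqZ (a : R[i]) c : vsq (a *: c) = cnorm a ^+ 2 * vsq c.
Proof.
by rewrite /vsq mulr_sumr; apply: eq_bigr => i _; rewrite mxE cnormM exprMn.
Qed.

Lemma vsq_tail_kernel x c : vsq (tail_kernel x *m c) =
  (2 * pi) ^- 2 * (sqnorm x / (1 + sqnorm x) ^+ 2) * vsq c.
Proof.
rewrite /tail_kernel -scalemxAl vsqZ vsq_alpha_dot cnormM cnorm_i mul1r -fmorphV cnormC.
rewrite real_normK ?num_real//.
move: (2 * pi) (1 + sqnorm x) => p s; rewrite invfM -[p ^- 2]exprVn -[s ^- 2]exprVn.
move: p^-1 s^-1 => p' s'; ring.
Qed.

(** On these boxes |x| is comparable to m, so that |x|^2 / <x>^4 is at least a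
    constant times m^-2, the inverse of the area. *)
Let box (m : R) : set (plane R) := `[m, 2 * m]%classic `*` `[m, 2 * m]%classic.

Let box_measure (m : R) : 0 < m -> mu2 (box m) = (m ^+ 2)%:E.
Proof.
move=> m0; rewrite [LHS]product_measure1E//.
have lm : leb `[m, 2 * m]%classic = m%:E.
  rewrite lebesgue_measure_itv/= lte_fin ltr_pMl// ltr1n -EFinB.
  by congr (_%:E); ring.
by rewrite [X in (X * _)%E](_ : _ = m%:E)// [X in (_ * X)%E](_ : _ = m%:E).
Qed.

Let box_bound x (m : R) : 1 <= m -> box m x ->
  (32 * m ^+ 2)^-1 <= sqnorm x / (1 + sqnorm x) ^+ 2.
Proof.
move=> m1 [/=]; rewrite !in_itv/= => /andP[a1 a2] /andP[b1 b2].
have s1 : 1 <= sqnorm x by rewrite /sqnorm; nra.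
have s2 : sqnorm x <= 8 * m ^+ 2 by rewrite /sqnorm; nra.
move: s1 s2; move: (sqnorm x) => s s1 s2.
have s0 : 0 < s by exact: lt_le_trans s1.
apply: (@le_trans _ _ (s / (2 * s) ^+ 2)).
  have -> : s / (2 * s) ^+ 2 = (4 * s)^-1 by field; rewrite gt_eqF.
  have m0 : 0 < m by exact: lt_le_trans m1.
  rewrite lef_pV2 ?posrE ?mulr_gt0 ?exprn_gt0//.
  by lra.
apply: ler_wpM2l; first exact: ltW.
have s2' : 0 < 1 + s by rewrite addr_gt0.
have s3 : 0 < 2 * s by rewrite mulr_gt0.
rewrite lef_pV2 ?posrE ?exprn_gt0// lerXn2r ?nnegrE ?(ltW s2') ?(ltW s3)//.
by lra.
Qed.

(** For c <> 0 the integrals of |tail_kernel c|^2 over [box m] are bounded below by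
    a positive constant.  Integrability would make them tend to 0, by dominated
    convergence, since the boxes escape to infinity. *)
Lemma tail_kernel_not_L2 c : L2 (fun x => tail_kernel x *m c) -> c = 0.
Proof.
move=> L2t; apply: vsq_eq0; apply/eqP/negPn/negP => c0.
have {c0} c0 : 0 < vsq c by rewrite lt_neqAle eq_sym c0 vsq_ge0.
pose g x := vsq (tail_kernel x *m c).
have ig : mu2.-integrable setT (EFin \o g) by exact: (integrable_vsq L2t).
have g0 x : 0 <= g x by exact: vsq_ge0.
have p0 : 0 < 2 * pi :> R by exact: lt_le_trans (two_pi_ge1 R).
pose ka : R := (2 * pi) ^- 2 * vsq c.
have ka0 : 0 < ka by rewrite mulr_gt0// invr_gt0 exprn_gt0.
have mbox (m : R) : measurable (box m) by exact: measurableX.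
pose f n x : \bar R := (g x * \1_(box n.+1%:R) x)%:E.
have mf n : measurable_fun setT (f n).
  apply/measurable_EFinP; apply: measurable_funM.
    by apply/measurable_EFinP; exact: measurable_int ig.
  exact: measurable_indic.
have lower n : ((ka / 32)%:E <= \int[mu2]_x f n x)%E.
  have m0 : 0 < n.+1%:R :> R by rewrite ltr0n.
  have kn0 : 0 <= ka / (32 * n.+1%:R ^+ 2).
    by apply: divr_ge0; [exact: ltW | rewrite mulr_ge0// sqr_ge0].
  apply: (@le_trans _ _ (\int[mu2]_x ((ka / (32 * n.+1%:R ^+ 2))%:E * (\1_(box n.+1%:R) x)%:E))%E).
    rewrite ge0_integralZl; [|by []|by apply/measurable_EFinP; exact: measurable_indic
      |by move=> x _; rewrite lee_fin|by rewrite lee_fin].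
    rewrite integral_indic// setIT [X in (_ * X)%E](_ : _ = (n.+1%:R ^+ 2)%:E); last exact: box_measure.
    rewrite -EFinM lee_fin le_eqVlt; apply/orP; left; apply/eqP.
    by field; rewrite gt_eqF.
  apply: ge0_le_integral => //.
  - by move=> x _; rewrite -EFinM lee_fin mulr_ge0.
  - apply: measurable_funeM; apply/measurable_EFinP; exact: measurable_indic.
  - move=> x _; rewrite -EFinM lee_fin indicE.
    have [xb|] := boolP (x \in box n.+1%:R); last by rewrite !mulr0.
    rewrite !mulr1 /g vsq_tail_kernel /ka [leLHS]mulrAC.
    apply: ler_wpM2r; first exact: vsq_ge0.
    apply: ler_wpM2l; first by rewrite invr_ge0 sqr_ge0.
    by apply: box_bound; [rewrite ler1n|exact/set_mem].
have lim0 : (\int[mu2]_x f n x)%E @[n --> \oo] --> (\int[mu2]_x (cst 0%E x))%E.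
  apply: (dominated_cvg measurableT mf _ _ ig) => //.
  - move=> x _; apply: cvg_near_cst.
    near=> n; rewrite /f indicE memNset ?mulr0// => -[/= ].
    rewrite in_itv/= => /andP[+ _] _; apply/negP; rewrite -ltNge.
    apply: (@le_lt_trans _ _ n%:R); last by rewrite ltr_nat.
    by near: n; exact: nbhs_infty_ger.
  - move=> n x _; rewrite gee0_abs ?lee_fin ?mulr_ge0// indicE.
    by case: (x \in _); rewrite ?mulr1 ?mulr0.
rewrite integral0 in lim0.
have /(lime_ge (cvgP _ lim0)) : \forall n \near \oo, ((ka / 32)%:E <= \int[mu2]_x f n x)%E.
  by apply: nearW.
rewrite (cvg_lim _ lim0)//; rewrite lee_fin leNgt => /negP; apply.
by rewrite divr_gt0.
Unshelve. all: by end_near.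
Qed.

End TailKernel.

Section Diagonalization.
Variable R : realType.
Implicit Types (x : plane R) (f g : vfield R).
Variables (zeta : 'I_2 -> plane R -> R) (B : mfield R).

Lemma vopE x i j : vop zeta B x i j = (Num.sqrt `|zeta i x|)%:C * B x i j.
Proof. by rewrite /vop /pwdiag mul_diag_mx !mxE. Qed.

Lemma UopE f x i : pwmul (Uop zeta) f x i 0 =
  (if 0 <= zeta i x then 1 else -1)%:C * f x i 0.
Proof. by rewrite /pwmul /Uop /pwdiag mul_diag_mx !mxE. Qed.

Lemma Uop_invol f x : pwmul (Uop zeta) (pwmul (Uop zeta) f) x = f x.
Proof.
apply/matrixP => i j; rewrite ord1 !UopE mulrA -rmorphM/=.
by case: ifP => _; rewrite ?mulr1 ?mulrNN ?mulr1 mul1r.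
Qed.

Lemma vsq_Uop f x : vsq (pwmul (Uop zeta) f x) = vsq (f x).
Proof.
apply: eq_bigr => i _; rewrite UopE cnormM cnormC.
by case: ifP => _; rewrite ?normrN normr1 mul1r.
Qed.

Lemma dot_Uop f g x : dot (pwmul (Uop zeta) f x) (g x) = dot (f x) (pwmul (Uop zeta) g x).
Proof.
apply: eq_bigr => i _; rewrite !UopE rmorphM/= mulrCA mulrA; congr (_ * _ * _).
by case: ifP => _; apply: complex_ext; rewrite !cReImE/= ?oppr0.
Qed.

Hypothesis mzeta : forall j, measurable_fun setT (zeta j).

Lemma measurable_vop : measurable_mx B -> measurable_mx (vop zeta B).
Proof.
move=> mB i j; suff : cmeasurable setT (fun x => vop zeta B x i j) by [].
under eq_fun do rewrite vopE; apply: cmeasurableM; last exact: mB.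
apply: cmeasurable_real; apply: (measurableT_comp (@measurable_sqrt R)).
by apply: measurableT_comp => //; exact: mzeta.
Qed.

Lemma L2_Uop f : L2 f -> L2 (pwmul (Uop zeta) f).
Proof.
move=> /L2P[mf f2]; apply/L2P; split; last by under eq_integral do rewrite vsq_Uop.
move=> i; under eq_fun do rewrite UopE; apply: cmeasurableM; last exact: mf.
apply: cmeasurable_real; apply: measurable_fun_ifT => //.
by apply: measurable_fun_ler => //; exact: mzeta.
Qed.

Lemma inner_Uop f g : inner (pwmul (Uop zeta) f) g = inner f (pwmul (Uop zeta) g).
Proof. by congr cintegral; apply/funext => x; exact: dot_Uop. Qed.

Lemma cnorm_unitary_le1 x i j : B x \is unitarymx -> cnorm (B x i j) <= 1.
Proof.
move=> /unitarymxP/matrixP/(_ i i); rewrite !mxE eqxx mulr1n => BB.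
have {BB} : \sum_k cnorm (B x i k) ^+ 2 = 1.
  apply: complexI; rewrite rmorph_sum/= -[RHS]BB; apply: eq_bigr => k _.
  by rewrite -mulJ !mxE.
rewrite (bigD1 j)//= => s1.
have s0 : 0 <= \sum_(k | k != j) cnorm (B x i k) ^+ 2 by apply: sumr_ge0 => k _; exact: sqr_ge0.
rewrite -(@ler_pXn2r _ 2)// ?nnegrE ?cnorm_ge0// expr1n -s1 lerDl.
exact: s0.
Qed.

(** zeta_i is a diagonal entry of B V B^t*, a sum of four terms in which the entries
    of the unitary matrix B are at most 1 in modulus. *)
Lemma zeta_le (V : mfield R) (m : R) x i : B x \is unitarymx ->
  V x = pwadj B x *m pwdiag zeta x *m B x ->
  (forall j k, cnorm (V x j k) <= m) -> `|zeta i x| <= 4 * m.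
Proof.
move=> uB VE Vm; have /unitarymxP BB := uB.
have D : pwdiag zeta x = B x *m V x *m pwadj B x.
  by rewrite VE !mulmxA BB mul1mx -mulmxA BB mulmx1.
have -> : `|zeta i x| = cnorm (pwdiag zeta x i i).
  by rewrite /pwdiag !mxE eqxx mulr1n cnormC.
have b1 j k : cnorm (B x j k) <= 1 by exact: cnorm_unitary_le1.
rewrite D mxE; apply: le_trans (cnorm_sum _) _.
have col k : cnorm ((B x *m V x) i k * pwadj B x k i) <= 2 * m.
  rewrite cnormM -[leRHS]mulr1; apply: ler_pM; rewrite ?cnorm_ge0//.
    rewrite mxE; apply: le_trans (cnorm_sum _) _; rewrite big_ord_recl big_ord1.
    have e j : cnorm (B x i j * V x j k) <= m.
      by rewrite cnormM -[leRHS]mul1r; apply: ler_pM; rewrite ?cnorm_ge0.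
    by apply: le_trans (lerD (e _) (e _)) _; lra.
  by rewrite mxE mxE cnormJ.
rewrite big_ord_recl big_ord1; apply: le_trans (lerD (col _) (col _)) _.
by lra.
Qed.

(** v is of the size of the square root of V, hence decays with the exponent
    beta / 2 > 1; the excess dl is capped to fit the range of
    [integral_absp_kernel]. *)
Lemma vop_decay (V : mfield R) (beta : R) : diagonalization V zeta B -> 2 < beta ->
  (exists c : R, forall x i j, `|V x i j| <= (c * japanese x `^ (- beta))%:C) ->
  exists dl C : R, [/\ 0 < dl < 2^-1, 0 <= C &
    forall x i j, cnorm (vop zeta B x i j) <= C * japanese x `^ (- (1 + dl))].
Proof.
move=> [_ _ uB VE] b2 [c Vc].
pose c' := Num.max c 0; have c'0 : 0 <= c' by rewrite le_max lexx orbT.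
pose dl : R := Num.min (beta / 2 - 1) 4^-1.
have dl1 : dl <= beta / 2 - 1 by rewrite ge_min lexx.
have dl2 : dl <= 4^-1 by rewrite ge_min lexx orbT.
have dl0 : 0 < dl by rewrite lt_min; apply/andP; split; lra.
exists dl, (Num.sqrt (4 * c')); split; [by apply/andP; split => //; lra|exact: sqrtr_ge0|].
move=> x i j; rewrite vopE cnormM cnormC ger0_norm ?sqrtr_ge0//.
rewrite -[leRHS]mulr1; apply: ler_pM; rewrite ?sqrtr_ge0 ?cnorm_ge0//; last exact: cnorm_unitary_le1.
have zb : `|zeta i x| <= 4 * (c' * japanese x `^ (- beta)).
  apply: (zeta_le (V := V)) => // j' k'; rewrite -lecR -cnormE; apply: le_trans (Vc _ _ _) _.
  by rewrite lecR; apply: ler_wpM2r; [exact: powR_ge0|rewrite le_max lexx].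
apply: le_trans (ler_wsqrtr zb) _; rewrite mulrA sqrtrM ?mulr_ge0//.
apply: ler_wpM2l; first exact: sqrtr_ge0.
have -> : japanese x `^ (- beta) = (japanese x `^ (- (beta / 2))) ^+ 2.
  rewrite expr2 -powRD; last by rewrite [japanese x == 0]gt_eqF ?implybT// japanese_gt0.
  by congr (_ `^ _); field.
rewrite sqrtr_sqr ger0_norm ?powR_ge0//; apply: japanese_powR_ge.
by lra.
Qed.

End Diagonalization.

(** * Kernels of T and T1 *)

Section Threshold.
Variables (R : realType) (zeta : 'I_2 -> plane R -> R) (B : mfield R) (dl C : R).
Hypothesis mzeta : forall j, measurable_fun setT (zeta j).
Hypothesis mB : measurable_mx B.
Hypothesis dl0 : 0 < dl < 2^-1.
Hypothesis C0 : 0 <= C.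
Hypothesis vb : forall x i j, cnorm (vop zeta B x i j) <= C * japanese x `^ (- (1 + dl)).
Implicit Types (f g : vfield R).
Local Notation v := (vop zeta B).
Local Notation vs f := (pwmul (pwadj v) f).
Local Notation T := (Top zeta B).

Let mv : measurable_mx v. Proof. exact: measurable_vop. Qed.

Lemma TopE f : T f = fun x => pwmul (Uop zeta) f x + 1 *: pwmul v (G00 (vs f)) x.
Proof. by apply/funext => x; rewrite scale1r. Qed.

Lemma L2_Top f : L2 f -> L2 (T f).
Proof.
move=> L2f; rewrite TopE; apply: L2D; first exact: L2_Uop.
exact: (L2_BirmanSchwinger dl0 C0).
Qed.

Lemma Top_symmetric f g : L2 f -> L2 g -> inner (T f) g = inner f (T g).
Proof.
move=> L2f L2g; have add (a b c d : vfield R) : L2 a -> L2 b -> L2 c -> L2 d ->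
    inner a g = inner f c -> inner b g = inner f d ->
    inner (fun x => a x + 1 *: b x) g = inner f (fun x => c x + 1 *: d x).
  move=> La Lb Lc Ld ac bd.
  by rewrite (innerDl 1 La Lb L2g) (innerDr 1 Lc Ld L2f) ac bd rmorph1.
rewrite !TopE; apply: add; [exact: L2_Uop|exact: (L2_BirmanSchwinger dl0 C0 mv vb L2f)|
  exact: L2_Uop|exact: (L2_BirmanSchwinger dl0 C0 mv vb L2g)|exact: inner_Uop|].
exact: (BirmanSchwinger_symmetric dl0 C0 mv vb L2f L2g).
Qed.

(** T f = 0 reads U f = - v G00 v* f, and U is an involution. *)
Lemma Top_ker f : aeq (T f) (fun=> 0) ->
  aeq f (pwmul (Uop zeta) (pwmul v (fun x => - G00 (vs f) x))).
Proof.
apply: filterS => x; rewrite /Top => /eqP; rewrite addr_eq0 => /eqP e.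
by rewrite -{1}(Uop_invol zeta f x) {1}/pwmul e /pwmul [in RHS]mulmxN.
Qed.

Lemma mean_aeq f g : L2 f -> L2 g -> aeq f g -> mean (vs f) = mean (vs g).
Proof.
move=> L2f L2g fg; have madj := measurable_pwadj mv.
apply/matrixP => i j; rewrite !mxE; apply: ae_eq_cintegral => //.
- exact: (measurable_pwmul madj (L2_measurable L2f)).
- exact: (measurable_pwmul madj (L2_measurable L2g)).
- by apply: filterS fg => x e _; rewrite /pwmul e.
Qed.

(** By [L2_G00_tail], -G00 v* f is in L^2 if and only if [tail_kernel] applied to the
    mean is. *)
Lemma L2_psi_iff f : L2 f -> L2 (fun x => - G00 (vs f) x) <-> mean (vs f) = 0.
Proof.
move=> L2f; have Ld := L2_G00_tail dl0 C0 mv vb L2f; split => [Lp|m0].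
  apply: tail_kernel_not_L2; have := L2D (-1) (L2Z (-1) Ld) Lp.
  congr L2; apply/funext => x; rewrite !scaleN1r opprK.
  by rewrite opprB addrNK.
have := L2Z (-1) Ld; congr L2; apply/funext => x.
by rewrite m0 mulmx0 subr0 scaleN1r.
Qed.

Variables S1 S2 : vfield R -> vfield R.
Hypothesis S1_riesz : riesz_projection0 (@L2 R) T S1.
Hypothesis S2_riesz : riesz_projection0 (range_L2 S1) (T1op zeta B S1) S2.
Hypothesis S2_le_S1 : proj_le S2 S1.

Let S1_L2 f : L2 f -> L2 (S1 f).
Proof. exact: (riesz_projection_mem S1_riesz). Qed.

Lemma range_S1P f : range_L2 S1 f <-> L2 f /\ aeq (T f) (fun=> 0).
Proof.
have D f' g' a : @L2 R f' -> L2 g' -> L2 (fun x => f' x + a *: g' x) by exact: L2D.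
split => [[L2f [g L2g fg]]|[L2f f0]]; split => //.
  have := riesz_projection_sub_ker (@subset_refl _ _) D L2_Top Top_symmetric S1_riesz L2g.
  have := symmetric_aeq (@subset_refl _ _) D L2_Top Top_symmetric L2f (S1_L2 L2g) fg.
  by apply: filterS2 => x /= -> ->.
exists f => //.
have := riesz_projection_ker (@subset_refl _ _) D L2_Top Top_symmetric S1_riesz L2f f0.
by apply: filterS => x ->.
Qed.

Let S1_L2_sub : range_L2 S1 `<=` @L2 R.
Proof. by move=> f []. Qed.

Let S1_id f : range_L2 S1 f -> aeq (S1 f) f.
Proof.
move=> /range_S1P[L2f f0].
exact: (riesz_projection_ker (@subset_refl _ _) (fun f g a => @L2D R f g a)
  L2_Top Top_symmetric S1_riesz).
Qed.

Let range_S1D f g a : range_L2 S1 f -> range_L2 S1 g ->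
  range_L2 S1 (fun x => f x + a *: g x).
Proof.
move=> /range_S1P[L2f f0] /range_S1P[L2g g0]; apply/range_S1P; split; first exact: L2D.
have := symmetric_linear (@subset_refl _ _) (fun f g a => @L2D R f g a)
  L2_Top Top_symmetric a L2f L2g.
by move: f0 g0; apply: filterS3 => x /= e1 e2 ->; rewrite e1 e2 scaler0 addr0.
Qed.

Let L2_vG11 f : L2 f -> L2 (pwmul v (G11 (vs f))).
Proof.
move=> L2f; have := L2_pwmul_cst dl0 mv vb (mean (vs f)); congr L2.
by apply/funext => x; rewrite /pwmul G11E.
Qed.

(** The range of S1 contains every S1 w with w in L^2. *)
Lemma T1op_range f : range_L2 S1 f -> range_L2 S1 (T1op zeta B S1 f).
Proof.
move=> [L2f _]; have L2w := L2_vG11 (S1_L2 L2f); split; first exact: S1_L2.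
by exists (pwmul v (G11 (vs (S1 f)))) => //; exact: aeW.
Qed.

(** S1 acts as the identity on its range: on the left it can be dropped because g is in
    the kernel of T, on the right because f is. *)
Lemma inner_T1op f g : range_L2 S1 f -> range_L2 S1 g ->
  inner (T1op zeta B S1 f) g = dot (mean (vs f)) (mean (vs g)).
Proof.
move=> Hf Hg; have [L2g g0] := (range_S1P g).1 Hg; have L2f := S1_L2_sub Hf.
have L2Sf := S1_L2 L2f.
rewrite (inner_riesz_projection (@subset_refl _ _) L2_Top Top_symmetric S1_riesz (L2_vG11 L2Sf) L2g g0).
by rewrite (inner_mean dl0 C0 mv vb L2Sf L2g) (mean_aeq L2Sf L2f (S1_id Hf)).
Qed.

Lemma T1op_symmetric f g : range_L2 S1 f -> range_L2 S1 g ->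
  inner (T1op zeta B S1 f) g = inner f (T1op zeta B S1 g).
Proof.
move=> Hf Hg; by rewrite inner_T1op// innerJ inner_T1op// -dotJ.
Qed.

(** Testing against f itself gives |mean|^2, while a vanishing mean makes T1 f
    orthogonal to itself. *)
Lemma T1op_ker f : range_L2 S1 f ->
  aeq (T1op zeta B S1 f) (fun=> 0) <-> mean (vs f) = 0.
Proof.
move=> Hf; have Hw := T1op_range Hf; split=> [w0|m0].
  apply: vsq_eq0; apply: complexI; rewrite -dotvv -inner_T1op//.
  rewrite (inner_aeql (S1_L2_sub Hw) (L20 R) (S1_L2_sub Hf) w0).
  by rewrite innerJ inner0r rmorph0.
apply: norm2_eq0; first exact: S1_L2_sub.
apply/eqP; rewrite -sqrf_eq0; apply/eqP/complexI; rewrite -innerff_norm inner_T1op// m0.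
by rewrite /dot big1// => i _; rewrite mxE mul0r.
Qed.

(** Elements S2 g with g outside S1 L^2 are covered by S2 g = S2 (S1 g), which brings
    the argument into the space where S2 is a Riesz projection. *)
Lemma range_S2P f : range_L2 S1 f -> range_L2 S2 f <-> mean (vs f) = 0.
Proof.
move=> Hf; have L2f := S1_L2_sub Hf.
have sub_ker := riesz_projection_sub_ker S1_L2_sub range_S1D T1op_range T1op_symmetric S2_riesz.
have ker_id := riesz_projection_ker S1_L2_sub range_S1D T1op_range T1op_symmetric S2_riesz.
apply: (iff_trans _ (T1op_ker Hf)); split => [[_ [g L2g fg]]|f0]; last first.
  by split => //; exists f => //; apply: filterS (ker_id _ Hf f0) => x ->.
have HSg : range_L2 S1 (S1 g).
  by split; [exact: S1_L2|exists g => //; exact: aeW].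
have HS2 := riesz_projection_mem S2_riesz HSg.
have [_ _ S21] := S2_le_S1 L2g.
have fS : aeq f (S2 (S1 g)) by move: fg S21; apply: filterS2 => x -> ->.
have := symmetric_aeq S1_L2_sub range_S1D T1op_range T1op_symmetric Hf HS2 fS.
by have := sub_ker _ HSg; apply: filterS2 => x /= -> ->.
Qed.

End Threshold.

Theorem lemma7p5 (R : realType) (beta : R) (V : mfield R)
    (zeta : 'I_2 -> plane R -> R) (B : mfield R)
    (S1 S2 : vfield R -> vfield R) (phi : vfield R)
    (V_measurable : measurable_mx V)
    (V_hermitian : forall x, V x \is hermsymmx)
    (beta_gt2 : 2 < beta)
    (V_decay : exists c : R, forall x i j,
       `|V x i j| <= (c * japanese x `^ (- beta))%:C)
    (V_diag : diagonalization V zeta B)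
    (S1_riesz : riesz_projection0 (@L2 R) (Top zeta B) S1)
    (S2_le_S1 : proj_le S2 S1)
    (S2_riesz : riesz_projection0 (range_L2 S1) (T1op zeta B S1) S2)
    (phi_S1 : range_L2 S1 phi) :
  let v := vop zeta B in
  let psi : vfield R := fun x => - G00 (pwmul (pwadj v) phi) x in
  aeq phi (pwmul (Uop zeta) (pwmul v psi)) /\ (range_L2 S2 phi <-> L2 psi).
Proof.
have [dl [C [dl0 C0 vb]]] := vop_decay V_diag beta_gt2 V_decay.
have [mzeta mB _ _] := V_diag.
have [L2phi phi0] := (range_S1P mzeta mB dl0 C0 vb S1_riesz phi).1 phi_S1.
move=> v psi; split; first exact: Top_ker.
rewrite (range_S2P mzeta mB dl0 C0 vb S1_riesz S2_riesz S2_le_S1 phi_S1).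
by rewrite (L2_psi_iff mzeta mB dl0 C0 vb L2phi).
Qed.
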